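(* If $\mathcal P$ is an atomic chiral $4$-polytope with regular facets and chiral vertex-figures, then its vertex-figures are atomic chiral polyhedra.
   Context: Tight: a polytope of type $\{p_1,\dots,p_{n-1}\}$ with exactly $2p_1\cdots p_{n-1}$ flags. A tight chiral $4$-polytope is atomic if it does not properly cover any tight chiral polytope. An atomic chiral polyhedron is a tight chiral polyhedron of type $\{p,q\}$ that covers no chiral polyhedron of type $\{p',q\}$ or $\{p,q'\}$ with $p'$ a proper divisor of $p$ or $q'$ a proper divisor of $q$. *)

(* Defs.v *)
From HB Require Import structures.
From mathcomp Require Import all_boot perm.

Set Implicit Arguments.
Unset Strict Implicit.
Unset Printing Implicit Defensive.

Section Polytopes.
Variables (T : finType) (le : rel T).

Definition ltp (x y : T) : bool := (x != y) && le x y.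

Definition partial_order : Prop :=
  [/\ reflexive le, antisymmetric le & transitive le].

Definition chain (C : {set T}) : bool :=
  [forall x in C, [forall y in C, le x y || le y x]].

(* rk x = (rank of the face x) + 2 : the maximal size of a chain of faces
   below x (this counts the least face F_{-1} and x itself). *)
Definition rk (x : T) : nat :=
  \max_(C : {set T} | chain C && (C \subset [set y | le y x])) #|C|.

Definition flag (C : {set T}) : bool :=
  chain C && [forall x, (x \notin C) ==> ~~ chain (x |: C)].

Definition adjacent (P Q : {set T}) : bool := #|P :\: Q| == 1.

Definition strongly_flag_connected : Prop :=
  forall P Q, flag P -> flag Q ->
    exists s : seq {set T},
      [/\ path adjacent P s, last P s = Q &
          all (fun L => flag L && (P :&: Q \subset L)) s].

Definition diamond : Prop :=
  forall F G, ltp F G -> rk G = (rk F).+2 ->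
    #|[set H | ltp F H && ltp H G]| = 2.

Definition polytope (n : nat) : Prop :=
  [/\ partial_order /\ (exists b, forall x, le b x),
      (exists t, forall x, le x t),
      (forall P, flag P -> #|P| = n.+2),
      diamond & strongly_flag_connected].

Definition is_aut (f : {perm T}) : Prop := forall x y, le (f x) (f y) = le x y.

Definition same_orbit (P Q : {set T}) : Prop :=
  exists f : {perm T}, is_aut f /\ f @: P = Q.

Definition regular : Prop :=
  forall P Q, flag P -> flag Q -> same_orbit P Q.

Definition chiral : Prop :=
  (forall P Q, flag P -> flag Q -> adjacent P Q -> ~ same_orbit P Q) /\
  exists P0 P1, [/\ flag P0, flag P1, ~ same_orbit P0 P1 &
                    forall P, flag P -> same_orbit P0 P \/ same_orbit P1 P].

(* Schlaefli type {p_1, ..., p_{n-1}}, ps = [:: p_1; ...; p_{n-1}]: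
   every section F/G with rank G = i-2, rank F = i+1 is a p_i-gon
   (has p_i vertices, i.e. faces of rank i-1). *)
Definition has_type (n : nat) (ps : seq nat) : Prop :=
  size ps = n.-1 /\
  forall (i : nat) (F G : T), 0 < i < n -> ltp G F -> rk G = i -> rk F = i + 3 ->
    #|[set H | ltp G H && ltp H F && (rk H == i.+1)]| = nth 0 ps i.-1.

Definition num_flags : nat := #|[set P : {set T} | flag P]|.

Definition tight (n : nat) (ps : seq nat) : Prop :=
  has_type n ps /\ num_flags = 2 * \prod_(p <- ps) p.

End Polytopes.

Definition covering (T1 T2 : finType) (le1 : rel T1) (le2 : rel T2)
    (h : T1 -> T2) : Prop :=
  [/\ (forall y, exists x, h x = y),
      (forall x, rk le2 (h x) = rk le1 x),
      (forall x y, le1 x y -> le2 (h x) (h y)) &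
      (forall P Q, flag le1 P -> flag le1 Q -> adjacent P Q ->
         adjacent (h @: P) (h @: Q))].

Definition covers (T1 T2 : finType) (le1 : rel T1) (le2 : rel T2) : Prop :=
  exists h : T1 -> T2, covering le1 le2 h.

Definition isomorphism (T1 T2 : finType) (le1 : rel T1) (le2 : rel T2)
    (h : T1 -> T2) : Prop :=
  bijective h /\ forall x y, le2 (h x) (h y) = le1 x y.

Definition properly_covers (T1 T2 : finType) (le1 : rel T1) (le2 : rel T2) : Prop :=
  exists h : T1 -> T2, covering le1 le2 h /\ ~ isomorphism le1 le2 h.

Definition facet_le (T : finType) (le : rel T) (F : T) : rel {x : T | le x F} :=
  fun x y => le (val x) (val y).

Definition vfig_le (T : finType) (le : rel T) (v : T) : rel {x : T | le v x} :=
  fun x y => le (val x) (val y).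

Definition atomic_chiral4 (T : finType) (le : rel T) : Prop :=
  exists ps : seq nat,
  [/\ polytope le 4, chiral le, tight le 4 ps &
      forall (T' : finType) (le' : rel T') (m : nat) (qs : seq nat),
        polytope le' m -> chiral le' -> tight le' m qs ->
        ~ properly_covers le le'].

Definition atomic_chiral_polyhedron (T : finType) (le : rel T) : Prop :=
  exists p q : nat,
  [/\ polytope le 3, chiral le, tight le 3 [:: p; q] &
      forall (T' : finType) (le' : rel T') (p' q' : nat),
        polytope le' 3 -> chiral le' ->
        (has_type le' 3 [:: p'; q] /\ p' %| p /\ p' != p) \/
        (has_type le' 3 [:: p; q'] /\ q' %| q /\ q' != q) ->
        ~ covers le le'].

(* Main.v *)
From HB Require Import structures.
From mathcomp Require Import all_boot all_fingroup ssralg all_solvable zify.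
Require Import Defs.

(** Let [Gamma] be the automorphism group, generated by the rotations [s1], [s2], [s3] of a base
flag.  Tightness means that [Gamma] factors uniquely as [<s1> <s2> <s3>], and the vertex stabiliser
is [G0 = <s2> <s3>].  Mirroring [s2 |-> s2^-1], [s3 |-> s3^-1] defines a subgroup of [G0 * G0]; its
second-coordinate kernel is the chirality group [Ch] of the vertex-figure, and a quotient of the
vertex-figure by a normal subgroup [N] contained in [<s2>] or [<s3>] is chiral only if [Ch] is not
contained in [N].  Likewise, a normal subgroup [K] of [Gamma] compatible with the factorisation
gives a tight quotient polytope, which is chiral unless [K] contains [Ch]; so atomicity forces every
such [K] to contain [Ch].

If the vertex-figure covers a chiral polyhedron in a forbidden way, the kernel [N] lies in [<s2>] or
[<s3>].  A subgroup of [<s3>] normal in [G0] is normal in [Gamma], and we are done.  If [N] lies in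
[<s2>], regularity of the facets makes [s3^2] fix all vertices, so [s3^2] lies in the core [C0] of
[G0].  One may take [N] of prime order [s]; then [Ch] has prime order [l <> s] and the normal closure
[L] of [N] centralises [C0].  By Ito's theorem [L'] is abelian; it is an [l]-group whose hull
[K = A1 B1] is determined by the action of [N].  The Hall [l]-subgroup of [<s2>] is then [B1], it is
inverted by [s3], and a Gaschuetz complement of [B1] in [G0] shows [Ch] meets [B1] trivially,
although it is contained in it. *)

Set Implicit Arguments.
Unset Strict Implicit.
Unset Printing Implicit Defensive.

(** * Flags and words *)

(** The hard case is a kernel [N] inside [<s2>]: nothing makes [s1] normalise it, so it yields no
    quotient of the whole polytope, and its normal closure [L] need not split along [<s1> <s2>]. The
    remedy is that every subgroup [Y] of [<s1> <s2>] normal in [Gamma] can be enlarged to a hull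
    that does split and whose order has no new prime divisors. Atomicity then puts [Ch] into the
    hull of every nontrivial such [Y]. Since [Ch] has prime order [l], the order of [Y] is divisible
    by [l], and a nilpotent [Y] is an [l]-group. This is why the derived group of [L] is an
    [l]-group, with the [s]-group [N] acting on it coprimely and nontrivially. The prime [l] turns
    out to be odd, because a group of order 2 has no nontrivial automorphism; oddness is used again
    in the power formula behind the cyclicity of [[~: K, N]], in the transfer argument, where the
    involution [s1 s2] must die, and in moving the complement so that it contains [s3]. *)

Section Chains.

Variables (T : finType) (le : rel T).
Implicit Types (x y z : T) (A B C P Q : {set T}).

Lemma chainP C : reflect {in C &, forall x y, le x y || le y x} (chain le C).
Proof.
apply: (iffP forall_inP) => [h x y Cx Cy | h x Cx].
  by have /forall_inP := h x Cx; apply.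
by apply/forall_inP => y Cy; apply: h.
Qed.

Lemma chainS C C' : C' \subset C -> chain le C -> chain le C'.
Proof.
move=> /subsetP sC /chainP h; apply/chainP => x y /sC Cx /sC Cy; exact: h.
Qed.

Lemma flag_chain P : flag le P -> chain le P.
Proof. by case/andP. Qed.

Lemma chain_flag C : chain le C -> exists2 P, flag le P & C \subset P.
Proof.
move=> chC; have [P /maxsetP[chP maxP] sCP] := maxset_exists chC.
exists P => //; rewrite /flag chP; apply/forall_inP => x xP.
apply/negP => /maxP/(_ (subsetUr _ _)) eP.
by move: xP; rewrite -eP !inE eqxx.
Qed.

Lemma flag_max P x : flag le P -> {in P, forall y, le x y || le y x} -> le x x -> x \in P.
Proof.
case/andP=> /chainP chP /forall_inP maxP h xx; apply: contraT => /maxP /chainP[].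
move=> y z /setU1P[->|Py] /setU1P[->|Pz]; rewrite ?xx ?h //; last exact: chP.
by rewrite orbC h.
Qed.

Variable n : nat.
Hypothesis po : partial_order le.
Hypothesis fs : forall P, flag le P -> #|P| = n.+2.

Let lexx : reflexive le. Proof. by case: po. Qed.
Let le_anti : antisymmetric le. Proof. by case: po. Qed.
Let le_trans : transitive le. Proof. by case: po. Qed.

Lemma card_chain C : chain le C -> #|C| <= n.+2.
Proof. by case/chain_flag=> P fP sCP; rewrite -(fs fP) subset_leq_card. Qed.

Lemma flag_card C : chain le C -> #|C| = n.+2 -> flag le C.
Proof.
case/chain_flag=> P fP sCP oC; suff -> : C = P by [].
by apply/eqP; rewrite eqEcard sCP (fs fP) oC /=.
Qed.

Lemma flag_sub P Q : flag le P -> flag le Q -> P \subset Q -> P = Q.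
Proof. by move=> fP fQ sPQ; apply/eqP; rewrite eqEcard sPQ !fs /=. Qed.

(** A chain below [x] and the part of [P] not below [x] together form a chain, of size at most
    [n.+2 = #|P|]; so no chain below [x] beats the initial segment of [P]. Ranks can thus be read
    off in any one flag. *)
Lemma rk_flag P x : flag le P -> x \in P -> rk le x = #|[set y in P | le y x]|.
Proof.
move=> fP Px; have /chainP chP := flag_chain fP.
set D := [set y in P | le y x]; apply/eqP; rewrite eqn_leq; apply/andP; split.
  apply/bigmax_leqP => C /andP[/chainP chC /subsetP sC].
  have sC' y : y \in C -> le y x by move/sC; rewrite inE.
  have tiU : C :&: (P :\: D) = set0.
    apply/setP=> y; rewrite !inE; case Cy: (y \in C) => //=.
    by rewrite sC' // andbT; case: (y \in P).
  have chU : chain le (C :|: (P :\: D)).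
    apply/chainP => y z.
    have hU u : u \in P :\: D -> u \in P /\ le x u.
      rewrite !inE => /andP[+ Pu]; rewrite Pu /=; split=> //.
      by have := chP _ _ Px Pu; rewrite (negbTE a) orbF.
    case/setUP=> [Cy|/hU[Py xy]] /setUP[Cz|/hU[Pz xz]].
    - exact: chC.
    - by rewrite (le_trans (sC' _ Cy) xz).
    - by rewrite (le_trans (sC' _ Cz) xy) orbT.
    exact: chP.
  have := card_chain chU; rewrite cardsU tiU cards0 subn0 -(fs fP).
  rewrite -(cardsID D P) (_ : P :&: D = D) ?leq_add2r //.
  by apply/setIidPr/subsetP => y; rewrite inE => /andP[].
have chD : chain le D by apply: chainS (flag_chain fP); apply/subsetP => y; rewrite inE => /andP[].
apply: (@leq_bigmax_cond _ _ (fun C : {set T} => #|C|) D); rewrite chD.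
by apply/subsetP => y; rewrite !inE => /andP[].
Qed.

Lemma chain2 x y : le x y -> chain le [set x; y].
Proof.
move=> xy; apply/chainP => u v /set2P[]-> /set2P[]->; rewrite ?lexx ?xy ?orbT //.
Qed.

Lemma flag2 x y : le x y -> exists P, [/\ flag le P, x \in P & y \in P].
Proof.
by case/chain2/chain_flag=> P fP /subsetP s; exists P; rewrite !s ?inE ?eqxx ?orbT.
Qed.

Lemma flag1 x : exists2 P, flag le P & x \in P.
Proof. by have [P [fP Px _]] := flag2 (lexx x); exists P. Qed.

Lemma le_rk x y : le x y -> rk le x <= rk le y.
Proof.
move=> xy; have [P [fP Px Py]] := flag2 xy; rewrite !(rk_flag fP) //.
by apply/subset_leq_card/subsetP => z; rewrite !inE => /andP[-> /le_trans->].
Qed.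

Lemma ltp_rk x y : ltp le x y -> rk le x < rk le y.
Proof.
case/andP=> nxy xy; have [P [fP Px Py]] := flag2 xy; rewrite !(rk_flag fP) //.
apply/proper_card/properP; split.
  by apply/subsetP => z; rewrite !inE => /andP[-> /le_trans->].
exists y; rewrite !inE Py ?lexx //=; apply: contra nxy => yx.
by apply/eqP/le_anti; rewrite xy.
Qed.

Lemma le_rk_eq x y : le x y -> rk le x = rk le y -> x = y.
Proof.
move=> xy e; apply/eqP/negPn/negP => nxy.
by have := @ltp_rk x y; rewrite /ltp nxy xy e ltnn => /(_ isT).
Qed.

Lemma flag_le P x y : flag le P -> x \in P -> y \in P -> le x y = (rk le x <= rk le y).
Proof.
move=> fP Px Py; apply/idP/idP => [|rxy]; first exact: le_rk.
have /chainP chP := flag_chain fP; case/orP: (chP _ _ Px Py) => // yx.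
suff -> : y = x by rewrite lexx.
by apply: le_rk_eq => //; apply/eqP; rewrite eqn_leq le_rk.
Qed.

Lemma flag_ltp P x y : flag le P -> x \in P -> y \in P -> ltp le x y = (rk le x < rk le y).
Proof.
move=> fP Px Py; apply/idP/idP => [|rxy]; first exact: ltp_rk.
rewrite /ltp (flag_le fP) // (ltnW rxy) andbT.
by apply: contraTneq rxy => ->; rewrite ltnn.
Qed.

Lemma flag_inj P x y : flag le P -> x \in P -> y \in P -> rk le x = rk le y -> x = y.
Proof. by move=> fP Px Py e; apply: le_rk_eq => //; rewrite (flag_le fP) // e. Qed.

Lemma rk_gt0 x : 0 < rk le x.
Proof.
have [P fP Px] := flag1 x; rewrite (rk_flag fP) // card_gt0; apply/set0Pn.
by exists x; rewrite inE Px lexx.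
Qed.

Lemma rk_max x : rk le x <= n.+2.
Proof.
have [P fP Px] := flag1 x; rewrite (rk_flag fP) // -(fs fP).
by apply/subset_leq_card/subsetP => y; rewrite inE => /andP[].
Qed.

(** Pigeonhole: [rk] is injective on a flag and takes values from 1 to [n.+2], which is the size of
    the flag. *)
Lemma flag_face P i : flag le P -> 0 < i <= n.+2 -> exists2 x, x \in P & rk le x = i.
Proof.
move=> fP /andP[i0 iN].
pose f x : 'I_n.+3 := inord (rk le x).
have vf x : f x = rk le x :> nat by rewrite inordK // ltnS rk_max.
have oI : #|f @: P| = n.+2.
  rewrite card_in_imset ?fs // => x y Px Py /(congr1 val) /=; rewrite !vf.
  exact: flag_inj fP Px Py.
have eI : f @: P = [set~ ord0].
  apply/eqP; rewrite eqEcard oI cardsC1 card_ord leqnn andbT.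
  apply/subsetP => _ /imsetP[x _ ->]; rewrite !inE -val_eqE /= vf.
  by rewrite -lt0n rk_gt0.
have : (Ordinal (iN : i < n.+3)) \in f @: P by rewrite eI !inE -val_eqE /= -lt0n.
by case/imsetP=> x Px /(congr1 val) /= e; exists x => //; rewrite -vf -e.
Qed.

Lemma flag_eq P Q : flag le P -> flag le Q -> {subset P <= Q} -> P = Q.
Proof. by move=> fP fQ s; apply: flag_sub => //; apply/subsetP. Qed.

Lemma card_interval P x y : flag le P -> x \in P -> y \in P -> le x y ->
  #|[set z in P | le x z && le z y]| + rk le x = (rk le y).+1.
Proof.
move=> fP Px Py xy; rewrite (rk_flag fP Px) (rk_flag fP Py).
have /chainP chP := flag_chain fP.
rewrite -(cardsID [set z | le x z] [set z in P | le z y]) -addnS; congr (_ + _).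
  by apply: eq_card => z; rewrite !inE; case: (z \in P); rewrite //= andbC.
rewrite (cardsD1 x) !inE Px lexx add1n; congr _.+1; apply: eq_card => z.
rewrite !inE; case Pz: (z \in P); rewrite ?andbF //=.
apply/andP/andP => [[nzx zx]|[nxz zy]].
  split; last exact: le_trans xy.
  by apply: contra nzx => xz; apply/eqP/le_anti; rewrite zx.
have := chP _ _ Px Pz; rewrite (negbTE nxz) /= => ->; split=> //.
by apply: contra nxz => /eqP->; apply: lexx.
Qed.

(** Adjacency at rank [i], weakened to allow equality and written as a one-sided inclusion; between
    flags it is symmetric by [agree_sym]. *)
Definition agree i A B := {in A, forall x, rk le x <> i -> x \in B}.

Lemma agree_eq i A B x y : flag le A -> flag le B -> agree i A B ->
  x \in A -> y \in B -> rk le x = rk le y -> rk le x <> i -> x = y.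
Proof. by move=> fA fB ag Ax By e ni; apply: (flag_inj fB) => //; apply: ag. Qed.

Lemma agree_sym i A B : flag le A -> flag le B -> agree i A B -> agree i B A.
Proof.
move=> fA fB ag y By ni.
have [|x Ax ex] := @flag_face A (rk le y) fA; first by rewrite rk_gt0 rk_max.
by rewrite -(agree_eq fA fB ag Ax By) ?ex.
Qed.

Lemma agree_face i A B x y : flag le A -> flag le B -> agree i A B ->
  x \in A -> y \in B -> rk le x = i -> rk le y = i -> x = y -> A = B.
Proof.
move=> fA fB ag Ax By ex ey exy; apply: flag_eq => // z Az.
have [ez|nz] := eqVneq (rk le z) i; last by apply: ag => //; apply/eqP.
by rewrite (flag_inj fA Az Ax) ?ez ?ex // exy.
Qed.

End Chains.

Section PolytopeBasics.

Variables (T : finType) (le : rel T) (n : nat).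
Hypothesis hP : polytope le n.
Implicit Types (x y z : T) (A B C P Q : {set T}).

Lemma polytope_po : partial_order le. Proof. by case: hP => -[]. Qed.
Lemma polytope_fs P : flag le P -> #|P| = n.+2. Proof. by case: hP => _ _ + _ _; apply. Qed.
Let po := polytope_po.
Let fs := polytope_fs.
Let lexx : reflexive le. Proof. by case: po. Qed.
Let le_anti : antisymmetric le. Proof. by case: po. Qed.
Let le_trans : transitive le. Proof. by case: po. Qed.

Lemma bottom_flag P x : flag le P -> rk le x = 1 -> x \in P.
Proof.
move=> fP r1; have [b hb] : exists b, forall x, le b x by case: hP => -[_].
have Pb : b \in P by apply: (flag_max fP); rewrite ?hb // => y _; rewrite hb.
suff <- : b = x by [].
apply: (le_rk_eq po fs) => //; apply/eqP; rewrite eqn_leq (le_rk po fs) //= r1.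
exact: rk_gt0 po fs _.
Qed.

Lemma top_flag P x : flag le P -> rk le x = n.+2 -> x \in P.
Proof.
move=> fP r1; have [t ht] : exists t, forall x, le x t by case: hP => _.
have Pt : t \in P by apply: (flag_max fP); rewrite ?ht // => y _; rewrite ht orbT.
suff -> : x = t by [].
apply: (le_rk_eq po fs) => //; apply/eqP; rewrite eqn_leq (le_rk po fs) //= r1.
exact: rk_max po fs _.
Qed.

(* Letters are the values of [rk] at proper faces: the letter of vertices is 2. *)
Definition letter i := 1 < i < n.+2.

Lemma agree_letter i A B : flag le A -> flag le B -> agree le i A B -> A <> B -> letter i.
Proof.
move=> fA fB ag nAB; rewrite /letter.
have [x Ax Bx] : exists2 x, x \in A & x \notin B.
  by apply/subsetPn; apply/negP => /(flag_sub fs fA fB).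
have ex : rk le x = i by apply/eqP; apply: contraR Bx => /eqP/ag; apply.
have r0 := rk_gt0 po fs x; have r1 := rk_max po fs x; rewrite ex in r0 r1.
have i1 : i != 1 by apply: contra Bx => /eqP e; apply: bottom_flag; rewrite // ex e.
have iN : i != n.+2 by apply: contra Bx => /eqP e; apply: top_flag; rewrite // ex e.
by lia.
Qed.

Lemma mid_unique F G x y y' : rk le G = (rk le F).+2 -> ltp le F G ->
  ltp le F x && ltp le x G -> ltp le F y && ltp le y G -> ltp le F y' && ltp le y' G ->
  y <> x -> y' <> x -> y = y'.
Proof.
move=> rG FG hx hy hy' nyx ny'x; apply/eqP/negPn/negP => nyy'.
have [_ _ _ dia _] := hP; have := dia F G FG rG.
have : #|x |: [set y; y']| = 3.
  by rewrite cardsU1 cards2 nyy' !inE !(eq_sym x) negb_or; do 2 (move/eqP: nyx => nyx; rewrite ?nyx); move/eqP: ny'x => ->.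
move=> o3 o2; have : x |: [set y; y'] \subset [set H | ltp le F H && ltp le H G].
  by apply/subsetP => z; rewrite !inE => /orP[/eqP->|/orP[]/eqP->].
by move/subset_leq_card; rewrite o2 o3.
Qed.

Lemma agree_mid i A B F G x y : flag le A -> flag le B -> agree le i A B -> letter i ->
  F \in A -> G \in A -> x \in A -> y \in B ->
  rk le F = i.-1 -> rk le G = i.+1 -> rk le x = i -> rk le y = i ->
  [/\ ltp le F G, rk le G = (rk le F).+2, ltp le F x && ltp le x G
    & ltp le F y && ltp le y G].
Proof.
move=> fA fB ag /andP[i1 iN] AF AG Ax By rF rG rx ry.
have BF : F \in B by apply: ag => //; rewrite rF; lia.
have BG : G \in B by apply: ag => //; rewrite rG => /eqP; rewrite eqn_leq ltnn.
have i0 : 0 < i by apply: ltn_trans i1.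
have i' : i.-1 < i by rewrite prednK.
split.
- by rewrite (flag_ltp po fs fA) // rF rG (ltn_trans i').
- by rewrite rG rF prednK.
- by rewrite !(flag_ltp po fs fA) // rF rG rx i' /=.
by rewrite !(flag_ltp po fs fB) // rF rG ry i' /=.
Qed.

Lemma letter_faces i A : flag le A -> letter i -> exists F G,
  [/\ F \in A, G \in A, rk le F = i.-1 & rk le G = i.+1].
Proof.
move=> fA /andP[i1 iN].
have [|F AF rF] := @flag_face _ _ _ po fs A i.-1 fA.
  by lia.
have [//|G AG rG] := @flag_face _ _ _ po fs A i.+1 fA.
by exists F, G.
Qed.

Lemma letter_face i A : flag le A -> letter i -> exists2 x, x \in A & rk le x = i.
Proof.
move=> fA /andP[i1 iN]; apply: (flag_face po fs fA).
by rewrite (ltn_trans _ i1) // ltnW.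
Qed.

Lemma flag_rk A x : flag le A -> exists2 y, y \in A & rk le y = rk le x.
Proof. by move=> fA; apply: (flag_face po fs fA); rewrite (rk_gt0 po fs) (rk_max po fs). Qed.

(** The default value [A] makes the operation total: on flags it is an involution, trivial when [i]
    is not a letter. *)
Definition swap i A := odflt A [pick Q | [&& flag le Q,
  [forall x in A, (rk le x != i) ==> (x \in Q)] & Q != A]].

Lemma swapP i A : flag le A ->
  flag le (swap i A) /\ agree le i A (swap i A).
Proof.
move=> fA; rewrite /swap; case: pickP => /= [Q /and3P[fQ /forall_inP ag _] | _]; last by split.
by split=> // x Ax /eqP nx; have /implyP := ag x Ax; apply.
Qed.

Lemma flag_swap i A : flag le A -> flag le (swap i A).
Proof. by case/(swapP i). Qed.

Lemma swap_agree i A : flag le A -> agree le i A (swap i A).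
Proof. by case/(swapP i). Qed.

Lemma swap_agree' i A : flag le A -> agree le i (swap i A) A.
Proof. by move=> fA; apply: (agree_sym po fs) => //; [apply: flag_swap | apply: swap_agree]. Qed.

(** Uniqueness half of the diamond condition: the faces of rank [i] of [Q] and of the exchanged flag
    both differ from that of [A] in the same two-element interval. *)
Lemma swap_unique i A Q : flag le A -> flag le Q -> agree le i A Q -> Q <> A -> Q = swap i A.
Proof.
move=> fA fQ ag nQA.
have li : letter i by apply: (agree_letter fA fQ ag) => e; apply: nQA.
have nS : swap i A <> A.
  rewrite /swap; case: pickP => /= [Q' /and3P[_ _ /eqP] // | /(_ Q)/negP[]].
  apply/and3P; split=> //; last by apply/eqP.
  by apply/forall_inP => x Ax; apply/implyP => /eqP; apply: ag.
have fS := flag_swap i fA; have agS := @swap_agree i A fA.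
have [F [G [AF AG rF rG]]] := letter_faces fA li.
have [x Ax rx] := letter_face fA li; have [y Qy ry] := letter_face fQ li.
have [z Sz rz] := letter_face fS li.
have [FG rFG hx hy] := agree_mid fA fQ ag li AF AG Ax Qy rF rG rx ry.
have [_ _ _ hz] := agree_mid fA fS agS li AF AG Ax Sz rF rG rx rz.
have eyz : y = z.
  apply: (mid_unique rFG FG hx hy hz) => e.
    by apply: nQA; symmetry; apply: (agree_face po fs fA fQ ag Ax Qy).
  by apply: nS; symmetry; apply: (agree_face po fs fA fS agS Ax Sz).
have agQS : agree le i Q (swap i A).
  by move=> u Qu nu; apply: agS => //; apply: (agree_sym po fs fA fQ ag).
exact: (agree_face po fs fQ fS agQS Qy Sz).
Qed.

(** Existence half of the diamond condition: the second face [y] between the neighbours of [x] is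
    comparable to the rest of [A], and replacing [x] by it gives a flag. *)
Lemma swap_neq i A : flag le A -> letter i -> swap i A <> A.
Proof.
move=> fA li; have [F [G [AF AG rF rG]]] := letter_faces fA li.
have [x Ax rx] := letter_face fA li.
have ag0 : agree le i A A by [].
have [FG rFG hx _] := agree_mid fA fA ag0 li AF AG Ax Ax rF rG rx rx.
have [_ _ _ dia _] := hP; have := dia F G FG rFG.
rewrite (cardsD1 x) inE hx add1n => -[] /eqP/cards1P[y ey].
have : y \in [set H | ltp le F H && ltp le H G] :\ x by rewrite ey set11.
rewrite !inE => /and3P[nyx Fy yG].
have cmp z : z \in A -> z != x -> le z y || le y z.
  move=> Az nzx; have nrz : rk le z != i.
    by apply: contra nzx => /eqP rz; apply/eqP; apply: (flag_inj po fs fA); rewrite ?rx.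
  have [zi|iz] := ltnP (rk le z) i.
    have zF : le z F.
      by rewrite (flag_le po fs fA) // rF -ltnS prednK //; case/andP: li => /ltnW.
    by rewrite (le_trans zF) //; case/andP: Fy.
  have Gz : le G z by rewrite (flag_le po fs fA) // rG ltn_neqAle eq_sym nrz.
  by rewrite orbC (le_trans _ Gz) //; case/andP: yG.
have nAy : y \notin A.
  apply: contra nyx => Ay; apply/eqP; apply: (flag_inj po fs fA) => //.
  apply/eqP; have := ltp_rk po fs Fy; have := ltp_rk po fs yG.
  rewrite rx eqn_leq rF rG ltnS => -> /=; rewrite prednK //.
  by case/andP: li => /ltnW.
pose Q := y |: (A :\ x).
have fQ : flag le Q.
  apply: (flag_card fs); last first.
    by rewrite cardsU1 !inE negb_and nAy orbT -(fs fA) (cardsD1 x A) Ax.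
  have /chainP chA := flag_chain fA; apply/chainP => u v.
  rewrite !inE => /orP[/eqP->|/andP[nu Au]] /orP[/eqP->|/andP[nv Av]].
  - by rewrite lexx.
  - by rewrite orbC cmp.
  - by rewrite cmp.
  exact: chA.
have agQ : agree le i A Q.
  move=> z Az nz; rewrite !inE Az andbT; apply/orP; right.
  by apply: contra_notN nz => /eqP->.
have nQA : Q <> A by move=> e; case/negP: nAy; rewrite -e !inE eqxx.
by rewrite -(swap_unique fA fQ agQ nQA).
Qed.

Lemma swap_id i A : flag le A -> ~~ letter i -> swap i A = A.
Proof.
move=> fA nl; apply/eqP/negPn/negP => /eqP ns.
case/negP: nl; apply: (agree_letter fA (flag_swap i fA) (@swap_agree i A fA)).
by move=> e; apply: ns.
Qed.

Lemma swapK i A : flag le A -> swap i (swap i A) = A.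
Proof.
move=> fA; have [li|nl] := boolP (letter i); last by rewrite !swap_id.
by apply/esym; apply: swap_unique; rewrite ?flag_swap //;
  [apply: swap_agree' | apply/nesym/swap_neq].
Qed.

Lemma swap_face_neq i A x y : flag le A -> letter i -> x \in A -> y \in swap i A ->
  rk le x = i -> rk le y = i -> y <> x.
Proof.
move=> fA li Ax Sy rx ry e; apply: (swap_neq fA li); apply/esym.
exact: (agree_face po fs fA (flag_swap i fA) (@swap_agree i A fA) Ax Sy).
Qed.

(** The new face is the second one between the neighbours [F] and [G], so it depends only on the
    faces of ranks [i - 1], [i] and [i + 1]; the hypothesis encodes this range with successors. *)
Lemma swap_local i A B y y' : flag le A -> flag le B -> letter i ->
  (forall u, u \in A -> i <= (rk le u).+1 <= i.+2 -> u \in B) ->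
  y \in swap i A -> y' \in swap i B -> rk le y = i -> rk le y' = i -> y = y'.
Proof.
move=> fA fB li AB Sy Sy' ry ry'.
have [F [G [AF AG rF rG]]] := letter_faces fA li.
have [x Ax rx] := letter_face fA li; have i1 : 1 < i by case/andP: li.
have BF : F \in B by apply: AB; rewrite // rF prednK ?(ltnW i1) // leqnn /= leqW.
have BG : G \in B by apply: AB; rewrite // rG leqnn andbT leqW.
have Bx : x \in B by apply: AB; rewrite // rx !leqnSn.
have [FG rFG hx hy] := agree_mid fA (flag_swap i fA) (@swap_agree i A fA) li AF AG Ax Sy rF rG rx ry.
have [_ _ _ hy'] := agree_mid fB (flag_swap i fB) (@swap_agree i B fB) li BF BG Bx Sy' rF rG rx ry'.
by apply: (mid_unique rFG FG hx hy hy');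
  [apply: (swap_face_neq fA li Ax Sy) | apply: (swap_face_neq fB li Bx Sy')].
Qed.

(** By [swap_local], the face exchanged at [j] is the same before and after an exchange at a letter
    at least two steps away. *)
Lemma swapC i j A : flag le A -> i.+1 < j -> swap i (swap j A) = swap j (swap i A).
Proof.
move=> fA ij; have [li|nl] := boolP (letter i); last by rewrite !(@swap_id i) ?flag_swap.
have [lj|nl] := boolP (letter j); last by rewrite !(@swap_id j) ?flag_swap.
have [fi fj] := (flag_swap i fA, flag_swap j fA).
have [fij fji] := (flag_swap j fi, flag_swap i fj).
apply/esym; apply: swap_unique => //.
  move=> z Cz nz; have [rz|nj] := eqVneq (rk le z) j; last first.
    have Az : z \in A by apply: (@swap_agree' j A fA z Cz); apply/eqP.
    by apply: (swap_agree fi); [apply: (swap_agree fA) | apply/eqP].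
  have [y Qy ry] := letter_face fij lj.
  suff -> : z = y by [].
  apply: (@swap_local j A (swap i A) z y) => // u Au ru.
  by apply: swap_agree => // e; lia.
move=> e; have [x Ax rx] := letter_face fA li; have [y Sy ry] := letter_face fi li.
have Cx : x \in swap j A by apply: swap_agree => //; lia.
have Qy : y \in swap j (swap i A) by apply: swap_agree => //; lia.
apply: (swap_face_neq fA li Ax Sy rx ry).
by apply: (flag_inj po fs fj); rewrite ?rx ?ry // -e.
Qed.

Definition run A w := foldl (fun B i => swap i B) A w.

Lemma run_cat A w w' : run A (w ++ w') = run (run A w) w'.
Proof. exact: foldl_cat. Qed.

Lemma flag_run A w : flag le A -> flag le (run A w).
Proof. by elim: w A => //= i w IH A fA; apply/IH/flag_swap. Qed.

Lemma run_keep A w x : flag le A -> x \in A -> rk le x \notin w -> x \in run A w.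
Proof.
elim: w A => //= i w IH A fA Ax; rewrite inE negb_or => /andP[/eqP ni nw].
by apply: IH; rewrite ?flag_swap //; apply: swap_agree.
Qed.

Lemma run_rev A w : flag le A -> run (run A w) (rev w) = A.
Proof.
elim: w A => //= i w IH A fA; rewrite rev_cons -cats1 run_cat IH ?flag_swap //=.
exact: swapK.
Qed.

Lemma adj_swap A Q : flag le A -> flag le Q -> adjacent A Q ->
  exists2 i, letter i & Q = swap i A.
Proof.
move=> fA fQ /cards1P[x ex].
have Ax : x \in A :\: Q by rewrite ex set11.
have nQA : Q <> A by move=> e; move: Ax; rewrite e setDv inE.
have ag : agree le (rk le x) A Q.
  move=> z Az nz; apply: contra_notT nz => nQz.
  by have : z \in A :\: Q by [rewrite inE nQz]; rewrite ex => /set1P->.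
exists (rk le x); first by apply: (agree_letter fA fQ ag) => e; apply: nQA.
exact: swap_unique.
Qed.

Lemma swap_adj i A : flag le A -> letter i -> adjacent A (swap i A).
Proof.
move=> fA li; have [x Ax rx] := letter_face fA li; apply/cards1P; exists x.
apply/setP => z; rewrite !inE; apply/andP/eqP => [[nz Az] | ->].
  apply: (flag_inj po fs fA) => //; rewrite rx; apply/eqP.
  by apply: contraR nz => /eqP; apply: swap_agree.
split=> //; apply/negP => Sx.
exact: (swap_face_neq fA li Ax Sx).
Qed.

(** All flags on a path given by strong connectivity contain [A :&: B], so no step exchanges a
    common face. Connectivity is later used in this form: a word avoiding the ranks of common
    faces. *)
Lemma connect A B : flag le A -> flag le B -> exists w,
  [/\ all letter w, run A w = B & forall i x, i \in w -> x \in A -> x \in B -> rk le x <> i].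
Proof.
move=> fA fB; have [_ _ _ _ con] := hP; have [s [ps lst als]] := con A B fA fB.
suff [w [lw rw hw]] : exists w, [/\ all letter w, run A w = last A s
    & forall i x, i \in w -> x \in A :&: B -> rk le x <> i].
  exists w; split=> // [|i x iw Ax Bx]; first by rewrite rw.
  by apply: (hw i); rewrite // inE Ax.
move: (A :&: B) (subsetIl A B) als => I; clear lst B fB.
elim: s A fA ps => [|Q s IH] A fA /=; first by exists [::].
case/andP=> adj ps sIA /andP[/andP[fQ sIQ] als].
have [i li eQ] := adj_swap fA fQ adj.
have [w [lw rw hw]] := IH Q fQ ps sIQ als.
exists (i :: w); rewrite /= li lw -eQ; split=> // j x.
rewrite inE => /orP[/eqP->|jw] Ix; last exact: hw.
move=> rx; apply: (@swap_face_neq i A x x) => //; first exact: (subsetP sIA).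
by rewrite -eQ (subsetP sIQ).
Qed.

End PolytopeBasics.

(** * Flag maps and automorphisms *)

(** Common ground of coverings and automorphisms: maps equivariant for the flag exchanges, hence
    determined by the image of a single flag. *)
Definition flag_map (T1 T2 : finType) (le1 : rel T1) (le2 : rel T2) (n : nat)
    (h : T1 -> T2) : Prop :=
  [/\ forall x, rk le2 (h x) = rk le1 x,
      forall A, flag le1 A -> flag le2 (h @: A) &
      forall A i, flag le1 A -> letter n i -> h @: swap le1 i A = swap le2 i (h @: A)].

Lemma adjacent_neq (T : finType) (P Q : {set T}) : adjacent P Q -> P <> Q.
Proof. by move=> + e; rewrite e /adjacent setDv cards0. Qed.

Section Maps.

Variables (T1 T2 : finType) (le1 : rel T1) (le2 : rel T2) (n : nat).
Hypotheses (hP1 : polytope le1 n) (hP2 : polytope le2 n).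
Let po1 := polytope_po hP1.
Let po2 := polytope_po hP2.
Let fs1 := polytope_fs hP1.
Let fs2 := polytope_fs hP2.

Lemma flag_map_intro (h : T1 -> T2) :
  (forall x, rk le2 (h x) = rk le1 x) -> (forall x y, le1 x y -> le2 (h x) (h y)) ->
  (forall A i, flag le1 A -> letter n i -> h @: swap le1 i A <> h @: A) ->
  flag_map le1 le2 n h.
Proof.
move=> rkh mh adj.
have fh A : flag le1 A -> flag le2 (h @: A).
  move=> fA; apply: (flag_card fs2).
    apply/chainP => _ _ /imsetP[x Ax ->] /imsetP[y Ay ->].
    by have /chainP/(_ x y Ax Ay)/orP[/mh->|/mh->] := flag_chain fA; rewrite ?orbT.
  rewrite card_in_imset ?fs1 // => x y Ax Ay e.
  by apply: (flag_inj po1 fs1 fA) => //; rewrite -!rkh e.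
split=> // A i fA li; apply: (swap_unique hP2); [exact: fh | | | exact: adj].
  by apply: fh; apply: flag_swap.
move=> _ /imsetP[x Ax ->]; rewrite rkh => nx; apply: imset_f.
exact: (swap_agree fA).
Qed.

Lemma covering_flag_map h : covering le1 le2 h -> flag_map le1 le2 n h.
Proof.
case=> _ rkh mh adj; apply: flag_map_intro => // A i fA li /esym.
by apply: adjacent_neq; apply: adj; rewrite ?flag_swap ?(swap_adj hP1).
Qed.

Lemma flag_map_run h A w : flag_map le1 le2 n h -> flag le1 A -> all (letter n) w ->
  h @: run le1 A w = run le2 (h @: A) w.
Proof.
case=> _ _ hs; elim: w A => //= i w IH A fA /andP[li lw].
by rewrite IH ?flag_swap // hs.
Qed.

Lemma flag_map_face h A x y : flag_map le1 le2 n h -> flag le1 A -> x \in A ->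
  y \in h @: A -> rk le2 y = rk le1 x -> h x = y.
Proof.
move=> [rkh fh _] fA Ax Hy e; apply: (flag_inj po2 fs2 (fh _ fA)); rewrite ?imset_f //.
by rewrite rkh.
Qed.

(** Every flag is reached from [A] by a word, and flag maps commute with words. For automorphisms
    this is freeness of the action on flags. *)
Lemma flag_map_eq h1 h2 A : flag_map le1 le2 n h1 -> flag_map le1 le2 n h2 ->
  flag le1 A -> h1 @: A = h2 @: A -> h1 =1 h2.
Proof.
move=> m1 m2 fA e x; have [B fB Bx] := flag1 po1 x.
have [w [lw rw _]] := connect hP1 fA fB.
apply: (flag_map_face m1 fB Bx); last by case: m2 => ->.
by rewrite -rw (flag_map_run m1) // e -(flag_map_run m2) // rw imset_f.
Qed.

End Maps.

Lemma flag_map_comp (T1 T2 T3 : finType) (le1 : rel T1) (le2 : rel T2) (le3 : rel T3) n f g :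
  flag_map le1 le2 n f -> flag_map le2 le3 n g -> flag_map le1 le3 n (g \o f).
Proof.
move=> [rf ff sf] [rg fg sg]; split=> [x|A fA|A i fA li]; first by rewrite /= rg rf.
  by rewrite (imset_comp g f); apply/fg/ff.
by rewrite !(imset_comp g f) sf // sg //; apply: ff.
Qed.

Section Automorphisms.

Variables (T : finType) (le : rel T) (n : nat).
Hypothesis hP : polytope le n.
Let po := polytope_po hP.
Let fs := polytope_fs hP.
Implicit Types (f g : {perm T}) (A B : {set T}).

Lemma aut_flag f A : is_aut le f -> flag le A -> flag le (f @: A).
Proof.
move=> af fA; apply: (flag_card fs); last by rewrite card_imset ?fs //; apply: perm_inj.
apply/chainP => _ _ /imsetP[x Ax ->] /imsetP[y Ay ->]; rewrite !af.
by have /chainP := flag_chain fA; apply.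
Qed.

Lemma aut_rk f x : is_aut le f -> rk le (f x) = rk le x.
Proof.
move=> af; have [A fA Ax] := flag1 po x.
rewrite (rk_flag po fs fA Ax) (rk_flag po fs (aut_flag af fA)) ?imset_f //.
rewrite -[RHS](card_imset _ (@perm_inj _ f)); apply: eq_card => y.
apply/idP/imsetP => [|[z]]; rewrite !inE.
  by case/andP=> /imsetP[z Az ->] zx; exists z; rewrite // !inE Az -af.
by case/andP=> Az zx ->; rewrite imset_f // af.
Qed.

Lemma aut_flag_map f : is_aut le f -> flag_map le le n f.
Proof.
move=> af; apply: (flag_map_intro hP hP) => [x|x y|A i fA li].
- exact: aut_rk.
- by rewrite af.
by move/(imset_inj (@perm_inj _ f)); apply: (swap_neq hP).
Qed.

Lemma aut_run f A w : is_aut le f -> flag le A -> all (letter n) w ->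
  f @: run le A w = run le (f @: A) w.
Proof. by move=> af; apply: flag_map_run; apply: aut_flag_map. Qed.

Lemma aut_eq f g A : is_aut le f -> is_aut le g -> flag le A -> f @: A = g @: A -> f = g.
Proof.
move=> af ag fA e; apply/permP.
by apply: (flag_map_eq hP hP (aut_flag_map af) (aut_flag_map ag) fA e).
Qed.

Definition autg : {set {perm T}} :=
  [set f : {perm T} | [forall x, forall y, le (f x) (f y) == le x y]].

Lemma autgP f : reflect (is_aut le f) (f \in autg).
Proof.
rewrite inE; apply: (iffP forallP) => [h x y|h x].
  by have /forallP/(_ y)/eqP := h x.
by apply/forallP => y; rewrite h.
Qed.

Lemma autg_group_set : group_set autg.
Proof.
apply/group_setP; split=> [|f g /autgP af /autgP ag].
  by apply/autgP => x y; rewrite !perm1.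
by apply/autgP => x y; rewrite !permM ag af.
Qed.
Canonical autg_group := Group autg_group_set.

Lemma aut_imsetM f g A : (f * g)%g @: A = g @: (f @: A).
Proof. by rewrite -imset_comp; apply: eq_imset => x; rewrite permM. Qed.

Lemma aut_imset1 A : (1%g : {perm T}) @: A = A.
Proof. by rewrite -[RHS]imset_id; apply: eq_imset => x; rewrite perm1. Qed.

Lemma aut_imsetV f A B : f @: A = B -> (f^-1)%g @: B = A.
Proof. by move=> <-; rewrite -aut_imsetM mulgV aut_imset1. Qed.

Lemma aut_face f A x y : is_aut le f -> flag le A -> x \in A -> y \in f @: A ->
  rk le y = rk le x -> f x = y.
Proof. by move=> af; apply: (flag_map_face hP); apply: aut_flag_map. Qed.

(* The automorphism sends the face of rank i of [run A w] to the face of rank i of [run B w]. *)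
Lemma extend_flag A B : flag le A -> flag le B ->
  (forall w, all (letter n) w -> run le A w = A -> run le B w = B) ->
  exists2 f : {perm T}, is_aut le f & f @: A = B.
Proof.
move=> fA fB H.
(* Two words reaching flags through [x] differ by a word [u] avoiding the letter [rk x]; carried
   over to [B], it also keeps the face of that rank, so the choice of word does not matter. *)
have wd w w' x y y' : all (letter n) w -> all (letter n) w' ->
    x \in run le A w -> x \in run le A w' -> y \in run le B w -> y' \in run le B w' ->
    rk le y = rk le x -> rk le y' = rk le x -> y = y'.
  move=> lw lw' xw xw' yw yw' ry ry'.
  have fl C v : flag le C -> flag le (run le C v) by apply: flag_run.
  have [u [lu ru hu]] := connect hP (fl _ w fA) (fl _ w' fA).
  have eA : run le A (w ++ u ++ rev w') = A by rewrite !run_cat ru (run_rev hP).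
  have eB : run le B (w ++ u ++ rev w') = B.
    by apply: H => //; rewrite !all_cat lw lu all_rev.
  have eB' : run le (run le B w) u = run le B w'.
    rewrite -[in RHS]eB !run_cat -{2}(revK w') (run_rev hP) //.
    by apply/fl/fl.
  apply: (flag_inj po fs (fl _ w' fB)) => //; last by rewrite ry ry'.
  rewrite -eB'; apply: run_keep => //; first exact: fl.
  by apply/negP => /hu/(_ xw xw'); rewrite ry.
have exw x : exists w, all (letter n) w && (x \in run le A w).
  have [C fC Cx] := flag1 po x; have [w [lw rw _]] := connect hP fA fC.
  by exists w; rewrite lw rw.
have exf x : exists y, (y \in run le B (xchoose (exw x))) && (rk le y == rk le x).
  have [y By ry] := flag_rk hP x (flag_run (xchoose (exw x)) fB).
  by exists y; rewrite By ry eqxx.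
pose f x := xchoose (exf x).
have fP x w : all (letter n) w -> x \in run le A w -> f x \in run le B w /\ rk le (f x) = rk le x.
  move=> lw xw; have /andP[fx /eqP rfx] := xchooseP (exf x).
  have /andP[lwx xwx] := xchooseP (exw x); split=> //.
  have [y By ry] := flag_rk hP x (flag_run w fB).
  by rewrite (wd _ _ x (f x) y lwx lw).
have mono x y : le x y -> le (f x) (f y).
  move=> xy; have [C [fC Cx Cy]] := flag2 po xy; have [w [lw rw _]] := connect hP fA fC.
  have [|fx rx] := fP x w lw; first by rewrite rw.
  have [|fy ry] := fP y w lw; first by rewrite rw.
  rewrite (flag_le po fs _ fx fy); last exact: flag_run.
  by rewrite rx ry (le_rk po fs).
have surj y : exists x, f x == y.
  have [C fC Cy] := flag1 po y; have [w [lw rw _]] := connect hP fB fC.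
  have [x Ax rx] := flag_rk hP y (flag_run w fA).
  exists x; have [fx rfx] := fP x w lw Ax; apply/eqP; apply: (flag_inj po fs fC).
  - by rewrite -rw.
  - by [].
  by rewrite rfx.
pose g y := xchoose (surj y).
have gK : cancel g f by move=> y; apply/eqP; apply: (xchooseP (surj y)).
have [g' g'K Kg'] := injF_bij (can_inj gK).
have fg' : f =1 g' by move=> x; rewrite -{1}(Kg' x) gK.
have injf : injective f by move=> x y; rewrite !fg' => /(can_inj Kg').
pose p := perm injf.
(* The inverse of [p] is a power of [p], so it preserves the order as well. *)
have monoX k x y : le x y -> le ((p ^+ k)%g x) ((p ^+ k)%g y).
  by elim: k => [|k IH] xy; rewrite ?expg0 ?perm1 // !expgSr !permM !permE; apply/mono/IH.
have ap : is_aut le p.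
  move=> x y; apply/idP/idP => [h|]; last by rewrite !permE; apply: mono.
  by have := monoX #[p]%g.-1 _ _ h; rewrite -invg_expg !permK.
exists p => //; apply: (flag_eq fs) => //; first exact: aut_flag.
by move=> _ /imsetP[x Ax ->]; rewrite permE; case: (fP x [::]).
Qed.

(** Carries the path spelled by [w] along [F], later the trace on a section or the projection to a
    quotient. The letters of [w] avoid the ranks of [I], so every flag on the way contains [I]. *)
Lemma run_path (T' : finType) (F : {set T} -> {set T'}) (I A : {set T}) w :
  flag le A -> I \subset A -> all (letter n) w ->
  (forall i x, i \in w -> x \in I -> rk le x <> i) ->
  (forall B i, flag le B -> I \subset B -> i \in w -> letter n i ->
     adjacent (F B) (F (swap le i B))) ->
  exists s, [/\ path (@adjacent T') (F A) s, last (F A) s = F (run le A w)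
    & forall L, L \in s -> exists B, [/\ flag le B, I \subset B & L = F B]].
Proof.
elim: w A => [|i w IH] A fA sIA /=; first by exists [::].
case/andP=> li lw avoid adj.
have fS := flag_swap i fA.
have sIS : I \subset swap le i A.
  apply/subsetP => x Ix; apply: (swap_agree fA); first exact: (subsetP sIA).
  by apply: avoid; rewrite ?inE ?eqxx.
have [||s [ps ls hs]] := IH _ fS sIS lw.
- by move=> j x jw; apply: avoid; rewrite inE jw orbT.
- by move=> B j fB sB jw lj; apply: adj; rewrite // inE jw orbT.
exists (F (swap le i A) :: s); split=> //=.
  by rewrite ps adj // inE eqxx.
by move=> L; rewrite inE => /orP[/eqP->|/hs //]; exists (swap le i A).
Qed.

End Automorphisms.

(** * Chiral polytopes *)

Section Words.

Variables (T : finType) (le : rel T) (n : nat).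
Hypothesis hP : polytope le n.
Let po := polytope_po hP.
Let fs := polytope_fs hP.
Implicit Types (f g h : {perm T}) (A B C : {set T}) (w u v : seq nat).
Local Notation autG := (autg_group le).
Local Notation run := (run le).

Lemma same_orbitP A B : same_orbit le A B <-> exists2 g, g \in autG & g @: A = B.
Proof.
by split=> [[g [/autgP ag e]]|[g /autgP ag e]]; exists g.
Qed.

Lemma same_orbit_sym A B : same_orbit le A B -> same_orbit le B A.
Proof.
move/same_orbitP=> [g Gg e]; apply/same_orbitP.
by exists (g^-1)%g; rewrite ?groupV // (aut_imsetV e).
Qed.

Lemma same_orbit_trans B A C : same_orbit le A B -> same_orbit le B C -> same_orbit le A C.
Proof.
move=> /same_orbitP[g Gg eg] /same_orbitP[h Gh eh]; apply/same_orbitP.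
by exists (g * h)%g; rewrite ?groupM // aut_imsetM eg.
Qed.

Lemma autG_run g A w : g \in autG -> flag le A -> all (letter n) w ->
  g @: run A w = run (g @: A) w.
Proof. by move/autgP; apply: (aut_run hP). Qed.

Lemma autG_inj g h A : g \in autG -> h \in autG -> flag le A -> g @: A = h @: A -> g = h.
Proof. by move=> /autgP ag /autgP ah; apply: (aut_eq hP). Qed.

Lemma run_mul g h A u v : g \in autG -> h \in autG -> flag le A ->
  all (letter n) u -> all (letter n) v ->
  g @: A = run A u -> h @: A = run A v -> (g * h)%g @: A = run A (v ++ u).
Proof. by move=> Gg Gh fA lu lv eg eh; rewrite aut_imsetM eg autG_run // eh -run_cat. Qed.

Lemma run_inv g A u : g \in autG -> flag le A -> all (letter n) u ->
  g @: A = run A u -> (g^-1)%g @: A = run A (rev u).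
Proof.
move=> Gg fA lu eg; apply: (@imset_inj _ _ g); first exact: perm_inj.
rewrite -aut_imsetM mulVg aut_imset1 autG_run ?all_rev // eg.
by rewrite (run_rev hP).
Qed.

Section PairWords.

Variables (A A' : {set T}) (D : {group {perm T} * {perm T}}) (I : pred nat) (c : nat).
Hypotheses (fA : flag le A) (fA' : flag le A') (lc : letter n c).
Hypothesis gens : forall i, I i -> letter n i -> exists g h,
  [/\ (g, h) \in D, g \in autG, h \in autG, g @: A = run A [:: i; c]
    & h @: A' = run A' [:: i; c]].

(** Each pair of letters passes through the fixed letter [c]: the inverse of the element for
    [[:: j; c]], followed by the element for [[:: i; c]], realises [[:: i; j]]. Two flags are
    followed at once so that [D] can be a group of mirrored pairs. *)
Lemma pair_words w : all (letter n) w -> all I w -> ~~ odd (size w) -> exists g h,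
  [/\ (g, h) \in D, g \in autG, h \in autG, g @: A = run A w & h @: A' = run A' w].
Proof.
have [m] := ubnP (size w); elim: m w => // m IH [|i [|j w]] //= szw.
  by exists 1%g, 1%g; rewrite !aut_imset1 !group1; split=> //; apply: (group1 D).
case/and3P=> li lj lw /and3P[Ii Ij Iw]; rewrite negbK => ew.
have [|g [h [Dgh Gg Gh eg eh]]] := IH w _ lw Iw ew; first exact: ltnW szw.
have [gi [hi [Di Ggi Ghi egi ehi]]] := gens Ii li.
have [gj [hj [Dj Ggj Ghj egj ehj]]] := gens Ij lj.
have key (B : {set T}) (k ki kj : {perm T}) : flag le B ->
    k \in autG -> ki \in autG -> kj \in autG ->
    k @: B = run B w -> ki @: B = run B [:: i; c] -> kj @: B = run B [:: j; c] ->
    (k * (kj^-1 * ki))%g @: B = run B (i :: j :: w).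
  move=> fB Gk Gki Gkj ek eki ekj.
  have ekjV := run_inv Gkj fB (_ : all (letter n) [:: j; c]) ekj.
  have eij : (kj^-1 * ki)%g @: B = run B [:: i; j].
    rewrite (run_mul _ _ fB _ _ (ekjV _) eki) ?groupV //= ?lj ?li ?lc //.
    by rewrite (swapK hP) // flag_swap.
  by rewrite (run_mul _ _ fB _ _ ek eij) ?groupM ?groupV //= ?li ?lj.
exists (g * (gj^-1 * gi))%g, (h * (hj^-1 * hi))%g; split; rewrite ?groupM ?groupV //.
- exact: (groupM Dgh (groupM (groupVr Dj) Di)).
- exact: key.
exact: key.
Qed.

End PairWords.

Lemma words_in A (H : {group {perm T}}) (I : pred nat) c w :
  flag le A -> letter n c -> H \subset autG ->
  (forall i, I i -> letter n i -> exists2 g, g \in H & g @: A = run A [:: i; c]) ->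
  all (letter n) w -> all I w -> ~~ odd (size w) -> exists2 g, g \in H & g @: A = run A w.
Proof.
move=> fA lc sH gens lw Iw ew.
have [|g [h [+ _ _ eg _]]] := @pair_words A A (setX_group H H) I c fA fA lc _ w lw Iw ew.
  move=> i Ii li; have [g Hg eg] := gens i Ii li.
  by exists g, g; rewrite inE /= Hg (subsetP sH).
by rewrite inE /= => /andP[Hg _]; exists g.
Qed.

End Words.

Lemma letter_neighbours j : 1 < j ->
  [/\ j.-1 != j, j.-1 != j.+1, j.+2 != j, j.+2 != j.+1 & j.-1 < j].
Proof. by move=> h; split; lia. Qed.

Section Chiral.

Variables (T : finType) (le : rel T) (n : nat).
Hypotheses (hP : polytope le n) (hC : chiral le).
Let po := polytope_po hP.
Let fs := polytope_fs hP.
Implicit Types (f g h : {perm T}) (A B C : {set T}) (w u v : seq nat).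
Local Notation autG := (autg_group le).
Local Notation run := (run le).
Local Notation swap := (swap le).

Lemma two_orbits A B C : flag le A -> flag le B -> flag le C ->
  ~ same_orbit le A B -> ~ same_orbit le B C -> same_orbit le A C.
Proof.
case: hC => _ [P0 [P1 [_ _ _ h]]] fA fB fC nAB nBC.
have j (P X Y : {set T}) : same_orbit le P X -> same_orbit le P Y -> same_orbit le X Y.
  by move=> /same_orbit_sym; apply: same_orbit_trans.
case: (h A fA) => hA; case: (h B fB) => hB; case: (h C fC) => hC'; try exact: j hA hC'.
- by case: nAB; apply: j hA hB.
- by case: nBC; apply: j hB hC'.
- by case: nBC; apply: j hB hC'.
by case: nAB; apply: j hA hB.
Qed.

Lemma swap_orbit A i : flag le A -> letter n i -> ~ same_orbit le A (swap i A).
Proof.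
case: hC => h _ fA li; apply: h; rewrite ?flag_swap //; exact: (swap_adj hP).
Qed.

(** Each exchange changes the orbit, and there are only two orbits. *)
Lemma even_orbit A w : flag le A -> all (letter n) w -> ~~ odd (size w) ->
  same_orbit le A (run A w).
Proof.
have [m] := ubnP (size w); elim: m w A => // m IH [|i [|j w]] A //= szw fA.
  by move=> _ _; apply/same_orbitP; exists 1%g; rewrite ?group1 ?aut_imset1.
case/and3P=> li lj lw; rewrite negbK => ew.
have fi := flag_swap i fA; have fj := flag_swap j fi.
apply: same_orbit_trans (IH w _ _ fj lw ew); last by lia.
by apply: (two_orbits fA fi fj); apply: swap_orbit.
Qed.

Lemma odd_orbit A w : flag le A -> all (letter n) w -> odd (size w) ->
  ~ same_orbit le A (run A w).
Proof.
case: w => //= i w fA /andP[li lw] ow s; apply: (swap_orbit fA li).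
apply: same_orbit_trans s _; apply: same_orbit_sym; apply: even_orbit => //.
exact: flag_swap.
Qed.

Lemma even_gen A w : flag le A -> all (letter n) w -> ~~ odd (size w) ->
  exists2 g, g \in autG & g @: A = run A w.
Proof. by move=> fA lw ew; apply/same_orbitP/even_orbit. Qed.

Lemma no_swap g A i : g \in autG -> flag le A -> letter n i -> g @: A <> swap i A.
Proof. by move=> Gg fA li e; apply: (swap_orbit fA li); apply/same_orbitP; exists g. Qed.

(** Join [A] to [g @: A] by a word. Its letters avoid the ranks of fixed faces, hence satisfy [I],
    and its length is even because an odd word changes the orbit. Such a word is realised in [H],
    and freeness on flags identifies the result with [g]. *)
Lemma stab_gen A (H : {group {perm T}}) (I : pred nat) c g :
  flag le A -> letter n c -> H \subset autG ->
  (forall i, I i -> letter n i -> exists2 g, g \in H & g @: A = run A [:: i; c]) ->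
  g \in autG -> {in A, forall x, ~~ I (rk le x) -> g x = x} -> g \in H.
Proof.
move=> fA lc sH gens Gg fix_g.
have fgA : flag le (g @: A) by apply: (aut_flag hP) => //; apply/autgP.
have [w [lw rw hw]] := connect hP fA fgA.
have Iw : all I w.
  apply/allP => i iw; apply: contraT => nI.
  have [x Ax rx] := letter_face hP fA (allP lw i iw).
  have gx : g x = x by apply: fix_g; rewrite ?rx.
  by case: (hw i x iw Ax); rewrite // -gx imset_f.
have ew : ~~ odd (size w).
  by apply/negP => /(odd_orbit fA lw); apply; apply/same_orbitP; exists g; rewrite ?rw.
have [h Hh eh] := words_in hP fA lc sH gens lw Iw ew.
by rewrite (autG_inj hP Gg (subsetP sH _ Hh) fA) // eh rw.
Qed.

(** The letter [i] is free, so a parity mismatch can be absorbed at a rank that is irrelevant to the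
    application. *)
Lemma flag_orbit2 A B i : flag le A -> flag le B -> letter n i ->
  (exists2 g, g \in autG & g @: A = B) \/ (exists2 g, g \in autG & g @: A = swap i B).
Proof.
move=> fA fB li; have [w [lw rw _]] := connect hP fA fB.
have [ow|ew] := boolP (odd (size w)); last by left; rewrite -rw; apply: even_gen.
right; have [||g Gg eg] := @even_gen A (w ++ [:: i]) fA.
- by rewrite all_cat lw /= li.
- by rewrite size_cat addn1 /= ow.
by exists g; rewrite // eg run_cat rw.
Qed.

Lemma card_flags A : flag le A -> 0 < n -> num_flags le = 2 * #|autG|.
Proof.
move=> fA n0; have l2 : letter n 2 by rewrite /letter; lia.
have f2 := flag_swap 2 fA.
pose O (B : {set T}) := [set g @: B | g : {perm T} in autG].
have oO B : flag le B -> #|O B| = #|autG|.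
  move=> fB; apply: card_in_imset => g h Gg Gh; exact: (autG_inj hP).
have dis : O A :&: O (swap 2 A) = set0.
  apply/setP => P; rewrite !inE; apply/negP => /andP[/imsetP[g Gg eP] /imsetP[h Gh eP']].
  apply: (@no_swap (g * h^-1)%g A 2); rewrite ?groupM ?groupV //.
  by rewrite aut_imsetM -eP (aut_imsetV (esym eP')).
rewrite /num_flags (_ : [set P | flag le P] = O A :|: O (swap 2 A)).
  by rewrite cardsU dis cards0 subn0 !oO // mul2n addnn.
apply/setP => P; rewrite !inE; apply/idP/orP => [fP | [/imsetP[g /autgP ag ->]|/imsetP[g /autgP ag ->]]].
- case: (flag_orbit2 fA fP l2) => [[g Gg <-]|[g Gg e]]; [left|right]; apply/imsetP; exists g => //.
  have := autG_run (w := [:: 2]) hP Gg fA; rewrite /= l2 => -> //.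
  by rewrite e (swapK hP).
- exact: (aut_flag hP).
exact: (aut_flag hP).
Qed.

Section SectionCount.

Variables (A : {set T}) (j : nat) (s : {perm T}).
Hypotheses (fA : flag le A) (lj : letter n j) (lj1 : letter n j.+1).
Hypotheses (Gs : s \in autG) (es : s @: A = run A [:: j.+1; j]).

Let sect F G := [set H | ltp le G H && ltp le H F && (rk le H == j)].

Let s_fix g x : g \in <[s]>%g -> x \in A -> rk le x != j -> rk le x != j.+1 -> g x = x.
Proof.
move=> /cycleP[k ->] Ax nj nj1; elim: k => [|k IH]; first by rewrite expg0 perm1.
rewrite expgSr permM IH; apply: (aut_face hP _ fA Ax) => //; first exact/autgP.
by rewrite es; apply: run_keep; rewrite // !inE negb_or nj1 nj.
Qed.

Let sub_s : <[s]>%g \subset autG. Proof. by rewrite cycle_subG. Qed.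

(** The rotation [s] acts regularly on the vertices of the polygon. An element fixing [x] can move
    only the face of rank [j.+1] of [A], hence is trivial; transitivity comes from words in [j] and
    [j.+1]. *)
Lemma base_section_count G F : G \in A -> F \in A -> rk le G = j.-1 -> rk le F = j.+2 ->
  #|sect F G| = #[s]%g.
Proof.
move=> AG AF rG rF; have j1 : 1 < j by case/andP: lj.
have [n1 n2 n3 n4 n5] := letter_neighbours j1.
have [x Ax rx] := letter_face hP fA lj.
have injx : {in <[s]>%g &, injective (fun g : {perm T} => g x)}.
  move=> g h sg sh e; apply/eqP; rewrite eq_mulgV1; apply/eqP.
  apply/set1gP; apply: (@stab_gen A 1%G (pred1 j.+1) j.+1) => //.
  - exact: sub1G.
  - by move=> i /eqP-> _; exists 1%g; rewrite ?set11 // aut_imset1 /= (swapK hP).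
  - by rewrite groupM ?groupV ?(subsetP sub_s).
  move=> y Ay /= ny; have [ry|nj] := eqVneq (rk le y) j.
    by rewrite (flag_inj po fs fA Ay Ax) ?ry // permM e -permM mulgV perm1.
  by rewrite permM !s_fix ?groupV //.
rewrite orderE -(card_in_imset injx); apply: eq_card => y; apply/idP/imsetP.
  rewrite inE => /andP[/andP[Gy yF] /eqP ry].
  pose C := y |: [set z in A | (rk le z != j) && (rk le z != j.+1)].
  have [lexx _ ltr] := po.
  have cmp z : z \in A -> rk le z != j -> rk le z != j.+1 -> le z y || le y z.
    move=> Az nj nj1; have [zj|jz] := ltnP (rk le z) j.
      have zG : le z G by rewrite (flag_le po fs fA) // rG -ltnS prednK // ltnW.
      by rewrite (ltr _ _ _ zG) //; case/andP: Gy.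
    have Fz : le F z.
      by rewrite (flag_le po fs fA) // rF ltn_neqAle eq_sym nj1 ltn_neqAle eq_sym nj.
    by rewrite orbC (ltr _ _ _ _ Fz) //; case/andP: yF.
  have chC : chain le C.
    have /chainP chA := flag_chain fA; apply/chainP => u v; rewrite !inE.
    case/orP=> [/eqP->|/and3P[Au uj uj1]] /orP[/eqP->|/and3P[Av vj vj1]].
    - by rewrite lexx.
    - by rewrite orbC cmp.
    - by rewrite cmp.
    exact: chA.
  have [B fB /subsetP sCB] := chain_flag chC.
  have By : y \in B by apply: sCB; rewrite !inE eqxx.
  have [w [lw rw hw]] := connect hP fA fB.
  have Iw : all (mem [:: j; j.+1]) w.
    apply/allP => i iw; apply: contraT; rewrite !inE negb_or => /andP[ij ij1].
    have [z Az rz] := letter_face hP fA (allP lw i iw).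
    by case: (hw i z iw Az); rewrite // sCB // !inE Az rz ij ij1 orbT.
  have gens i : mem [:: j; j.+1] i -> letter n i ->
      exists2 g, g \in <[s]>%g & g @: A = run A [:: i; j].
    rewrite !inE => /orP[]/eqP-> _; last by exists s; rewrite ?cycle_id.
    by exists 1%g; rewrite ?group1 // aut_imset1 /= (swapK hP).
  (* An odd word becomes even by appending [j.+1], which leaves the face [y] of rank [j] in
     place. *)
  have [w' [lw' Iw' ew' yw']] : exists w', [/\ all (letter n) w', all (mem [:: j; j.+1]) w',
      ~~ odd (size w') & y \in run A w'].
    have [ow|ew] := boolP (odd (size w)); last by exists w; rewrite rw.
    exists (w ++ [:: j.+1]); rewrite !all_cat lw Iw /= lj1 !inE eqxx orbT size_cat addn1 /= ow.
    split=> //; rewrite run_cat rw /=; apply: (swap_agree fB) => //.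
    by rewrite ry; apply: n_Sn.
  have [g sg eg] := words_in hP fA lj sub_s gens lw' Iw' ew'.
  exists g => //; apply/esym; apply: (aut_face hP _ fA Ax); rewrite ?eg ?rx ?ry //.
  by apply/autgP; apply: (subsetP sub_s).
case=> g sg ->; have Gg := subsetP sub_s g sg; have ag := elimT (autgP _ _) Gg.
have gG : g G = G by apply: s_fix; rewrite // rG.
have gF : g F = F by apply: s_fix; rewrite // rF.
rewrite inE (aut_rk hP) // rx eqxx andbT -{1}gG -{1}gF /ltp !ag !(inj_eq perm_inj).
by rewrite -!/(ltp _ _ _) !(flag_ltp po fs fA) // rG rF rx n5 leqnSn.
Qed.

(** Exchanging rank [j] keeps [G] and [F], so by [flag_orbit2] an automorphism carries the base
    section to any section of these ranks. *)
Lemma section_count G F : ltp le G F -> rk le G = j.-1 -> rk le F = j.+2 ->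
  #|sect F G| = #[s]%g.
Proof.
move=> GF rG rF; have j1 : 1 < j by case/andP: lj.
have [n1 n2 n3 n4 n5] := letter_neighbours j1.
have [B [fB BG BF]] : exists B, [/\ flag le B, G \in B & F \in B].
  by apply: (flag2 po); case/andP: GF.
have [g [Gg gG gF]] : exists g, [/\ g \in autG, G \in g @: A & F \in g @: A].
  case: (flag_orbit2 fA fB lj) => -[g Gg eg]; exists g; rewrite eg; split=> //.
    by apply: (swap_agree fB); rewrite // rG; apply/eqP.
  by apply: (swap_agree fB); rewrite // rF; apply/eqP.
have ag := elimT (autgP _ _) Gg.
case/imsetP: gG rG GF => G0 AG0 -> + _; case/imsetP: gF rF => F0 AF0 ->.
rewrite !(aut_rk hP) // => rF rG; rewrite -(base_section_count AG0 AF0 rG rF).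
rewrite -[RHS](card_imset _ (@perm_inj _ g)); apply: eq_card => y.
have gK z : z = g ((g^-1)%g z) by rewrite permKV.
rewrite [in LHS](gK y) [in RHS](gK y) mem_imset; last exact: perm_inj.
by rewrite !inE /ltp !ag !(inj_eq perm_inj) (aut_rk hP).
Qed.

End SectionCount.

Variable A : {set T}.
Hypothesis fA : flag le A.

Lemma chiral_has_type (ss : seq {perm T}) : size ss = n.-1 ->
  (forall k, k < n.-1 -> nth 1%g ss k \in autG /\
     nth 1%g ss k @: A = run A [:: k.+3; k.+2]) ->
  has_type le n [seq #[s]%g | s <- ss].
Proof.
move=> sz hs; split; first by rewrite size_map.
move=> i F G /andP[i0 iN] GF rG rF.
have [|Gs es] := hs i.-1; first by lia.
have l1 : letter n i.+1 by rewrite /letter; lia.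
have l2 : letter n i.+2 by rewrite /letter; lia.
rewrite (nth_map 1%g) ?sz; last by lia.
rewrite prednK // in es.
apply: (section_count fA l1 l2 Gs es); rewrite ?rG ?rF; lia.
Qed.

Lemma chiral_type_unique (ss : seq {perm T}) ps : size ss = n.-1 ->
  (forall k, k < n.-1 -> nth 1%g ss k \in autG /\
     nth 1%g ss k @: A = run A [:: k.+3; k.+2]) ->
  has_type le n ps -> ps = [seq #[s]%g | s <- ss].
Proof.
move=> sz hs [szp hp]; apply: (@eq_from_nth _ 0); first by rewrite size_map sz szp.
move=> k; rewrite szp => kn; have [Gs es] := hs k kn.
rewrite (nth_map 1%g) ?sz //.
have l1 : letter n k.+2 by rewrite /letter; lia.
have l2 : letter n k.+3 by rewrite /letter; lia.
have [|G AG rG] := @flag_face _ _ _ po fs A k.+1 fA; first by lia.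
have [|F AF rF] := @flag_face _ _ _ po fs A k.+4 fA; first by lia.
rewrite -(base_section_count fA l1 l2 Gs es AG AF rG rF).
have -> : k = k.+1.-1 by []; rewrite -(hp k.+1 F G) //; try lia.
by rewrite (flag_ltp po fs fA) // rG rF; lia.
Qed.

End Chiral.

(** * Sections *)

Section Sections.

Variables (T : finType) (le : rel T) (n : nat).
Hypothesis hP : polytope le n.
Variables (D : pred T) (a c : T) (m : nat).
Hypothesis hD : forall x, D x = le a x && le x c.
Hypothesis hac : le a c.
Hypothesis hm : rk le c = rk le a + m.+1.
Let po := polytope_po hP.
Let fs := polytope_fs hP.
Let lexx : reflexive le. Proof. by case: po. Qed.
Let le_anti : antisymmetric le. Proof. by case: po. Qed.
Let le_trans : transitive le. Proof. by case: po. Qed.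

Local Notation S := {x : T | D x}.
(** The carrier predicate [D] is abstract so that [le v] or the faces below a facet can be
    substituted, making this order convertible with [vfig_le] or [facet_le]. *)
Definition sub_le : rel S := fun x y => le (val x) (val y).
Definition sect (P : {set T}) : {set S} := [set x | val x \in P].

Let Da : D a. Proof. by rewrite hD lexx hac. Qed.
Let Dc : D c. Proof. by rewrite hD lexx hac. Qed.

Lemma sub_le_po : partial_order sub_le.
Proof.
split=> [x | x y /le_anti/val_inj // | y x z]; first exact: lexx.
exact: le_trans.
Qed.

Lemma chain_sect P : chain le P -> chain sub_le (sect P).
Proof. by move/chainP => chP; apply/chainP => x y; rewrite !inE; apply: chP. Qed.

Let outer P : flag le P -> a \in P -> c \in P -> forall y, y \in P -> ~~ D y ->
  le y a \/ le c y.
Proof.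
move=> fP Pa Pc y Py; rewrite hD negb_and => /orP[]; rewrite !(flag_le po fs fP) // -ltnNge.
  by move/ltnW; left.
by move/ltnW; right.
Qed.

Lemma card_sect B : flag le B -> a \in B -> c \in B -> #|sect B| = m.+2.
Proof.
move=> fB Ba Bc; have := card_interval po fs fB Ba Bc hac.
rewrite hm -(card_imset _ val_inj) (_ : val @: sect B = [set z in B | le a z && le z c]); first by lia.
apply/setP => z; rewrite inE -hD; apply/imsetP/andP => [[x + ->]|[Bz Dz]].
  by rewrite inE => Bx; split=> //; apply: (valP x).
by exists (Sub z Dz); rewrite ?inE ?SubK.
Qed.

(** The faces of [P] outside the interval lie below [a] or above [c], so they are comparable to
    every face of the section. Hence each section flag is the trace of a flag with prescribed outer
    part. *)
Lemma flag_glue A P : flag sub_le A -> flag le P -> a \in P -> c \in P ->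
  exists B, [/\ flag le B, A = sect B, forall y, y \in P -> ~~ D y -> y \in B, a \in B & c \in B].
Proof.
move=> fA fP Pa Pc; have /chainP chA := flag_chain fA; have /chainP chP := flag_chain fP.
have chU : chain le (val @: A :|: [set y in P | ~~ D y]).
  have cmp x y : y \in P -> ~~ D y -> le (val (x : S)) y || le y (val x).
    move=> Py nDy; have := valP x; rewrite hD => /andP[ax xc].
    case: (outer fP Pa Pc Py nDy) => [ya|cy]; first by rewrite (le_trans ya ax) orbT.
    by rewrite (le_trans xc cy).
  apply/chainP => u v /setUP[/imsetP[x Ax ->]|hu] /setUP[/imsetP[y Ay ->]|hv].
  - exact: chA.
  - by move: hv; rewrite inE => /andP[Py nDy]; apply: cmp.
  - by move: hu; rewrite inE => /andP[Px nDx]; rewrite orbC cmp.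
  by move: hu hv; rewrite !inE => /andP[Px _] /andP[Py _]; apply: chP.
have [B fB /subsetP sB] := chain_flag chU.
have sAB x : x \in A -> val x \in B by move=> Ax; apply: sB; rewrite inE imset_f.
have eA : A = sect B.
  apply/setP => x; rewrite inE; apply/idP/idP => [/sAB //|Bx].
  apply: (flag_max fA); last exact: lexx.
  by move=> y /sAB By; have /chainP := flag_chain fB; apply.
have mem z (Dz : D z) : (forall x : S, le z (val x) || le (val x) z) -> z \in B.
  move=> h; have : Sub z Dz \in A.
    by apply: (flag_max fA) => [y _|]; rewrite /sub_le ?SubK ?h ?lexx.
  by move/sAB; rewrite SubK.
exists B; split=> //.
- by move=> y Py nDy; apply: sB; rewrite !inE Py nDy orbT.
- by apply: mem Da _ => x; have := valP x; rewrite hD => /andP[->].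
by apply: mem Dc _ => x; have := valP x; rewrite hD => /andP[_ ->]; rewrite orbT.
Qed.

Let base : exists P, [/\ flag le P, a \in P & c \in P].
Proof. exact: (flag2 po hac). Qed.

Lemma sub_le_fs A : flag sub_le A -> #|A| = m.+2.
Proof.
move=> fA; have [P [fP Pa Pc]] := base.
by have [B [fB -> _ Ba Bc]] := flag_glue fA fP Pa Pc; apply: card_sect.
Qed.

Lemma flag_sect P : flag le P -> a \in P -> c \in P -> flag sub_le (sect P).
Proof.
move=> fP Pa Pc; apply: (flag_card sub_le_fs); last exact: card_sect.
by apply/chain_sect/flag_chain.
Qed.

Lemma flag_through (x : S) : exists P, [/\ flag le P, a \in P, val x \in P & c \in P].
Proof.
have := valP x; rewrite hD => /andP[ax xc].
have ch : chain le [set a; val x; c].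
  apply/chainP => u v; rewrite !inE -!orbA => /or3P[]/eqP-> /or3P[]/eqP->;
  by rewrite ?lexx ?ax ?xc ?hac ?orbT.
have [P fP /subsetP sP] := chain_flag ch.
by exists P; rewrite !sP // !inE eqxx ?orbT.
Qed.

Lemma sub_le_rk (x : S) : rk sub_le x + rk le a = (rk le (val x)).+1.
Proof.
have [P [fP Pa Px Pc]] := flag_through x.
have /andP[ax xc] : le a (val x) && le (val x) c by rewrite -hD; apply: (valP x).
rewrite (rk_flag sub_le_po sub_le_fs (flag_sect fP Pa Pc)) ?inE //.
rewrite -(card_interval po fs fP Pa Px ax) -(card_imset _ val_inj); congr (_ + _).
apply: eq_card => z; rewrite inE; apply/imsetP/and3P => [[y + ->]|[Pz az zx]].
  by rewrite !inE => /andP[Py yx]; split=> //; have := valP y; rewrite hD => /andP[].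
have Dz : D z by rewrite hD az (le_trans zx xc).
by exists (Sub z Dz); rewrite ?inE /sub_le ?SubK ?Pz.
Qed.

Lemma adjacent_sect B i : flag le B -> a \in B -> c \in B -> rk le a < i < rk le c ->
  adjacent (sect B) (sect (swap le i B)).
Proof.
move=> fB Ba Bc /andP[ai ic].
have li : letter n i.
  rewrite /letter (leq_ltn_trans _ ai) ?(rk_gt0 po fs) //.
  exact: leq_trans ic (rk_max po fs c).
have [x Bx rx] := letter_face hP fB li.
have Dx : D x by rewrite hD !(flag_le po fs fB) // rx (ltnW ai) (ltnW ic).
apply/cards1P; exists (Sub x Dx); apply/setP => z; rewrite !inE -val_eqE SubK.
apply/andP/eqP => [[nz Bz]|->].
  apply: (flag_inj po fs fB) => //; rewrite rx; apply/eqP.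
  by apply: contraR nz => /eqP; apply: (swap_agree fB).
by split=> //; apply/negP => Sx; apply: (swap_face_neq hP fB li Bx Sx).
Qed.

Lemma swap_sect B i : flag le B -> a \in B -> c \in B -> rk le a < i < rk le c ->
  sect (swap le i B) <> sect B /\
  agree sub_le (i.+1 - rk le a) (sect B) (sect (swap le i B)).
Proof.
move=> fB Ba Bc hi; split; first by apply/nesym/adjacent_neq/adjacent_sect.
move=> x; rewrite !inE => Bx nx; apply: (swap_agree fB) => // e; apply: nx.
by have := sub_le_rk x; rewrite e; lia.
Qed.

Lemma sub_polytope : polytope sub_le m.
Proof.
split.
- split; first exact: sub_le_po.
  by exists (Sub a Da) => x; rewrite /sub_le SubK; have := valP x; rewrite hD => /andP[].
- by exists (Sub c Dc) => x; rewrite /sub_le SubK; have := valP x; rewrite hD => /andP[].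
- exact: sub_le_fs.
- move=> F G FG rFG; have [_ _ _ dia _] := hP.
  have e1 := sub_le_rk F; have e2 := sub_le_rk G.
  have rFG' : rk le (val G) = (rk le (val F)).+2.
    by apply/eqP; rewrite -eqSS -e2 rFG !addSn e1.
  have lt x y : ltp sub_le x y = ltp le (val x) (val y) by rewrite /ltp val_eqE.
  rewrite -(dia (val F) (val G)) -?lt // -(card_imset _ val_inj); apply: eq_card => z.
  apply/imsetP/idP => [[x + ->]|]; rewrite !inE ?lt // => /andP[Fz zG].
  have Dz : D z.
    have /andP[aF _] : le a (val F) && le (val F) c by rewrite -hD; apply: (valP F).
    have /andP[_ Gc] : le a (val G) && le (val G) c by rewrite -hD; apply: (valP G).
    have [/andP[_ Fz'] /andP[_ zG']] := (Fz, zG).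
    by rewrite hD (le_trans aF Fz') (le_trans zG' Gc).
  by exists (Sub z Dz); rewrite ?inE ?lt SubK ?Fz.
(* Strong connectivity: both section flags are glued to the same outer part of [P], so a connecting
   word has only letters strictly between the ranks of [a] and [c]. *)
move=> A B fA fB; have [P [fP Pa Pc]] := base.
have [A' [fA' eA outA Aa Ac]] := flag_glue fA fP Pa Pc.
have [B' [fB' eB outB Ba Bc]] := flag_glue fB fP Pa Pc.
have [w [lw rw hw]] := connect hP fA' fB'.
have wI i : i \in w -> rk le a < i < rk le c.
  move=> iw; have li := allP lw i iw; have [y Py ry] := letter_face hP fP li.
  have ia : i <> rk le a by move=> e; apply: (hw i a iw Aa Ba).
  have ic : i <> rk le c by move=> e; apply: (hw i c iw Ac Bc).
  have Dy : D y.
    by apply: contraT => nDy; case: (hw i y iw (outA _ Py nDy) (outB _ Py nDy)).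
  move: Dy; rewrite hD => /andP[/(le_rk po fs) h1 /(le_rk po fs) h2].
  by rewrite ry in h1 h2; clear -ia ic h1 h2; lia.
have [|||s [ps ls hs]] := @run_path _ le n S sect (A' :&: B') A' w fA' _ lw.
- exact: subsetIl.
- by move=> i x iw /setIP[Ax Bx]; apply: hw.
- move=> C i fC /subsetP sC iw li; apply: adjacent_sect; rewrite ?wI // sC ?inE //.
    by rewrite Aa Ba.
  by rewrite Ac Bc.
exists s; rewrite eA eB; split=> //; first by rewrite ls rw.
apply/allP => L /hs[C [fC /subsetP sC ->]]; rewrite flag_sect ?sC ?inE ?Aa ?Ba ?Ac ?Bc //=.
by apply/subsetP => x; rewrite !inE => /andP[Ax Bx]; apply: sC; rewrite inE Ax Bx.
Qed.

Lemma sect_swap B i : flag le B -> a \in B -> c \in B -> rk le a < i < rk le c ->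
  sect (swap le i B) = swap sub_le (i.+1 - rk le a) (sect B).
Proof.
move=> fB Ba Bc hi; have [nS agS] := swap_sect fB Ba Bc hi.
apply: (swap_unique sub_polytope) => //; first exact: flag_sect.
apply: flag_sect; first exact: flag_swap.
  by apply: (swap_agree fB) => // e; move: hi; rewrite e ltnn.
by apply: (swap_agree fB) => // e; move: hi; rewrite e ltnn andbF.
Qed.

Lemma sub_aut g : g \in autg_group le -> g a = a -> g c = c ->
  exists2 g' : {perm S}, is_aut sub_le g' & forall x, val (g' x) = g (val x).
Proof.
move=> /autgP ag ga gc.
have Dg x : D (g x) = D x by rewrite !hD -{1}ga -{1}gc !ag.
have Dgx (x : S) : D (g (val x)) by rewrite Dg; apply: (valP x).
pose f (x : S) : S := Sub (g (val x)) (Dgx x).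
have injf : injective f.
  by move=> x y /(congr1 val); rewrite !SubK => /perm_inj/val_inj.
exists (perm injf) => [x y|x]; last by rewrite permE SubK.
by rewrite /sub_le !permE !SubK ag.
Qed.

Lemma sect_aut (g : {perm T}) (g' : {perm S}) B : (forall x, val (g' x) = g (val x)) ->
  g' @: sect B = sect (g @: B).
Proof.
move=> hg; apply/setP => x; rewrite inE; apply/imsetP/imsetP => [[y + ->]|[z Bz ez]].
  by rewrite inE => By; exists (val y); rewrite ?hg.
exists ((g'^-1)%g x); last by rewrite permKV.
by rewrite inE (_ : val _ = z) //; apply: (@perm_inj _ g); rewrite -hg permKV.
Qed.

End Sections.

(** * Quotients *)

Section Quotient.

Variables (T : finType) (le : rel T) (n : nat).
Hypothesis hP : polytope le n.
Let po := polytope_po hP.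
Let fs := polytope_fs hP.
Let lexx : reflexive le. Proof. by case: po. Qed.
Let le_trans : transitive le. Proof. by case: po. Qed.
Local Notation autG := (autg_group le).

Variable K : {group {perm T}}.
Hypothesis sK : K \subset autG.

Let Kaut k : k \in K -> is_aut le k. Proof. by move/(subsetP sK)/autgP. Qed.
Let Krk k x : k \in K -> rk le (k x) = rk le x. Proof. by move/Kaut; apply: (aut_rk hP). Qed.

Definition qequiv x y := [exists k in K, k x == y].

Lemma qequivP x y : reflect (exists2 k, k \in K & k x = y) (qequiv x y).
Proof.
apply: (iffP exists_inP) => -[k Kk]; first by move/eqP; exists k.
by move=> e; exists k => //; apply/eqP.
Qed.

Lemma qequiv_refl x : qequiv x x.
Proof. by apply/qequivP; exists 1%g; rewrite ?group1 ?perm1. Qed.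

Lemma qequiv_sym x y : qequiv x y -> qequiv y x.
Proof.
by case/qequivP=> k Kk <-; apply/qequivP; exists (k^-1)%g; rewrite ?groupV ?permK.
Qed.

Lemma qequiv_trans y x z : qequiv x y -> qequiv y z -> qequiv x z.
Proof.
move=> /qequivP[k Kk <-] /qequivP[l Kl <-]; apply/qequivP.
by exists (k * l)%g; rewrite ?groupM ?permM.
Qed.

(** The value of [pick] depends only on the set of candidates, so all members of an orbit get the
    same representative; the quotient lives on the fixed points of [qrep]. *)
Definition qrep x := odflt x [pick y | qequiv x y].

Lemma qrepP x : qequiv x (qrep x).
Proof. by rewrite /qrep; case: pickP => //= _; apply: qequiv_refl. Qed.

Lemma qrep_eq x y : qequiv x y -> qrep x = qrep y.
Proof.
move=> xy; rewrite /qrep (eq_pick (_ : qequiv x =1 qequiv y)).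
  by case: pickP => // /(_ y); rewrite qequiv_refl.
move=> z; apply/idP/idP; first exact: qequiv_trans (qequiv_sym xy).
exact: qequiv_trans xy.
Qed.

Lemma qrepK x : qrep (qrep x) == qrep x.
Proof. by apply/eqP/esym/qrep_eq/qrepP. Qed.

Local Notation Tq := {x : T | qrep x == x}.
Definition quo (x : T) : Tq := exist _ (qrep x) (qrepK x).
Definition quo_le : rel Tq := fun x y => [exists k in K, le (val x) (k (val y))].

Lemma quo_val y : quo (val y) = y.
Proof. by apply: val_inj; rewrite /=; apply/eqP; apply: (valP y). Qed.

Lemma quoP x y : reflect (exists2 k, k \in K & k x = y) (quo x == quo y).
Proof.
apply: (iffP eqP) => [/(congr1 val)|[k Kk e]].
  rewrite /= => e; apply/qequivP; apply: qequiv_trans (qrepP x) _.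
  by rewrite e; apply: qequiv_sym; apply: qrepP.
by apply: val_inj; rewrite /=; apply: qrep_eq; apply/qequivP; exists k.
Qed.

Lemma quoK k x : k \in K -> quo (k x) = quo x.
Proof. by move=> Kk; apply/esym/eqP/quoP; exists k. Qed.

Lemma quo_leP x y : reflect (exists2 k, k \in K & le x (k y)) (quo_le (quo x) (quo y)).
Proof.
apply: (iffP idP) => [/exists_inP|] [j Kj h];
  have [k Kk ek] := qequivP _ _ (qrepP x); have [l Kl el] := qequivP _ _ (qrepP y).
  exists (l * j * k^-1)%g; first by rewrite !groupM ?groupV.
  by rewrite -(Kaut Kk) !permM permKV ek el.
apply/exists_inP; exists (l^-1 * j * k)%g; first by rewrite !groupM ?groupV.
by rewrite /= -ek -el !permM permK (Kaut Kk).
Qed.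

Let r (y : Tq) := rk le (val y).

Lemma quo_rk0 x : r (quo x) = rk le x.
Proof. by rewrite /r /=; have [k Kk <-] := qequivP _ _ (qrepP x); apply: Krk. Qed.

Lemma quo_le_rk y z : quo_le y z -> r y <= r z.
Proof. by case/exists_inP=> k Kk /(le_rk po fs); rewrite Krk. Qed.

Lemma quo_le_eq y z : quo_le y z -> r y = r z -> y = z.
Proof.
case/exists_inP=> k Kk h e; have e' : val y = k (val z).
  by apply: (le_rk_eq po fs h); rewrite Krk.
by rewrite -(quo_val y) e' quoK // quo_val.
Qed.

Lemma quo_le_mono x y : le x y -> quo_le (quo x) (quo y).
Proof. by move=> xy; apply/quo_leP; exists 1%g; rewrite ?group1 ?perm1. Qed.

Lemma quo_le_po : partial_order quo_le.
Proof.
split.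
- by move=> y; rewrite -(quo_val y); apply: quo_le_mono.
- move=> y z /andP[yz zy]; apply: quo_le_eq => //; apply/eqP.
  by rewrite eqn_leq !quo_le_rk.
move=> y x z; rewrite -(quo_val x) -(quo_val y) -(quo_val z).
move=> /quo_leP[k Kk h] /quo_leP[l Kl h']; apply/quo_leP.
exists (l * k)%g; rewrite ?groupM // permM; apply: le_trans h _.
by rewrite (Kaut Kk).
Qed.

(** Induction on the size. Remove a face [m] of largest rank, lift the rest to a flag [A], and let
    [x] lift the highest remaining face. Some [K]-translate of [m] lies above [x] and forms a chain
    with the part of [A] below [x]. *)
Lemma chain_lift (C : {set Tq}) : chain quo_le C -> exists2 A, flag le A & C \subset quo @: A.
Proof.
have [k] := ubnP #|C|; elim: k C => // k IH C; rewrite ltnS => oC chC.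
have [->|[m0 Cm0]] := set_0Vmem C.
  have [|A fA _] := @chain_flag _ le set0; first by apply/chainP => x y; rewrite inE.
  by exists A; rewrite ?sub0set.
have [m Cm maxm] : exists2 m, m \in C & forall y, y \in C -> r y <= r m.
  by case: (arg_maxnP r Cm0) => m Cm h; exists m.
have chC' : chain quo_le (C :\ m) by apply: chainS chC; apply: subD1set.
have [|A fA sA] := IH (C :\ m) _ chC'.
  by rewrite (leq_trans _ oC) // [X in _ < X](cardsD1 m) Cm.
have [C0|[x0 Cx0]] := set_0Vmem (C :\ m).
  have [B fB Bm] := flag1 po (val m); exists B => //.
  apply/subsetP => y Cy; suff -> : y = m by rewrite -(quo_val m) imset_f.
  by apply/eqP; apply: contraT => ny; rewrite -(in_set0 y) -C0 !inE ny.
have [x' Cx' maxx] : exists2 y, y \in C :\ m & forall z, z \in C :\ m -> r z <= r y.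
  by case: (arg_maxnP r Cx0) => y Cy h; exists y.
have /imsetP[x Ax ex] := subsetP sA _ Cx'.
have /setD1P[nx'm Cx1] := Cx'.
have /orP[|le_mx] : quo_le x' m || quo_le m x' by have /chainP := chC; apply.
  rewrite ex -{1}(quo_val m) => /quo_leP[l Kl xm].
  have [|B fB /subsetP sB] := @chain_flag _ le (l (val m) |: [set a in A | le a x]).
    have /chainP chA := flag_chain fA.
    have below a : le a x -> le a (l (val m)) by move=> h; apply: le_trans h xm.
    apply/chainP => u v; rewrite !inE => /predU1P[->|/andP[Au ux]] /predU1P[->|/andP[Av vx]].
    - by rewrite lexx.
    - by rewrite (below v) ?orbT.
    - by rewrite (below u).
    exact: chA.
  exists B => //; apply/subsetP => y Cy; have [->|ny] := eqVneq y m.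
    by rewrite -(quo_val m) -(quoK _ Kl) imset_f // sB // !inE eqxx.
  have Cy' : y \in C :\ m by rewrite !inE ny.
  have /imsetP[a Aa ea] := subsetP sA _ Cy'; rewrite ea imset_f // sB // !inE Aa.
  by rewrite (flag_le po fs fA) // -!quo_rk0 -ea -ex maxx ?orbT.
case/eqP: nx'm; apply/esym; apply: quo_le_eq => //; apply/eqP.
by rewrite eqn_leq (quo_le_rk le_mx) maxm.
Qed.

Lemma quo_chain A : flag le A -> chain quo_le (quo @: A).
Proof.
move=> fA; apply/chainP => _ _ /imsetP[x Ax ->] /imsetP[y Ay ->].
have /chainP/(_ _ _ Ax Ay) := flag_chain fA.
by case/orP=> /quo_le_mono ->; rewrite ?orbT.
Qed.

Lemma quo_inj A x y : flag le A -> x \in A -> y \in A -> quo x = quo y -> x = y.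
Proof. by move=> fA Ax Ay e; apply: (flag_inj po fs fA) => //; rewrite -!quo_rk0 e. Qed.

Lemma quo_card A : flag le A -> #|quo @: A| = n.+2.
Proof. by move=> fA; rewrite card_in_imset ?fs // => x y; apply: quo_inj. Qed.

Lemma quo_flag_lift F : flag quo_le F -> exists2 A, flag le A & F = quo @: A.
Proof.
move=> fF; have [A fA sFA] := chain_lift (flag_chain fF); exists A => //.
apply/eqP; rewrite eqEsubset sFA; apply/subsetP => y Ay.
have /chainP chA := quo_chain fA.
apply: (flag_max fF) => [z /(subsetP sFA) Az|]; first exact: chA.
by case: quo_le_po => ->.
Qed.

Lemma quo_fs F : flag quo_le F -> #|F| = n.+2.
Proof. by case/quo_flag_lift=> A fA ->; apply: quo_card. Qed.

Lemma quo_flag A : flag le A -> flag quo_le (quo @: A).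
Proof. by move=> fA; apply: (flag_card quo_fs); [apply: quo_chain | apply: quo_card]. Qed.

Lemma quo_rk x : rk quo_le (quo x) = rk le x.
Proof.
have [A fA Ax] := flag1 po x.
rewrite (rk_flag quo_le_po quo_fs (quo_flag fA)) ?imset_f // (rk_flag po fs fA Ax).
rewrite -[RHS](card_in_imset (f := quo)); last first.
  by move=> y z; rewrite !inE => /andP[Ay _] /andP[Az _]; apply: quo_inj fA Ay Az.
apply: eq_card => y; apply/idP/imsetP => [|[z]]; rewrite !inE.
  case/andP=> /imsetP[z Az ->] /quo_le_rk; rewrite !quo_rk0 => h.
  by exists z; rewrite // !inE Az (flag_le po fs fA).
by case/andP=> Az zx ->; rewrite imset_f ?quo_le_mono.
Qed.

(** Alignment: faces matching one at a time modulo [K], on a set [S] of ranks, match through one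
    common element of [K]. The diamond condition uses it for two ranks, strong connectivity for all
    ranks at which two quotient flags coincide. *)
Hypothesis KQ : forall A B (S : pred nat), flag le A -> flag le B ->
  (forall x y, x \in A -> y \in B -> rk le x = rk le y -> S (rk le x) ->
     exists2 k, k \in K & k x = y) ->
  exists2 k, k \in K &
    forall x y, x \in A -> y \in B -> rk le x = rk le y -> S (rk le x) -> k x = y.
Hypothesis Kswap : forall k A i, k \in K -> flag le A -> letter n i -> k @: A <> swap le i A.

Lemma quo_flag_eq A B : flag le A -> flag le B -> quo @: A = quo @: B ->
  exists2 k, k \in K & k @: A = B.
Proof.
move=> fA fB e; have [x y Ax By rxy _|k Kk hk] := @KQ A B predT fA fB.
  apply/quoP/eqP; apply: (flag_inj quo_le_po quo_fs (quo_flag fB)).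
  - by rewrite -e; apply: imset_f.
  - exact: imset_f.
  by rewrite !quo_rk.
exists k => //; apply: (flag_eq fs) => //; first exact: (aut_flag hP) (Kaut Kk) fA.
move=> _ /imsetP[x Ax ->]; have [y By ry] := flag_rk hP x fB.
by rewrite (hk x y).
Qed.

Lemma quo_swap_neq A i : flag le A -> letter n i -> quo @: swap le i A <> quo @: A.
Proof.
move=> fA li /esym e; have [k Kk] := quo_flag_eq fA (flag_swap i fA) e.
exact: Kswap.
Qed.

Lemma quo_swap_agree A i : flag le A -> agree quo_le i (quo @: A) (quo @: swap le i A).
Proof.
move=> fA _ /imsetP[x Ax ->]; rewrite quo_rk => nx; apply: imset_f.
exact: (swap_agree fA).
Qed.

Lemma quo_adjacent A i : flag le A -> letter n i -> adjacent (quo @: A) (quo @: swap le i A).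
Proof.
move=> fA li; have [x Ax rx] := letter_face hP fA li.
have fS := quo_flag (flag_swap i fA).
apply/cards1P; exists (quo x); apply/setP => y; rewrite !inE.
apply/andP/eqP => [[ny /imsetP[z Az ez]]|->].
  rewrite ez; congr quo; apply: (flag_inj po fs fA) => //; rewrite rx; apply/eqP.
  apply: contraR ny => /eqP nz; rewrite ez; apply: imset_f; exact: (swap_agree fA).
split; last exact: imset_f.
apply/negP => Sx; apply: (quo_swap_neq fA li); apply/esym.
apply: (agree_face quo_le_po quo_fs (quo_flag fA) fS (quo_swap_agree (i := i) fA) (imset_f _ Ax) Sx) => //.
  by rewrite quo_rk.
by rewrite quo_rk.
Qed.

Lemma quo_polytope : polytope quo_le n.
Proof.
split.
- split; first exact: quo_le_po.
  have [b hb] : exists b, forall x, le b x by case: hP => -[_].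
  by exists (quo b) => y; rewrite -(quo_val y); apply: quo_le_mono.
- have [t ht] : exists t, forall x, le x t by case: hP.
  by exists (quo t) => y; rewrite -(quo_val y); apply: quo_le_mono.
- exact: quo_fs.
- move=> F G FG rFG; have qpo := quo_le_po.
  have [P [fP PF PG]] := flag2 qpo (proj2 (andP FG)).
  have [A fA eA] := quo_flag_lift fP.
  move: PF PG; rewrite eA => /imsetP[F0 AF eF] /imsetP[G0 AG eG].
  rewrite eF eG !quo_rk in rFG.
  have li : letter n (rk le F0).+1.
    rewrite /letter ltnS (rk_gt0 po fs) /=.
    by have := rk_max po fs G0; rewrite rFG ltnS.
  have [x Ax rx] := letter_face hP fA li.
  have [x' Ax' rx'] := letter_face hP (flag_swap (rk le F0).+1 fA) li.
  have AF' : F0 \in swap le (rk le F0).+1 A by apply: (swap_agree fA) => //; apply: n_Sn.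
  have AG' : G0 \in swap le (rk le F0).+1 A.
    by apply: (swap_agree fA); rewrite // rFG => /esym; apply: n_Sn.
  have lt B u v : flag le B -> u \in B -> v \in B -> ltp quo_le (quo u) (quo v) = (rk le u < rk le v).
    by move=> fB Bu Bv; rewrite (flag_ltp qpo quo_fs (quo_flag fB)) ?imset_f // !quo_rk.
  have nq : quo x != quo x'.
    apply/eqP => e; apply: (quo_swap_neq fA li); apply/esym.
    apply: (agree_face qpo quo_fs (quo_flag fA) (quo_flag (flag_swap _ fA))
      (quo_swap_agree (i := (rk le F0).+1) fA) (imset_f _ Ax) (imset_f _ Ax')) => //.
      by rewrite quo_rk.
    by rewrite quo_rk.
  rewrite (_ : [set _ | _ & _] = [set quo x; quo x']) ?cards2 ?nq //.
  apply/setP => y; rewrite !inE; apply/andP/orP => [[Fy yG]|].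
    have ch : chain quo_le [set F; y; G].
      have [qxx _ _] := qpo; have [/andP[_ Fy'] /andP[_ yG'] /andP[_ FG']] := And3 Fy yG FG.
      apply/chainP => u v; rewrite !inE -!orbA => /or3P[]/eqP-> /or3P[]/eqP->;
      by rewrite ?qxx ?Fy' ?yG' ?FG' ?orbT.
    have [B fB /subsetP sB] := chain_lift ch.
    have /imsetP[F1 BF eF1] := sB F (ltac:(by rewrite !inE eqxx)).
    have /imsetP[G1 BG eG1] := sB G (ltac:(by rewrite !inE eqxx orbT)).
    have /imsetP[y1 By ey1] := sB y (ltac:(by rewrite !inE eqxx orbT)).
    have rF1 : rk le F1 = rk le F0 by rewrite -!quo_rk -eF1 eF.
    have rG1 : rk le G1 = rk le G0 by rewrite -!quo_rk -eG1 eG.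
    (* Aligning both ends by the same [k] moves [y1] between [F0] and [G0], where the diamond
       condition upstairs applies. *)
    have [u v Bu Av ruv|k Kk hk] := @KQ B A (mem [:: rk le F0; rk le G0]) fB fA.
      rewrite !inE => /orP[]/eqP ru; apply/quoP.
        rewrite (flag_inj po fs fB Bu BF) ?ru ?rF1 // -eF1 eF.
        by rewrite (flag_inj po fs fA Av AF) // -ruv.
      rewrite (flag_inj po fs fB Bu BG) ?ru ?rG1 // -eG1 eG.
      by rewrite (flag_inj po fs fA Av AG) // -ruv.
    have kF : k F1 = F0 by apply: hk; rewrite // rF1 !inE eqxx.
    have kG : k G1 = G0 by apply: hk; rewrite // rG1 !inE eqxx orbT.
    have ry : rk le y1 = (rk le F0).+1.
      have h1 := ltp_rk qpo quo_fs Fy; have h2 := ltp_rk qpo quo_fs yG.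
      rewrite eF ey1 !quo_rk in h1; rewrite eG ey1 !quo_rk rFG ltnS in h2.
      by apply/eqP; rewrite eqn_leq h1 h2.
    have hky : ltp le F0 (k y1) && ltp le (k y1) G0.
      have fkB := aut_flag hP (Kaut Kk) fB.
      rewrite !(flag_ltp po fs fkB) ?imset_f //.
      - by rewrite Krk // ry ltnS leqnn rFG ltnS leqnn.
      - by rewrite -kG imset_f.
      by rewrite -kF imset_f.
    have hx : ltp le F0 x && ltp le x G0 by rewrite !(flag_ltp po fs fA) // rx rFG !ltnS !leqnn.
    have hx' : ltp le F0 x' && ltp le x' G0.
      by rewrite !(flag_ltp po fs (flag_swap (rk le F0).+1 fA)) // rx' rFG !ltnS !leqnn.
    have FG0 : ltp le F0 G0 by rewrite (flag_ltp po fs fA) // rFG ltnS leqnSn.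
    rewrite ey1 -(quoK y1 Kk); have [->|/eqP nx] := eqVneq (k y1) x; first by left.
    right; rewrite (mid_unique hP rFG FG0 hx hky hx' nx) //.
    exact: (swap_face_neq hP fA li Ax Ax').
  have fS := flag_swap (rk le F0).+1 fA.
  rewrite eF eG => -[]/eqP->.
    by split; rewrite (lt A) // rx ?rFG ltnS leqnn.
  by split; rewrite (lt (swap le (rk le F0).+1 A)) // rx' ?rFG ltnS leqnn.
move=> P Q /quo_flag_lift[A fA ->] /quo_flag_lift[B fB ->].
(* [S] collects the ranks at which the quotient flags coincide. After alignment there, a path
   upstairs that keeps the common faces projects to the path required. *)
pose S i := [exists x in A, [exists y in B, [&& rk le x == i, rk le y == i & quo x == quo y]]].
have [x y Ax By rxy|k Kk hk] := @KQ A B S fA fB.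
  case/exists_inP=> x1 Ax1 /exists_inP[y1 By1 /and3P[/eqP rx1 /eqP ry1 q1]].
  have -> : x = x1 by apply: (flag_inj po fs fA).
  have -> : y = y1 by apply: (flag_inj po fs fB); rewrite // -rxy.
  exact/quoP.
have fkA := aut_flag hP (Kaut Kk) fA.
have ekA : quo @: (k @: A) = quo @: A.
  by rewrite -imset_comp; apply: eq_imset => x /=; rewrite quoK.
have [w [lw rw hw]] := connect hP fkA fB.
have [|||s [ps ls hs]] := @run_path _ le n Tq (fun X => quo @: X) (k @: A :&: B) (k @: A) w fkA _ lw.
- exact: subsetIl.
- by move=> i x iw /setIP[Ax Bx]; apply: hw.
- by move=> C i fC _ _ li; apply: quo_adjacent.
rewrite /= ekA rw in ps ls; exists s; split=> //.
apply/allP => L /hs[C [fC /subsetP sC ->]]; rewrite quo_flag //=.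
apply/subsetP => z /setIP[/imsetP[x Ax ->] /imsetP[y By e]].
have rxy : rk le x = rk le y by rewrite -!quo_rk e.
have kx : k x = y.
  apply: hk => //; apply/exists_inP; exists x => //; apply/exists_inP; exists y => //.
  by rewrite eqxx -rxy eqxx e eqxx.
by rewrite e; apply: imset_f; apply: sC; rewrite inE By -kx imset_f.
Qed.

Lemma quo_covering : covering le quo_le quo.
Proof.
split.
- by move=> y; exists (val y); apply: quo_val.
- exact: quo_rk.
- exact: quo_le_mono.
move=> P Q fP fQ /(adj_swap hP fP fQ)[i li ->].
exact: quo_adjacent.
Qed.

Lemma quo_aut g : g \in autG -> g \in ('N(K))%g ->
  exists2 g' : {perm Tq}, is_aut quo_le g' & forall x, g' (quo x) = quo (g x).
Proof.
move=> Gg nKg; have ag := elimT (autgP _ _) Gg.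
have gk h k x : h \in ('N(K))%g -> k \in K -> exists2 l, l \in K & h (k x) = l (h x).
  move=> nh Kk; exists (k ^ h)%g; first by rewrite memJ_norm.
  by rewrite -!permM conjgE !mulgA mulgV mul1g.
pose f (y : Tq) := quo (g (val y)).
have fq x : f (quo x) = quo (g x).
  rewrite /f /=; have [k Kk <-] := qequivP _ _ (qrepP x).
  by have [l Kl ->] := gk g k x nKg Kk; rewrite quoK.
have injf : injective f.
  move=> y z; rewrite -(quo_val y) -(quo_val z) !fq => /eqP/quoP[k Kk e].
  have nV : (g^-1)%g \in ('N(K))%g by rewrite groupV.
  have [l Kl el] := gk _ k (g (val y)) nV Kk.
  apply/eqP/quoP; exists l => //.
  by rewrite e !permK in el.
exists (perm injf) => [y z|x]; last by rewrite permE fq.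
rewrite !permE -(quo_val y) -(quo_val z) !fq; apply/quo_leP/quo_leP => -[k Kk h].
  have nV : (g^-1)%g \in ('N(K))%g by rewrite groupV.
  have [l Kl el] := gk _ k (g (val z)) nV Kk; rewrite permK in el.
  by exists l => //; rewrite -ag -el permKV.
by have [l Kl el] := gk g k (val z) nKg Kk; exists l; rewrite // -el ag.
Qed.

End Quotient.

Import GroupScope.

(** * Products of cyclic groups *)

Section ProductsOfCyclicGroups.

Variable gT : finGroupType.
Implicit Types (A B G K N : {group gT}) (x y z : gT).

(** Factoring [b ^ x] and [a ^ y] shows that [x * y] and [y * x] conjugate [[~ a, b]] alike, so
    [[~ x, y]] commutes with it. Modulo [[~: A, B]] the images of [A] and [B] commute, so the
    derived group of [G] lies in this abelian group. *)
Theorem Ito_der1_abelian A B G :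
  A * B = G -> abelian A -> abelian B -> abelian G^`(1).
Proof.
move=> defG abA abB.
have defG' : B * A = G by rewrite -invMG defG invGid.
have sAG : A \subset G by rewrite -defG mulG_subl.
have sBG : B \subset G by rewrite -defG mulG_subr.
have cA a a' : a \in A -> a' \in A -> [~ a, a'] = 1.
  by move=> Aa Aa'; apply/eqP/commgP; apply: (centsP abA).
have cB b b' : b \in B -> b' \in B -> [~ b, b'] = 1.
  by move=> Bb Bb'; apply/eqP/commgP; apply: (centsP abB).
have key a x b y : a \in A -> x \in A -> b \in B -> y \in B ->
    [~ a, b] ^ (x * y) = [~ a, b] ^ (y * x).
  move=> Aa Ax Bb By.
  have : b ^ x \in A * B by rewrite defG groupJ ?(subsetP sAG x) ?(subsetP sBG b).
  case/mulsgP=> a1 b1 Aa1 Bb1 e1.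
  have : a ^ y \in B * A by rewrite defG' groupJ ?(subsetP sAG a) ?(subsetP sBG y).
  case/mulsgP=> b2 a2 Bb2 Aa2 e2.
  have ax : a ^ x = a by apply/conjg_fixP/eqP; apply: cA.
  have by' : b ^ y = b by apply/conjg_fixP/eqP; apply: cB.
  have a2x : a2 ^ x = a2 by apply/conjg_fixP/eqP; apply: cA.
  have b1y : b1 ^ y = b1 by apply/conjg_fixP/eqP; apply: cB.
  rewrite !conjgM conjRg ax e1 commgMJ (cA a a1) // conj1g mulg1.
  rewrite conjRg b1y e2 commMgJ (cB b2 b1) // conj1g mul1g.
  rewrite [in RHS]conjRg by' e2 commMgJ (cB b2 b) // conj1g mul1g.
  by rewrite [in RHS]conjRg a2x e1 commgMJ (cA a2 a1) // conj1g mulg1.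
have abR : abelian [~: A, B].
  rewrite /commutator abelian_gen; apply/centsP.
  move=> _ /imset2P[a b Aa Bb ->] _ /imset2P[x y Ax By ->].
  apply/commgP/conjg_fixP.
  rewrite [[~ x, y]]commgEl conjgE.
  have -> : x^-1 * (y^-1 * (x * y)) = (x^-1 * y^-1) * (x * y) by rewrite mulgA.
  by rewrite conjgM key ?groupV // -conjgM mulgA mulgKV mulVg conjg1.
apply: abelianS abR; apply: der1_min.
  by rewrite -defG mul_subG // (subset_trans _ (commg_norm A B)) ?joing_subl ?joing_subr.
rewrite -defG quotientMl; last first.
  by rewrite (subset_trans _ (commg_norm A B)) ?joing_subl.
rewrite abelianM !quotient_abelian //=.
by rewrite centsC; apply: quotient_cents2r.
Qed.

Lemma coprime_commg_cent_prod K N :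
  N \subset 'N(K) -> coprime #|K| #|N| -> solvable K ->
  [~: K, N] * 'C_K(N) = K.
Proof.
move=> nKN coKN solK; have sRK : [~: K, N] \subset K by rewrite commg_subl.
have nRK : K \subset 'N([~: K, N]) by apply: commg_norml.
have eqC : 'C_K(N) / [~: K, N] = K / [~: K, N].
  rewrite (coprime_quotient_cent sRK) ?commg_normr //.
  by apply/setIidPl; apply: quotient_cents2r.
apply/eqP; rewrite eqEsubset mul_subG ?subsetIl //=.
by move: (subxx (K / [~: K, N])); rewrite -{2}eqC quotientSK.
Qed.

Lemma coprime_commg_id K N :
  N \subset 'N(K) -> coprime #|K| #|N| -> solvable K ->
  [~: [~: K, N], N] = [~: K, N].
Proof.
move=> nKN coKN solK; have nRN : N \subset 'N([~: K, N]) by apply: commg_normr.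
apply/eqP; rewrite eqEsubset commg_subl nRN gen_subG /=.
apply/subsetP=> _ /imset2P[k n Kk Nn ->].
have /mulsgP[r c Rr /setIP[Kc cNc] ->] : k \in [~: K, N] * 'C_K(N).
  by rewrite coprime_commg_cent_prod.
rewrite commMgJ (_ : [~ c, n] = 1) ?mulg1; last first.
  by apply/eqP/commgP; apply: (centP cNc).
rewrite conjRg (_ : n ^ c = n); last first.
  by apply/conjg_fixP/commgP/esym; apply: (centP cNc).
have nRc : c \in 'N([~: K, N]) by apply: (subsetP (commg_norml K N)).
by apply: mem_commg; rewrite ?memJ_norm.
Qed.

Lemma norm_card2_cents (X N : {group gT}) :
  #|X| = 2 -> N \subset 'N(X) -> N \subset 'C(X).
Proof.
move=> oX nXN; rewrite centsC; apply/centsP=> x Xx n Nn.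
have [-> | ntx] := eqVneq x 1; first exact/commute_sym/commute1.
apply/commgP/conjg_fixP.
have defX : X :=: [set 1; x].
  apply/eqP; rewrite eq_sym eqEcard oX cards2 eq_sym ntx andbT.
  by rewrite subUset !sub1set group1 Xx.
have : x ^ n \in X by rewrite memJ_norm ?(subsetP nXN).
rewrite defX !inE => /orP[]/eqP // xn1.
by case/eqP: ntx; apply/eqP; rewrite -(conjg_eq1 x n) xn1.
Qed.

Lemma gen_induction (X : {set gT}) (P : gT -> Prop) :
  P 1 -> (forall x, x \in X -> P x) -> (forall x y, P x -> P y -> P (x * y)) ->
  forall x, x \in <<X>> -> P x.
Proof.
move=> P1 PX PM x /gen_prodgP[n [c Xc ->]].
by apply: (big_ind P) => // i _; apply: PX.
Qed.

(** Automorphisms of a cyclic group are power maps, and power maps commute. *)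
Lemma cyclic_conjgC (R : {group gT}) g h r :
  cyclic R -> g \in 'N(R) -> h \in 'N(R) -> r \in R -> r ^ (g * h) = r ^ (h * g).
Proof.
case/cyclicP=> u defR ng nh; rewrite defR => /cycleP[i ->].
have Ru t : t \in 'N(R) -> exists j, u ^ t = u ^+ j.
  by move=> nt; apply/cycleP; rewrite -defR memJ_norm // defR cycle_id.
have [[j ej] [k ek]] := (Ru g ng, Ru h nh).
by rewrite !conjXg; congr (_ ^+ _); rewrite !conjgM ej ek !conjXg ej ek -!expgM mulnC.
Qed.

End ProductsOfCyclicGroups.

(** Modulo the Frattini subgroup, [K] has rank at most 2, and [[~: K, N]] and [<[y]>] meet trivially
    there because [N] centralises [y]; both images have order [p], and together they generate. For
    [p = 2] the action on the first would be trivial. Cyclicity is proved by contradiction, in a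
    quotient where [[~: K, N]] becomes elementary abelian of order [p ^ 2]. *)
Lemma cyclic_commg_of_prod_cycles (gT : finGroupType) (p : nat)
    (K N : {group gT}) (x y : gT) :
  p.-group K -> <[x]> * <[y]> = K -> N \subset 'N(K) -> coprime #|K| #|N| ->
  y \in 'C(N) -> <[x]> != K -> ~~ (N \subset 'C(K)) ->
  [/\ cyclic [~: K, N], [~: K, N] * <[y]> = K & 2 < p].
Proof.
move=> pK defK nKN coKN cNy nxK ncNK.
have solK := pgroup_sol pK; have nilK := pgroup_nil pK.
have xK : x \in K by rewrite -defK (subsetP (mulG_subl _ _)) ?cycle_id.
have yK : y \in K by rewrite -defK (subsetP (mulG_subr _ _)) ?cycle_id.
have sRK : [~: K, N] \subset K by rewrite commg_subl.
have nRK : K \subset 'N([~: K, N]) by apply: commg_norml.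
have nsRK : [~: K, N] <| K by rewrite /normal sRK.
have prodK := coprime_commg_cent_prod nKN coKN solK.
have RN := coprime_commg_id nKN coKN solK.
have ntK : K :!=: 1 by apply: contra ncNK => /eqP->; apply: cents1.
have [p_pr _ _] := pgroup_pdiv pK ntK.
set P := 'Phi(K); have nPK : K \subset 'N(P) by apply: normal_norm (Phi_normal K).
have nPN : N \subset 'N(P) by apply: char_norm_trans (Phi_char K) nKN.
have abK : p.-abelem (K / P) by apply: Phi_quotient_abelem.
have ncR : ~~ ([~: K, N] \subset P).
  apply: contra ncNK => sRP; rewrite centsC; apply/setIidPl.
  rewrite -[LHS]genGid.
  apply: Phi_nongen; apply/eqP; rewrite eqEsubset join_subG Phi_sub subsetIl /=.
  by rewrite -{1}prodK mulG_subG joing_subr (subset_trans sRP) ?joing_subl.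
have yP : y \notin P.
  apply: contra nxK => yP; apply/eqP; rewrite -[LHS]genGid; apply: Phi_nongen.
  apply/eqP; rewrite eqEsubset join_subG Phi_sub cycle_subG xK /=.
  by rewrite -{1}defK mulG_subG joing_subr cycle_subG mem_gen // inE yP.
have coKNP : coprime #|K / P| #|N / P| by apply: coprime_morph.
have nKNP : N / P \subset 'N(K / P) by apply: quotient_norms.
have abKP := abelem_abelian abK.
have RP : [~: K, N] / P = [~: K / P, N / P] by apply: quotientR.
have tiRy : [~: K, N] / P :&: <[y]> / P = 1.
  apply/trivgP; rewrite -(coprime_abel_cent_TI nKNP coKNP abKP) -RP.
  by apply: setIS; apply: quotient_cents; rewrite cycle_subG.
have nyP : <[y]> \subset 'N(P) by rewrite cycle_subG (subsetP nPK).
have nxP : <[x]> \subset 'N(P) by rewrite cycle_subG (subsetP nPK).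
have oKP : #|K / P| <= p ^ 2.
  have ocyc z : z \in K -> #|<[z]> / P| <= p.
    move=> zK; rewrite quotient_cycle ?(subsetP nPK) // -orderE.
    apply: dvdn_leq (prime_gt0 p_pr) _; rewrite order_dvdn.
    by have [_ ->] := abelemP p_pr abK; rewrite ?mem_quotient.
  rewrite -defK quotientMl // expnS expn1.
  apply: leq_trans (dvdn_leq _ (dvdn_cardMg _ _)) _; first by rewrite muln_gt0 !cardG_gt0.
  by rewrite leq_mul ?ocyc.
have p_dvd (X : {group coset_of P}) : X \subset K / P -> X :!=: 1 -> p <= #|X|.
  move=> sX ntX; have pX : p.-group X by apply: pgroupS sX (abelem_pgroup abK).
  by have [_ d _] := pgroup_pdiv pX ntX; apply: dvdn_leq.
have ntyP : <[y]> / P != 1.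
  by rewrite -subG1 quotient_sub1 // cycle_subG.
have ntRP : [~: K, N] / P != 1.
  by rewrite -subG1 quotient_sub1 // (subset_trans sRK).
have syK : <[y]> / P \subset K / P by rewrite quotientS // cycle_subG.
have sRKP : [~: K, N] / P \subset K / P by apply: quotientS.
have oprod : #|[~: K, N] / P * (<[y]> / P)| = (#|[~: K, N] / P| * #|<[y]> / P|)%N.
  exact: TI_cardMg.
have defKP : [~: K, N] / P * (<[y]> / P) = K / P.
  apply/eqP; rewrite eqEcard mul_subG //= oprod (leq_trans oKP) //.
  by rewrite expnS expn1 leq_mul ?p_dvd.
have oRP : #|[~: K, N] / P| = p.
  apply/eqP; rewrite eqn_leq p_dvd // andbT.
  move: oKP; rewrite -defKP oprod expnS expn1.
  by move/(leq_trans (leq_mul (leqnn _) (p_dvd _ syK ntyP))); rewrite leq_pmul2r ?prime_gt0.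
have p_gt2 : 2 < p.
  rewrite ltn_neqAle prime_gt1 // andbT; apply: contra ntRP => /eqP p2.
  have cNR : N / P \subset 'C([~: K, N] / P).
    apply: norm_card2_cents; first by rewrite oRP.
    by apply: quotient_norms; apply: commg_normr.
  rewrite -RN quotientR ?(subset_trans sRK) //; apply/eqP/commG1P.
  by rewrite centsC.
have defKR : [~: K, N] * <[y]> = K.
  have nRy : <[y]> \subset 'N([~: K, N]) by rewrite cycle_subG (subsetP nRK).
  rewrite -norm_joinEr //= -[LHS]genGid; apply: Phi_nongen.
  apply/eqP; rewrite eqEsubset join_subG Phi_sub join_subG sRK cycle_subG yK /=.
  have nPM : [~: K, N] <*> <[y]> \subset 'N('Phi(K)).
    by rewrite join_subG nyP (subset_trans sRK).
  rewrite (norm_joinEr nPM) -quotientSK //= (norm_joinEr nRy).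
  by rewrite quotientMl ?(subset_trans sRK) // defKP.
split=> //; apply: Phi_quotient_cyclic.
set R := [~: K, N] in sRK nRK nsRK RN defKR *; set F := 'Phi(R).
have pR : p.-group R by apply: pgroupS pK.
have nsFK : F <| K by apply: char_normal_trans (Phi_char _) nsRK.
have nFK := normal_norm nsFK.
have nRN : N \subset 'N(R) by apply: commg_normr.
have nFN : N \subset 'N(F) by apply: char_norm_trans (Phi_char _) nRN.
have nFR : R \subset 'N(F) by apply: subset_trans sRK nFK.
have sFR : F \subset R by apply: Phi_sub.
have abU : p.-abelem (R / F) by apply: Phi_quotient_abelem.
(* [N] centralises [y] but fixes nothing nontrivial in the Frattini quotient of [R], because
   [[~: R, N] = R]. *)
have sRyF : R :&: <[y]> \subset F.
  rewrite -quotient_sub1; last by rewrite subIset ?nFR.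
  have coU : coprime #|R / F| #|N / F|.
    by apply: coprime_morph; apply: coprimeSg coKN.
  rewrite -(coprime_abel_cent_TI (quotient_norms _ nRN) coU (abelem_abelian abU)).
  rewrite -quotientR // RN subsetI quotientS ?subsetIl //=.
  apply: subset_trans (quotientS _ (subsetIr _ _)) _.
  by apply: quotient_cents; rewrite cycle_subG.
rewrite (abelem_cyclic abU) leqNgt; apply/negP => lU.
have pKF : p.-group (K / F) by apply: quotient_pgroup.
have nsUK : R / F <| K / F by apply: quotient_normal.
(* The subtracted 2 makes [Q] a subgroup of index [p ^ 2] in [R / F], normal in [K / F]. *)
have [Q [sQU nsQ oQ]] := normal_pgroup pKF nsUK (leq_subr 2 _).
have [R2 defQ sFR2 nsR2K] := inv_quotientN nsFK nsQ.
have nR2K := normal_norm nsR2K.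
have sR2R : R2 \subset R.
  by rewrite -(quotientSGK _ sFR) ?(subset_trans (normal_sub nsR2K)) // -defQ.
have nR2R : R \subset 'N(R2) by apply: subset_trans sRK nR2K.
have oU : #|R / R2| = (p ^ 2)%N.
  rewrite card_quotient // -(@index_quotient_eq _ R%G 'Phi(R)%G R2) ?subIset ?sFR2 ?orbT //.
  have cQ : #|R2 / 'Phi(R)| = (p ^ (logn p #|R / F| - 2))%N by rewrite -oQ defQ.
  rewrite -divgS ?quotientS // cQ {1}(card_pgroup (abelem_pgroup abU)).
  by rewrite -expnB ?prime_gt0 ?leq_subr // subKn.
have pproper (rT : finGroupType) (X Y : {group rT}) :
    p.-group Y -> X \proper Y -> p * #|X| <= #|Y|.
  move=> pY /properP[sXY [e Ye nXe]]; rewrite -(Lagrange sXY) mulnC leq_pmul2l //.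
  have ntYX : #|Y : X| != 1%N.
    by rewrite indexg_eq1; apply: contra nXe => sYX; apply: (subsetP sYX).
  have /p_natP[[|k] eYX] : p.-nat #|Y : X| by apply: pnat_dvd (dvdn_indexg _ _) pY.
    by rewrite eYX in ntYX.
  by rewrite eYX expnS leq_pmulr // expn_gt0 prime_gt0.
have pKt : p.-group (K / R2) by apply: quotient_pgroup.
have nilKt := pgroup_nil pKt.
have sUK : R / R2 \subset K / R2 by apply: quotientS.
have pUt : p.-group (R / R2) by apply: pgroupS pKt.
have ntU : R / R2 != 1 by rewrite -cardG_gt1 oU (ltn_exp2l 0) ?prime_gt1.
have nUK : K / R2 \subset 'N(R / R2) by apply: quotient_norms.
have C1p : [~: R / R2, K / R2] \proper R / R2.
  by apply: (nil_comm_properl nilKt) => //; rewrite subsetI subxx.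
have oC1 : #|[~: R / R2, K / R2]| <= p.
  have := pproper _ [~: R / R2, K / R2]%G _ pUt C1p.
  by rewrite oU expnS expn1 leq_pmul2l ?prime_gt0.
have sC1K : [~: R / R2, K / R2] \subset K / R2 by apply: subset_trans (proper_sub C1p) sUK.
(* The first commutator has order at most [p], so one more kills it. Hence [[~ v, u]] below is
   central, as the power formula requires. *)
have C2 : [~: [~: R / R2, K / R2], K / R2] = 1.
  have [-> | ntC1] := eqsVneq [~: R / R2, K / R2] 1; first exact: comm1G.
  have C2p : [~: [~: R / R2, K / R2], K / R2] \proper [~: R / R2, K / R2].
    apply: (nil_comm_properl nilKt) => //; rewrite subsetI subxx /=.
    by rewrite (subset_trans _ (commg_normr _ _)).
  have := pproper _ [~: [~: R / R2, K / R2], K / R2]%G _ (pgroupS sC1K pKt) C2p.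
  move/leq_trans/(_ oC1); rewrite -{2}(muln1 p) leq_pmul2l ?prime_gt0 //.
  by move/card_le1_trivg.
have /mulsgP[r w Rr /cycleP[i ->] defx] : x \in R * <[y]> by rewrite defKR.
have Kr := subsetP sRK r Rr.
pose u := coset R2 r; pose v := coset R2 y ^+ i.
have nR2z z : z \in K -> z \in 'N(R2) by apply: (subsetP nR2K).
have defxt : coset R2 x = u * v by rewrite defx morphM ?morphX ?nR2z ?groupX.
have Ku : u \in K / R2 by apply: mem_quotient.
have Uu : u \in R / R2 by apply: mem_quotient.
have Kv : v \in K / R2 by rewrite groupX ?mem_quotient.
have C1c : [~ v, u] \in [~: R / R2, K / R2] by rewrite commGC mem_commg.
have cC1 z : z \in K / R2 -> commute z [~ v, u].
  by move=> Kz; apply/commute_sym; apply: (centsP (introT commG1P C2)).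
have sR'R2 : R^`(1) \subset R2 by apply: subset_trans sFR2; apply: der1_min nFR (abelem_abelian abU).
have up1 z : z \in R / R2 -> z ^+ p = 1.
  case/morphimP=> t nt Rt ->; rewrite -morphX //; apply: coset_id.
  apply: (subsetP sFR2); have [_ abUp] := abelemP p_pr abU.
  have nFt : t \in 'N(F) by apply: (subsetP nFR).
  apply: coset_idr; first by rewrite groupX.
  by rewrite morphX // abUp // mem_quotient.
(* In the [p]-th power of [u * v], both [u ^+ p] and the power ['C(p, 2)] of the commutator vanish,
   the latter because [p] is odd; only a power of [y] survives. *)
have xtp : coset R2 x ^+ p \in <[coset R2 y]>.
  rewrite defxt expMg_Rmul; try exact: cC1.
  rewrite up1 // mul1g.
  have /dvdnP[j ->] : p %| 'C(p, 2) by apply: prime_dvd_bin.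
  rewrite mulnC expgM (up1 [~ v, u]) ?(subsetP (proper_sub C1p)) // expg1n mulg1.
  by rewrite -expgM mem_cycle.
have tiUy : R / R2 :&: <[coset R2 y]> = 1.
  rewrite -quotient_cycle ?nR2z // -quotientGI //; apply/trivgP.
  by rewrite quotient_sub1 ?(subset_trans sRyF) // (subset_trans _ nR2R) ?subsetIl.
have defKt : R / R2 * <[coset R2 y]> = K / R2.
  by rewrite -quotient_cycle ?nR2z // -quotientMl // defKR.
have defKt2 : <[coset R2 x]> * <[coset R2 y]> = K / R2.
  by rewrite -!quotient_cycle ?nR2z // -quotientMl ?defK // cycle_subG nR2z.
(* Modulo [R2], the intersection of [<[x]>] and [<[y]>] has index at most [p] in [<[x]>], so their
   product has at most [p * #[y]] elements, against the [p ^ 2 * #[y]] computed from [R]. *)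
have := mul_cardG <[coset R2 x]> <[coset R2 y]>.
rewrite defKt2 -defKt (TI_cardMg tiUy) oU -!orderE => eo.
have ox : #[coset R2 x] <= p * #[coset R2 x ^+ p].
  rewrite orderXgcd.
  rewrite -{1}(divnK (dvdn_gcdl #[coset R2 x] p)) mulnC leq_mul // dvdn_leq ?prime_gt0 //.
  exact: dvdn_gcdr.
have oi : #[coset R2 x ^+ p] <= #|<[coset R2 x]> :&: <[coset R2 y]>|.
  by apply: subset_leq_card; rewrite subsetI !cycle_subG mem_cycle.
have : #[coset R2 x] * #[coset R2 y] <= p * #|<[coset R2 x]> :&: <[coset R2 y]>| * #[coset R2 y].
  by rewrite leq_pmul2r ?order_gt0 // (leq_trans ox) // leq_pmul2l ?prime_gt0.
rewrite eo mulnAC leq_pmul2r ?order_gt0 // leq_pmul2r ?cardG_gt0 //.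
by rewrite leqNgt -{1}(expn1 p) ltn_exp2l ?prime_gt1.
Qed.

(** A central [z] in [S] fixes every coset of [S], and each of the [#|G : S|] factors of its
    transfer is [z] itself. *)
Lemma transfer_central_morphism (gT : finGroupType) (G S : {group gT}) :
  S \subset G -> abelian S ->
  exists f : {morphism G >-> gT}, f @* G \subset S
    /\ {in S :&: 'C(G), forall z, f z = z ^+ #|G : S|}.
Proof.
move=> sSG abS.
have abA : abelian (idm S @* S) by rewrite morphim_idm.
pose f x := FiniteModule.fmval (transfer G abA x).
have fM : {in G &, {morph f : x y / x * y}}.
  by move=> x y Gx Gy; rewrite /f transferM.
exists (Morphism fM); split.
  apply/subsetP=> _ /morphimP[x _ _ ->] /=.
  apply: (subsetP (_ : idm S @* S \subset S)); first by rewrite morphim_idm.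
  exact: FiniteModule.fmodP.
move=> z /setIP[Sz /centP cGz] /=; rewrite /f /transfer.
rewrite (eq_bigr (fun _ => FiniteModule.fmod abA z)) => [|_ /rcosetsP[x Gx ->]]; last first.
  have Grx : repr (S :* x) \in G.
    have := mem_repr_rcoset S x; case/rcosetP=> t St ->.
    by rewrite groupM // (subsetP sSG).
  rewrite /= -rcosetM /= (_ : S :* (x * z) = S :* x); last first.
    by have -> : x * z = z * x; [rewrite cGz | rewrite rcosetM (rcoset_id Sz)].
  by rewrite -cGz // mulgK.
rewrite GRing.sumr_const FiniteModule.fmvalZ FiniteModule.fmodK //.
by apply: (subsetP (_ : S \subset idm S @* S)); rewrite ?morphim_idm.
Qed.

(** * The chirality group *)

Section ChiralityGroup.

Variables (gT : finGroupType) (s2 s3 : gT).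

(** The would-be graph of conjugation by the reflection that exchanges the middle face of the base
    flag, which would invert both rotations. The elements paired with 1 measure how far it is from
    being the graph of a map. *)
Definition mirror_pairs : {group gT * gT} :=
  <<[set (s2, s2^-1); (s3, s3^-1)]>>%G.

Definition chirality_set : {set gT} := [set h | (1, h) \in mirror_pairs].

Lemma chirality_group_set : group_set chirality_set.
Proof.
apply/group_setP; split=> [|h k]; rewrite !inE; first exact: group1.
move=> hh kk; have : (1 * 1, h * k) \in mirror_pairs by apply: (groupM hh kk).
by rewrite mul1g.
Qed.

Canonical chirality_group := Group chirality_group_set.

Lemma mirror_pair2 : (s2, s2^-1) \in mirror_pairs.
Proof. by rewrite mem_gen // !inE eqxx. Qed.

Lemma mirror_pair3 : (s3, s3^-1) \in mirror_pairs.
Proof. by rewrite mem_gen // !inE eqxx orbT. Qed.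

Lemma mirror_pairs_ind (P : gT -> gT -> Prop) :
  P 1 1 -> P s2 s2^-1 -> P s3 s3^-1 ->
  (forall g h g' h', P g h -> P g' h' -> P (g * g') (h * h')) ->
  forall g h, (g, h) \in mirror_pairs -> P g h.
Proof.
move=> P1 P2 P3 PM g h gh.
apply: (gen_induction (P := fun u => P u.1 u.2) _ _ _ gh) => //.
  by move=> _ /set2P[]->.
by move=> [a b] [c d]; apply: PM.
Qed.

Lemma mirror_pairs_gen (G0 : {group gT}) g h :
  s2 \in G0 -> s3 \in G0 -> (g, h) \in mirror_pairs -> g \in G0 /\ h \in G0.
Proof.
move=> G2 G3; move: g h; apply: mirror_pairs_ind; rewrite ?groupV //.
by move=> g h g' h' [Gg Gh] [Gg' Gh']; rewrite !groupM.
Qed.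

Lemma chirality_norm : (s2 \in 'N(chirality_group)) && (s3 \in 'N(chirality_group)).
Proof.
have nC g h : (g, h) \in mirror_pairs -> h \in 'N(chirality_group).
  move=> gh; rewrite inE; apply/subsetP=> _ /imsetP[k + ->].
  rewrite !inE => kk; have : (1 ^ g, k ^ h) \in mirror_pairs by apply: (groupJ kk gh).
  by rewrite conj1g.
by rewrite -groupV (nC _ _ mirror_pair2) -groupV (nC _ _ mirror_pair3).
Qed.

(* If conjugation by [t] inverts both generators modulo [X], it realises the mirror map there. *)
Lemma chirality_sub_conj (X : {group gT}) t :
  s2 \in 'N(X) -> s3 \in 'N(X) -> s2 ^ t * s2 \in X -> s3 ^ t * s3 \in X ->
  chirality_group \subset X.
Proof.
move=> n2 n3 X2 X3.
have key g h : (g, h) \in mirror_pairs -> h \in 'N(X) /\ h * (g ^ t)^-1 \in X.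
  move: g h; apply: mirror_pairs_ind; rewrite ?groupV //.
  - by rewrite conj1g invg1 mulg1.
  - by rewrite -invMg groupV.
  - by rewrite -invMg groupV.
  move=> g h g' h' [nh Xh] [nh' Xh']; split; first exact: groupM.
  rewrite conjMg invMg.
  have -> : h * h' * ((g' ^ t)^-1 * (g ^ t)^-1) =
            (h' * (g' ^ t)^-1) ^ h^-1 * (h * (g ^ t)^-1).
    by rewrite [_ ^ h^-1]conjgE invgK !mulgA mulgKV.
  by rewrite groupM // memJ_norm ?groupV.
apply/subsetP=> h; rewrite inE => /key[_].
by rewrite conj1g invg1 mulg1.
Qed.

(* Along [mirror_pairs] the [V]-parts stay mutually inverse, while the [H]-parts act alike on [V]. *)
Lemma chirality_TI_complement (G0 V H : {group gT}) :
  V * H = G0 -> V :&: H = 1 -> abelian V -> G0 \subset 'N(V) ->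
  s2 \in G0 -> s2 \in 'C(V) -> s3 \in H -> {in V, forall b, b ^ s3 = b^-1} ->
  chirality_group :&: V = 1.
Proof.
move=> defG tiVH abV nVG G2 c2 H3 inv3.
have sVG : V \subset G0 by rewrite -defG mulG_subl.
have sHG : H \subset G0 by rewrite -defG mulG_subr.
have nV x : x \in H -> x \in 'N(V) by move=> /(subsetP sHG)/(subsetP nVG).
have key g h : (g, h) \in mirror_pairs -> exists b k k',
    [/\ b \in V, k \in H /\ k' \in H, g = b * k, h = b^-1 * k'
      & {in V, forall v, v ^ k^-1 = v ^ k'^-1}].
  move: g h; apply: mirror_pairs_ind.
  - by exists 1, 1, 1; split; rewrite ?group1 ?invg1 ?mulg1.
  - have /mulsgP[b k Vb Hk e2] : s2 \in V * H by rewrite defG.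
    have ck : k \in 'C(V).
      have -> : k = b^-1 * s2 by rewrite e2 mulKg.
      by rewrite groupM // groupV (subsetP abV).
    have fk v x : v \in V -> x \in 'C(V) -> v ^ x = v.
      by move=> Vv /centP cx; apply/conjg_fixP/commgP/esym/cx.
    exists b, k, k^-1; split; rewrite ?groupV //.
      by rewrite e2 invMg; apply: (centP (groupVr ck)); rewrite groupV.
    by move=> v Vv; rewrite invgK !fk ?groupV.
  - exists 1, s3, s3^-1; split; rewrite ?groupV ?group1 ?mul1g ?invg1 ?mul1g //.
    move=> v Vv; rewrite invgK inv3 //; apply: (conjg_inj s3).
    by rewrite conjgKV conjVg inv3 // invgK.
  move=> g h g' h' [b [k [k' [Vb [Hk Hk'] -> -> ek]]]] [c [l [l' [Vc [Hl Hl'] -> -> el]]]].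
  exists (b * c ^ k^-1), (k * l), (k' * l'); split.
  - by rewrite groupM // memJ_norm ?groupV ?nV.
  - by rewrite !groupM.
  - by rewrite conjgE invgK !mulgA mulgKV.
  - rewrite ek // invMg -conjVg.
    have cc : commute (c^-1 ^ k'^-1) b^-1.
      by apply: (centsP abV); rewrite ?groupV // memJ_norm ?groupV ?nV.
    by rewrite cc conjgE invgK !mulgA mulgKV.
  by move=> v Vv; rewrite !invMg !conjgM el // ek // memJ_norm ?groupV ?nV.
apply/trivgP/subsetP=> h /setIP[]; rewrite inE => /key[b [k [k' [Vb [Hk Hk'] e -> _]]]] Vh.
have b1 : b = 1.
  by apply/set1gP; rewrite -tiVH inE Vb -groupV -(mulg1 b^-1) e mulKg.
have Hh : k' \in V :&: H by rewrite inE Hk' andbT; move: Vh; rewrite b1 invg1 mul1g.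
by move: Hh; rewrite tiVH b1 invg1 mul1g.
Qed.

End ChiralityGroup.

(** * Group-theoretic core: normal subgroups of the vertex stabiliser inside the middle cyclic
    factor *)

Section Core.

Variables (gT : finGroupType) (s1 s2 s3 : gT) (G G0 Gm : {group gT}).
Local Notation A := <[s1]>.
Local Notation B := <[s2]>.
Local Notation D := <[s3]>.
Local Notation Ch := (chirality_group s2 s3).

Hypotheses (r12 : (s1 * s2) ^+ 2 = 1) (r23 : (s2 * s3) ^+ 2 = 1)
  (r123 : (s1 * s2 * s3) ^+ 2 = 1).
Hypotheses (defG : A * B = G) (defG0 : B * D = G0) (defGm : A * G0 = Gm).
Hypotheses (tiAG0 : A :&: G0 = 1) (tiGG0 : G :&: G0 = B) (tiBD : B :&: D = 1).
Hypothesis core3 : s3 ^+ 2 \in gcore G0 Gm.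
Hypothesis atom : forall K : {group gT}, K <| Gm -> K :!=: 1 -> K \subset G ->
  K \subset (K :&: A) * (K :&: B) -> s1 \notin K -> s2 \notin K -> Ch \subset K.

Local Notation C0 := (gcore G0 Gm).
Let tau := s2 * s3.

Let sAG : A \subset G. Proof. by rewrite -defG mulG_subl. Qed.
Let sBG : B \subset G. Proof. by rewrite -defG mulG_subr. Qed.
Let sBG0 : B \subset G0. Proof. by rewrite -defG0 mulG_subl. Qed.
Let sDG0 : D \subset G0. Proof. by rewrite -defG0 mulG_subr. Qed.
Let sAGm : A \subset Gm. Proof. by rewrite -defGm mulG_subl. Qed.
Let sG0Gm : G0 \subset Gm. Proof. by rewrite -defGm mulG_subr. Qed.
Let sGGm : G \subset Gm.
Proof. by rewrite -defG -defGm mulgS. Qed.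
Let G0s2 : s2 \in G0. Proof. by rewrite -cycle_subG. Qed.
Let G0s3 : s3 \in G0. Proof. by rewrite -cycle_subG. Qed.
Let Gs1 : s1 \in G. Proof. by rewrite -cycle_subG. Qed.
Let Gs2 : s2 \in G. Proof. by rewrite -cycle_subG. Qed.

Let e23 : s2 * s3 * s2 = s3^-1.
Proof. by apply: (mulIg s3); rewrite mulVg -[LHS]mulgA -expg2 r23. Qed.
Let e32 : s3 * s2 * s3 = s2^-1.
Proof. by apply: (mulgI s2); rewrite mulgV !mulgA -mulgA -expg2 r23. Qed.
Let e12 : s2 * s1 * s2 = s1^-1.
Proof. by apply: (mulgI s1); rewrite mulgV !mulgA -mulgA -expg2 r12. Qed.
Let tauV : tau^-1 = tau.
Proof. by apply/eqP; rewrite eq_invg_mul -expg2 r23. Qed.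
Let s1tau : s1 ^ tau = s1^-1.
Proof.
rewrite conjgE tauV; apply: (mulgI s1); rewrite mulgV.
by rewrite -r123 expg2 /tau !mulgA.
Qed.

Let norm_Gm (X : {group gT}) :
  s1 \in 'N(X) -> s2 \in 'N(X) -> s3 \in 'N(X) -> Gm \subset 'N(X).
Proof. by move=> n1 n2 n3; rewrite -defGm -defG0 !mul_subG ?cycle_subG. Qed.

Let norm_Gm_tau (X : {group gT}) :
  s1 \in 'N(X) -> s2 \in 'N(X) -> tau \in 'N(X) -> Gm \subset 'N(X).
Proof.
move=> n1 n2 nt; apply: norm_Gm => //.
by rewrite -(mulKg s2 s3) groupM ?groupV.
Qed.

Let Ch_G0 : Ch \subset G0.
Proof.
by apply/subsetP=> h; rewrite inE => /(mirror_pairs_gen G0s2 G0s3)[].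
Qed.

Let nChG0 : G0 \subset 'N(Ch).
Proof. by rewrite -defG0 mul_subG ?cycle_subG; case/andP: (chirality_norm s2 s3). Qed.

(** Modulo [s2 ^+ 2], conjugation by [s2] inverts both generators, because
    [s3 * s2 * s3 = s2^-1]. *)
Let Ch_sq (K : {group gT}) : K <| Gm -> s2 ^+ 2 \in K -> Ch \subset K.
Proof.
move=> /andP[_ nK] K2; have nG0 := subset_trans sG0Gm nK.
apply: (@chirality_sub_conj _ _ _ K s2); rewrite ?(subsetP nG0) //.
  by rewrite /conjg mulKg -expg2.
by rewrite conjgE -mulgA [s3 * s2 * s3]e32 -invMg groupV -expg2.
Qed.

Let nsC0 : C0 <| Gm. Proof. by rewrite gcore_normal. Qed.
Let sC0G0 : C0 \subset G0. Proof. exact: gcore_sub. Qed.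

(** Modulo the core, [s3] is an involution, and since [s2 * s3 * s2 = s3^-1] conjugation by it
    inverts [s2]. *)
Let Ch_C0 : Ch \subset C0.
Proof.
have nG0 := subset_trans sG0Gm (normal_norm nsC0).
apply: (@chirality_sub_conj _ _ _ _ s3); rewrite ?(subsetP nG0) //.
  by rewrite conjgE -mulgA e23 -invMg groupV -expg2.
by rewrite /conjg mulKg -expg2.
Qed.

(** Drops the nondegeneracy conditions of [atom]: if [s1] or [s2] lies in [K], then so does
    [s2 ^+ 2], and [Ch_sq] applies. *)
Let atom' (K : {group gT}) : K <| Gm -> K :!=: 1 -> K \subset G ->
  K \subset (K :&: A) * (K :&: B) -> Ch \subset K.
Proof.
move=> nsK ntK sKG tK; have nK := normal_norm nsK.
have [K1 | nK1] := boolP (s1 \in K).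
  apply: Ch_sq => //.
  have -> : s2 ^+ 2 = s1^-1 * (s1 ^ s2)^-1.
    by apply: (mulIg (s1 ^ s2)); rewrite mulgKV -e12 conjgE expg2 !mulgA mulgK.
  by rewrite groupM ?groupV // memJ_norm // (subsetP nK) // (subsetP sG0Gm).
have [K2 | nK2] := boolP (s2 \in K); first by rewrite Ch_sq ?groupX.
exact: atom.
Qed.

Section Hull.

Variable Y : {group gT}.
Hypotheses (nsY : Y <| Gm) (sYG : Y \subset G).
Let nY := normal_norm nsY.
Let nYG : G \subset 'N(Y). Proof. exact: subset_trans sGGm nY. Qed.
Let nYB : B \subset 'N(Y). Proof. exact: subset_trans sBG nYG. Qed.
Let nYA : A \subset 'N(Y). Proof. exact: subset_trans sAG nYG. Qed.

(* [hull Y] = Y (A :&: Y B) enlarges a normal subgroup [Y] of [G] so that it factors along [A * B]. *)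
Definition hullA : {group gT} := (A :&: (Y <*> B))%G.
Definition hull : {group gT} := (Y <*> hullA)%G.

Lemma hullE : hull = Y * hullA :> {set gT}.
Proof. by rewrite /= norm_joinEr // subIset ?nYA. Qed.

Lemma sub_hull : Y \subset hull. Proof. exact: joing_subl. Qed.

Lemma hull_G : hull \subset G.
Proof. by rewrite join_subG sYG subIset ?sAG. Qed.

Lemma hull_YB : hull \subset Y * B.
Proof. by rewrite hullE -(norm_joinEr nYB) mul_subG ?joing_subl ?subsetIr. Qed.

Lemma hull_capA : hull :&: A = hullA.
Proof.
apply/eqP; rewrite eqEsubset subsetI joing_subr subsetIl !andbT /=.
by rewrite setIC setIS //; move: hull_YB; rewrite -(norm_joinEr nYB).
Qed.

Lemma hull_prod : hullA * (hull :&: B) = hull.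
Proof.
apply/eqP; rewrite eqEsubset mul_subG ?joing_subr ?subsetIl //=.
apply/subsetP=> k Kk.
have /mulsgP[a b Aa Bb ek] : k \in A * B by rewrite defG (subsetP hull_G).
have YBk : k \in Y <*> B by rewrite (norm_joinEr nYB) (subsetP hull_YB).
have Aa1 : a \in hullA.
  rewrite inE Aa -(mulgK b a) -ek groupM ?groupV //.
  by rewrite (subsetP (joing_subr _ _)).
have Kb : b \in hull.
  by rewrite -(mulKg a b) -ek groupM ?groupV // (subsetP (joing_subr _ _)).
by rewrite ek mem_mulg // inE Kb.
Qed.

(** [s1] centralises [A], [tau] inverts it, and [s2] changes an element [y * b] of [hullA] only by a
    factor in [Y]. The generator [s3] is traded for [tau] because its action on [A] is not directly
    visible. *)
Lemma hull_normal : hull <| Gm.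
Proof.
rewrite /normal (subset_trans hull_G) //=.
have nh t : t \in Gm -> (forall a, a \in hullA -> a ^ t \in hull) -> t \in 'N(hull).
  move=> Gt H; rewrite inE; apply/subsetP=> _ /imsetP[k Kk ->].
  have /mulsgP[y a Yy a1 ->] : k \in Y * hullA by rewrite -hullE.
  have Ha := H a a1; rewrite conjMg groupMr //.
  by apply: (subsetP sub_hull); rewrite memJ_norm // (subsetP nY).
have sub1 : hullA \subset hull by apply: joing_subr.
apply: norm_Gm_tau; apply: nh; rewrite ?groupM ?(subsetP sGGm s1) ?(subsetP sG0Gm) //.
- move=> a a1; suff -> : a ^ s1 = a by apply: (subsetP sub1).
  case/setIP: a1 => /cycleP[i ->] _.
  by rewrite conjXg /conjg mulKg.
- move=> a a1; have : a \in Y * B by rewrite -(norm_joinEr nYB); case/setIP: a1.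
  case/mulsgP=> y b Yy Bb ea.
  have -> : a ^ s2 = y ^ s2 * y^-1 * a.
    rewrite ea conjMg -[RHS]mulgA mulKg; congr (_ * _); apply/conjg_fixP/commgP.
    by case/cycleP: Bb => i ->; apply/commute_sym/commuteX.
  have Ka := subsetP sub1 a a1; rewrite groupMr //; apply: (subsetP sub_hull).
  by rewrite groupMr ?groupV // memJ_norm // (subsetP nYG).
move=> a a1; suff -> : a ^ tau = a^-1 by rewrite groupV (subsetP sub1).
by case/setIP: a1 => /cycleP[i ->] _; rewrite conjXg s1tau expgVn.
Qed.

(** Counting in [hullA * B = Y * B]. The order of [hullA] thus divides that of [Y], which controls
    the primes of the hull. *)
Lemma card_hullA : (#|hullA| * #|Y :&: B|)%N = #|Y|.
Proof.
have tiAB : hullA :&: B = 1.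
  apply/trivgP; rewrite -tiAG0 /= -setIA; apply: setIS.
  by rewrite subIset // orbC (subset_trans _ sBG0).
have eYB : hullA * B = Y * B.
  rewrite /= setIC group_modr ?joing_subr // defG -(norm_joinEr nYB).
  by apply/setIidPl; rewrite join_subG sYG.
have := mul_cardG Y B; rewrite -eYB (TI_cardMg tiAB) mulnAC.
by move/eqP; rewrite eqn_pmul2r ?cardG_gt0 // => /eqP.
Qed.

Lemma hull_pgroup pi : pi.-group Y -> pi.-group hull.
Proof.
move=> piY; have piA : pi.-group hullA.
  by apply: pnat_dvd piY; rewrite -card_hullA dvdn_mulr.
by rewrite /pgroup hullE; apply: pnat_dvd (dvdn_cardMg _ _) _; rewrite pnatM; apply/andP; split.
Qed.

Lemma Ch_hull : Y :!=: 1 -> Ch \subset hull.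
Proof.
move=> ntY; apply: atom' => //.
- exact: hull_normal.
- by apply: contra ntY => /eqP e1; rewrite -subG1 -e1 sub_hull.
- exact: hull_G.
by rewrite hull_capA hull_prod.
Qed.

End Hull.

(** * A kernel of prime order not containing the chirality group is impossible *)

Section PrimeKernel.

Variables (N : {group gT}) (s : nat).
Hypotheses (sNB : N \subset B) (nsN : N <| G0) (s_pr : prime s) (oN : #|N| = s).
Hypothesis nChN : ~~ (Ch \subset N).

Let nNG0 := normal_norm nsN.
Let sNG0 := normal_sub nsN.
Let sNGm := subset_trans sNG0 sG0Gm.
Let L : {group gT} := <<class_support N Gm>>%G.
Let abB : abelian B := cycle_abelian s2.

Let norm_closure (X : {group gT}) :
  N \subset X -> Gm \subset 'N(X) -> L \subset X.
Proof. by move=> sNX nX; rewrite gen_subG class_support_sub_norm. Qed.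

Let sNL : N \subset L.
Proof. by apply/subsetP=> n Nn; rewrite mem_gen // -(conjg1 n) imset2_f. Qed.
Let sLGm : L \subset Gm.
Proof. by apply: norm_closure => //; apply: normG. Qed.
Let nsL : L <| Gm.
Proof. by rewrite /normal sLGm norms_gen ?class_support_norm. Qed.
(** [Gm = G0 * A] and [G0] normalises [N], so every conjugate of [N] is a conjugate by an element of
    [A]. *)
Let sLG : L \subset G.
Proof.
rewrite gen_subG; apply/subsetP=> _ /imset2P[n g Nn Gg ->].
have : g \in G0 * A by rewrite -invMG defGm invGid.
case/mulsgP=> g0 a G0g Aa ->; rewrite conjgM groupJ ?(subsetP sAG a) //.
by rewrite (subsetP sBG) // (subsetP sNB) // memJ_norm // (subsetP nNG0).
Qed.

Let ntN : N :!=: 1. Proof. by rewrite -cardG_gt1 oN prime_gt1. Qed.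
Let ntL : L :!=: 1.
Proof. by apply: contra ntN => /eqP L1; rewrite -subG1 -L1. Qed.
Let ntCh : Ch :!=: 1.
Proof. by apply: contra nChN => /eqP->; apply: sub1G. Qed.

Let Ch_B : Ch \subset B.
Proof. by rewrite -tiGG0 subsetI Ch_G0 (subset_trans (Ch_hull nsL sLG ntL)) ?hull_G. Qed.

(** [C0 :&: B] equals [C0 :&: G], so [G] normalises it; being cyclic, it has only characteristic
    subgroups. *)
Let subB_normal (X : {group gT}) :
  X \subset B -> X \subset C0 -> G0 \subset 'N(X) -> X <| Gm.
Proof.
move=> sXB sXC nX; rewrite /normal (subset_trans sXB) ?(subset_trans sBG0) //=.
have chX : X \char C0 :&: B.
  by rewrite sub_cyclic_char ?subsetI ?sXC // (cyclicS (subsetIr _ _)) ?cycle_cyclic.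
have eCB : C0 :&: B = C0 :&: G.
  apply/eqP; rewrite eqEsubset setIS //= subsetI subsetIl -tiGG0 subsetI subsetIr /=.
  by rewrite subIset ?sC0G0.
apply: norm_Gm; try by apply: (subsetP nX).
have: G \subset 'N(X).
  suff nCG : G \subset 'N(C0 :&: B) by apply: char_norm_trans chX nCG.
  by rewrite eCB normsI ?normG // (subset_trans sGGm (normal_norm nsC0)).
by move/subsetP; apply.
Qed.

Let subB_atom (X : {group gT}) : X \subset B -> X \subset C0 -> G0 \subset 'N(X) ->
  X :!=: 1 -> Ch \subset X.
Proof.
move=> sXB sXC nX ntX; apply: atom' => //; first exact: subB_normal.
  exact: subset_trans sXB sBG.
by rewrite (subset_trans _ (mulG_subr _ _)) // subsetI subxx.
Qed.

(** A subgroup of prime order in the cyclic group [Ch] is characteristic, so [G0] normalises it, and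
    [subB_atom] puts all of [Ch] inside it. *)
Let Ch_prime : prime #|Ch|.
Proof.
have Ch_gt1 : 1 < #|Ch| by rewrite cardG_gt1.
have [q q_pr] := pdivP Ch_gt1; case/(Cauchy q_pr)=> y Chy oy.
have chY : <[y]> \char Ch.
  by rewrite sub_cyclic_char ?cycle_subG // (cyclicS Ch_B) ?cycle_cyclic.
have sYC : <[y]> \subset Ch by rewrite cycle_subG.
have : Ch \subset <[y]>.
  apply: subB_atom; rewrite ?(subset_trans sYC) //.
    exact: char_norm_trans chY nChG0.
  by rewrite -cardG_gt1 -orderE oy prime_gt1.
move=> sCY; have <- : <[y]> = Ch by apply/eqP; rewrite eqEsubset sYC.
by rewrite -orderE oy.
Qed.

Let l := #|Ch|.

Let Ch_min (X : {group gT}) : X \subset B -> l.-group X -> X :!=: 1 -> Ch \subset X.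
Proof.
move=> sXB lX ntX; have [_ d _] := pgroup_pdiv lX ntX.
have [y Xy oy] := Cauchy Ch_prime d.
have sYX : <[y]> \subset X by rewrite cycle_subG.
suff -> : Ch :=: <[y]> by [].
by apply/eqP; rewrite (eq_subG_cyclic (cycle_cyclic s2)) ?(subset_trans sYX) // -orderE oy.
Qed.

Let s_neq_l : s != l.
Proof.
apply: contra nChN => /eqP sl; suff -> : Ch :=: N by [].
by apply/eqP; rewrite (eq_subG_cyclic (cycle_cyclic s2)) // oN sl.
Qed.

Let sl' (rT : finGroupType) (X : {group rT}) : s.-group X -> l^'.-group X.
Proof.
apply: sub_pgroup => p; rewrite !inE => /eqP ->.
by rewrite s_neq_l.
Qed.

Let sN' : s.-group N. Proof. by rewrite /pgroup oN pnat_id. Qed.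

Let tiNC0 : N :&: C0 = 1.
Proof.
apply: prime_TIg; rewrite ?oN //; apply: contra nChN => sNC.
exact: subB_atom.
Qed.

(* [N] and the core [C0] are normal in [G0] with trivial intersection, so the closure [L] of [N]
   centralises [C0]. *)
Let cLC0 : L \subset 'C(C0).
Proof.
apply: norm_closure; last by apply: norms_cent; apply: normal_norm.
apply/commG1P/trivgP; rewrite -tiNC0 subsetI commg_subl commg_subr.
rewrite (subset_trans sC0G0 nNG0) /=.
exact: subset_trans sNGm (normal_norm nsC0).
Qed.

(** The hull of a nontrivial [Y] would be an [l']-group containing [Ch], whose order is [l]. *)
Let p'_trivial (Y : {group gT}) : Y <| Gm -> Y \subset G -> l^'.-group Y -> Y :=: 1.
Proof.
move=> nsY sYG lY; apply/eqP/negPn/negP => ntY.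
have := pgroupS (Ch_hull nsY sYG ntY) (hull_pgroup nsY sYG lY).
by rewrite /pgroup p'natE ?Ch_prime // dvdnn.
Qed.

Let R : {group gT} := L^`(1)%G.
Let abR : abelian R.
Proof.
apply: abelianS (Ito_der1_abelian defG (cycle_abelian _) (cycle_abelian _)).
exact: dergS.
Qed.
Let nsRL : R <| L. Proof. exact: der_normal. Qed.
Let nsR : R <| Gm. Proof. exact: char_normal_trans (der_char 1 L) nsL. Qed.
Let sRL := normal_sub nsRL.
Let sRG := subset_trans sRL sLG.
Let nRL := normal_norm nsRL.
Let nRGm := normal_norm nsR.

Let nil_pgroup (Y : {group gT}) :
  Y <| Gm -> Y \subset G -> nilpotent Y -> l.-group Y.
Proof.
move=> nsY sYG nilY; have := nilpotent_pcoreC l nilY.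
rewrite (_ : 'O_l^'(Y) = 1) ?dprodg1 => [<-|]; first exact: pcore_pgroup.
apply: p'_trivial; rewrite ?pcore_pgroup ?(subset_trans (pcore_sub _ _)) //.
exact: char_normal_trans (pcore_char _ _) nsY.
Qed.

Let lR : l.-group R.
Proof. by apply: nil_pgroup => //; apply: abelian_nil. Qed.

(* [L / R] is abelian and generated by conjugates of the image of the [s]-group [N]. *)
Let sLR : s.-group (L / R).
Proof.
suff sLO : L / R \subset 'O_s(L / R) by apply: pgroupS sLO (pcore_pgroup _ _).
have sCL : class_support N Gm \subset 'N(R) by apply: subset_trans nRL; apply: subset_gen.
apply: (@subset_trans _ _ <<class_support N Gm / R>>); first by rewrite -quotient_gen.
rewrite gen_subG; apply/subsetP=> _ /morphimP[x nx Cx ->].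
change (coset R x \in 'O_s(L / R)).
have Lx : x \in L by apply: (subsetP (subset_gen _)).
have abLR : abelian (L / R) by apply: der_abelian.
rewrite -cycle_subG; apply: pcore_max; last first.
  by rewrite -sub_abelian_normal // cycle_subG mem_quotient.
case/imset2P: Cx nx Lx => n g Nn _ -> nx Lx.
suff : s.-group (<[n ^ g]> / R) by rewrite quotient_cycle.
apply: quotient_pgroup.
by rewrite /pgroup /= -orderE orderJ; apply: mem_p_elt sN' Nn.
Qed.

Let l_subR (X : {group gT}) : X \subset L -> l.-group X -> X \subset R.
Proof.
move=> sXL lX; rewrite -quotient_sub1 ?(subset_trans sXL) // subG1 trivg_card1.
apply/eqP; apply: pnat_1 (quotient_pgroup R lX) _.
exact: sl' (pgroupS (quotientS _ sXL) sLR).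
Qed.

Let nilR (Y : {group gT}) : Y \subset L -> R \subset 'C(Y) -> nilpotent Y.
Proof.
move=> sYL cRY.
have sYZ : Y^`(1) \subset 'Z(Y).
  rewrite subsetI der_sub; apply: subset_trans cRY.
  exact: dergS.
by rewrite -quotient_center_nil abelian_nil // sub_der1_abelian.
Qed.

(** Otherwise [L] centralises [R], hence is nilpotent and an [l]-group, although it contains the
    [s]-group [N]. *)
Let ncNR : ~~ (N \subset 'C(R)).
Proof.
apply/negP => cNR.
have cLR : L \subset 'C(R) by apply: norm_closure => //; apply: norms_cent.
have lL : l.-group L by apply: nil_pgroup => //; apply: nilR; rewrite // centsC.
have := pnat_1 (pgroupS sNL lL) (sl' sN').
by apply/eqP; rewrite -trivg_card1.
Qed.

Let cRL (X : {group gT}) : X <| Gm -> X \subset L -> X \subset 'C(R) -> X \subset R.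
Proof.
move=> nsX sXL cX; apply: l_subR => //; apply: nil_pgroup => //.
  exact: subset_trans sXL sLG.
by apply: nilR; rewrite // centsC.
Qed.

Let ntR : R :!=: 1.
Proof. by apply: contra ncNR => /eqP->; apply: cents1. Qed.

Let K : {group gT} := hull R.
Let A1 : {group gT} := hullA R.
Let B1 : {group gT} := (K :&: B)%G.
Let nsK : K <| Gm. Proof. exact: hull_normal. Qed.
Let lK : l.-group K. Proof. exact: hull_pgroup. Qed.
Let sChK : Ch \subset K. Proof. exact: Ch_hull. Qed.
Let defK : A1 * B1 = K. Proof. exact: hull_prod. Qed.
Let sRK : R \subset K. Proof. exact: sub_hull. Qed.
Let sA1A : A1 \subset A. Proof. exact: subsetIl. Qed.
Let sB1B : B1 \subset B. Proof. exact: subsetIr. Qed.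
Let nKN : N \subset 'N(K). Proof. exact: subset_trans sNGm (normal_norm nsK). Qed.
Let coKN : coprime #|K| #|N|. Proof. exact: pnat_coprime lK (sl' sN'). Qed.
Let tiAB : A :&: B = 1.
Proof. by apply/trivgP; rewrite -tiAG0 setIS. Qed.
Let cNB : B \subset 'C(N).
Proof. by rewrite (subset_trans abB) // centS. Qed.

(** [N] centralises the factor [B1]. The factor [A1] is not all of [K], because [K] contains the
    nontrivial group [Ch], which lies in [G0] and so meets [A] trivially. *)
Let kernel_facts :
  [/\ cyclic [~: K, N], [~: K, N] * B1 = K & 2 < l].
Proof.
have /cyclicP[x ex] : cyclic A1 by apply: cyclicS sA1A (cycle_cyclic _).
have /cyclicP[y ey] : cyclic B1 by apply: cyclicS sB1B (cycle_cyclic _).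
rewrite ey; apply: (@cyclic_commg_of_prod_cycles _ l K N x y) => //.
- by rewrite -ex -ey.
- by rewrite -cycle_subG -ey (subset_trans sB1B).
- rewrite -ex; apply: contra ntCh => /eqP eK.
  by rewrite -subG1 -tiAG0 subsetI Ch_G0 andbT (subset_trans sChK) // -eK.
by apply: contra ncNR => cNK; rewrite (subset_trans cNK) ?centS.
Qed.

Let cycKN : cyclic [~: K, N]. Proof. by have [] := kernel_facts. Qed.
Let prodK : [~: K, N] * B1 = K. Proof. by have [] := kernel_facts. Qed.
Let l_gt2 : 2 < l. Proof. by have [] := kernel_facts. Qed.
Let solK : solvable K := pgroup_sol lK.
Let KNN : [~: [~: K, N], N] = [~: K, N]. Proof. exact: coprime_commg_id. Qed.
Let sKNK : [~: K, N] \subset K. Proof. by rewrite commg_subl. Qed.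
Let sKNR : [~: K, N] \subset R.
Proof.
apply: l_subR; last exact: pgroupS lK.
apply: subset_trans (commgS K sNL) _; rewrite commg_subr.
exact: subset_trans (normal_sub nsK) (normal_norm nsL).
Qed.

Let tiKN : [~: K, N] :&: 'C(N) = 1.
Proof.
rewrite -{1}KNN; apply: coprime_abel_cent_TI.
- exact: commg_normr.
- exact: coprimeSg coKN.
exact: cyclic_abelian.
Qed.

Let cKN : 'C_K(N) \subset B1.
Proof.
apply/subsetP=> k /setIP[]; rewrite -{1}prodK => /mulsgP[r b Rr Bb ->] cN.
have cb : b \in 'C(N) by rewrite (subsetP cNB) // (subsetP sB1B).
have : r \in [~: K, N] :&: 'C(N) by rewrite inE Rr -(groupMr _ cb).
by rewrite tiKN => /set1gP->; rewrite mul1g.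
Qed.

(** With [S] a Sylow [s]-subgroup of [L] containing [N], one has [L = R * S], and [R] is the product
    of [[~: R, N]] and ['C_R(N)]. Once [S] centralises the second factor, [L] is abelian modulo
    [[~: R, N]], so [R] lies there. *)
Let R_KN : R \subset [~: K, N].
Proof.
have nRN : N \subset 'N(R) by apply: subset_trans sNGm nRGm.
have coRN : coprime #|R| #|N| by apply: coprimeSg coKN.
have eRN : [~: R, N] = [~: K, N].
  by apply/eqP; rewrite eqEsubset commSg //= -{1}KNN commSg.
have [S sylS sNS] := Sylow_superset sNL sN'.
have sSL := pHall_sub sylS; have sS := pHall_pgroup sylS.
have nRS := subset_trans sSL nRL.
have coRS : coprime #|R| #|S| by apply: pnat_coprime lR (sl' sS).
have tiRS := coprime_TIg coRS.
have eLR : S / R = L / R.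
  apply/eqP; rewrite eqEcard; apply/andP; split; first exact: quotientS.
  by rewrite (card_Hall (quotient_pHall nRS sylS)) part_pnat_id.
have defL : R * S = L.
  apply/eqP; rewrite eqEsubset mul_subG //= -quotientSK ?eLR //.
have abLR : abelian (L / R) by apply: der_abelian.
have abS : abelian S.
  rewrite (isog_abelian (quotient_isog nRS tiRS)); apply: abelianS abLR.
  exact: quotientS.
have cSN : S \subset 'C(N) by rewrite (subset_trans abS) ?centS.
have nSX : S \subset 'N('C_R(N)).
  by rewrite normsI // norms_cent // (subset_trans cSN) ?cent_sub.
have sXB1 : 'C_R(N) \subset B1 by rewrite (subset_trans _ cKN) ?setSI.
have sXB := subset_trans sXB1 sB1B.
(* Otherwise the commutator is a nontrivial [l]-subgroup of [B], so it contains [Ch]; but [L]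
   centralises [Ch], while coprime action leaves no fixed points in that commutator. *)
have cSX : S \subset 'C('C_R(N)).
  rewrite centsC; apply/commG1P/eqP/negPn/negP => ntXS.
  have sXS : [~: 'C_R(N), S] \subset 'C_R(N) by rewrite commg_subl.
  have sCh : Ch \subset [~: 'C_R(N), S].
    apply: Ch_min => //; first exact: subset_trans sXS sXB.
    by apply: pgroupS lR; rewrite (subset_trans sXS) ?subsetIl.
  have coX : coprime #|'C_R(N)| #|S| by apply: coprimeSg coRS; apply: subsetIl.
  have abX : abelian 'C_R(N) by apply: abelianS abR; apply: subsetIl.
  case/negP: ntCh; rewrite -subG1 -(coprime_abel_cent_TI nSX coX abX) subsetI sCh.
  by rewrite centsC (subset_trans sSL) // (subset_trans cLC0) // centS.
have nS1 : S \subset 'N([~: R, N]).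
  by rewrite normsR // (subset_trans cSN) ?cent_sub.
have nR1 : R \subset 'N([~: R, N]) by apply: commg_norml.
have prodR := coprime_commg_cent_prod nRN coRN (abelian_sol abR).
have sRS1 : [~: R, S] \subset [~: R, N].
  rewrite gen_subG; apply/subsetP=> _ /imset2P[r t Rr St ->].
  have /mulsgP[r1 x Rr1 Xx ->] : r \in [~: R, N] * 'C_R(N) by rewrite prodR.
  have -> : [~ r1 * x, t] = [~ r1, t] ^ x.
    rewrite commMgJ (_ : [~ x, t] = 1) ?mulg1 //; apply/eqP/commgP.
    by apply/commute_sym; apply: (centsP cSX).
  rewrite memJ_norm ?(subsetP nR1) //; last by case/setIP: Xx.
  rewrite commgEl groupMl ?groupV // memJ_norm ?(subsetP nS1) //.
rewrite -eRN; apply: (@der1_min _ L [~: R, N]%G).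
  by rewrite -defL mul_subG.
rewrite -defL quotientMl // abelianM !quotient_abelian //=.
by apply: quotient_cents2r; rewrite commGC.
Qed.

Let defR : R = [~: K, N] :> {set gT}.
Proof. by apply/eqP; rewrite eqEsubset R_KN sKNR. Qed.
Let cycR : cyclic R. Proof. by rewrite defR. Qed.
Let tiRN : R :&: 'C(N) = 1. Proof. by rewrite defR. Qed.
Let tiRB : R :&: B = 1. Proof. by apply/trivgP; rewrite -tiRN setIS. Qed.

(** Conjugations on the cyclic group [R] commute, so [n ^ g] and [n] act alike on it; their quotient
    lies in ['C_L(R)], which is contained in [R]. *)
Let conjN n g : n \in N -> g \in Gm -> n ^ g * n^-1 \in R.
Proof.
move=> Nn Gg; have Gn : n \in Gm by apply: (subsetP sNGm).
have nRx x : x \in Gm -> x \in 'N(R) by apply: (subsetP nRGm).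
have nsC : 'C_L(R) <| Gm.
  rewrite /normal (subset_trans (subsetIl _ _)) //= normsI ?norms_cent //.
  exact: normal_norm.
have sCR : 'C_L(R) \subset R by apply: cRL; rewrite ?subsetIl ?subsetIr.
have Ln x : x \in N -> x \in L by apply: (subsetP sNL).
have Lng : n ^ g \in L by rewrite memJ_norm ?Ln ?(subsetP (normal_norm nsL)).
apply: (subsetP sCR); rewrite inE (groupMr _ (groupVr (Ln n Nn))) Lng andTb.
apply/centP=> r Rr; apply/esym/commgP/conjg_fixP.
rewrite conjgM; apply: (canLR (conjgK _)).
rewrite [n ^ g]conjgE conjgM.
rewrite (cyclic_conjgC cycR) ?memJ_norm ?nRx ?groupV //.
by rewrite conjgM conjgKV.
Qed.

(** Both [A1] and [R] are complements of [B1] in [K]. *)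
Let oA1 : #|A1| = #|R|.
Proof.
have tiA1 : A1 :&: B1 = 1 by apply/trivgP; rewrite -tiAB setISS.
have tiR1 : R :&: B1 = 1 by apply/trivgP; rewrite -tiRB setIS.
have := TI_cardMg tiA1; rewrite defK -prodK -defR (TI_cardMg tiR1).
by move/eqP; rewrite eqn_pmul2r ?cardG_gt0 // => /eqP.
Qed.

Let hallA : l.-Hall(A) 'O_l(A).
Proof. exact: nilpotent_pcore_Hall (abelian_nil (cycle_abelian _)). Qed.
Let hallB : l.-Hall(B) 'O_l(B).
Proof. exact: nilpotent_pcore_Hall (abelian_nil (cycle_abelian _)). Qed.
Let hallD : l.-Hall(D) 'O_l(D).
Proof. exact: nilpotent_pcore_Hall (abelian_nil (cycle_abelian _)). Qed.

Let sB1l : B1 \subset 'O_l(B).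
Proof.
apply: pcore_max; first by apply: pgroupS lK; apply: subsetIl.
by rewrite -sub_abelian_normal.
Qed.

(** No nontrivial element of ['O_l(A)] commutes with a generator [n] of [N], so [n] has as many
    conjugates under ['O_l(A)] as this group has elements. By [conjN] they all lie in one coset of
    [R], which has the order of [A1]. *)
Let Al_A1 : 'O_l(A) = A1.
Proof.
have sA1K : A1 \subset K by rewrite -defK mulG_subl.
have lA1 : l.-group A1 by apply: pgroupS lK.
have sA1 : A1 \subset 'O_l(A).
  by apply: pcore_max => //; rewrite -sub_abelian_normal ?cycle_abelian.
apply/eqP; rewrite eq_sym eqEcard sA1 oA1 /=.
have /cyclicP[n en] : cyclic N by apply: prime_cyclic; rewrite oN.
have Nn : n \in N by rewrite en cycle_id.
have sOA : 'O_l(A) \subset A by apply: pcore_sub.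
have C1 : 'C_('O_l(A))[n] = 1.
  apply/eqP/negPn/negP => ntC.
  have ntA1 : A1 :!=: 1 by rewrite -cardG_gt1 oA1 cardG_gt1.
  have lC : l.-group 'C_('O_l(A))[n] by apply: pgroupS (pcore_pgroup l A); apply: subsetIl.
  have [_ d1 _] := pgroup_pdiv lA1 ntA1; have [x1 A1x1 ox1] := Cauchy Ch_prime d1.
  have [_ d2 _] := pgroup_pdiv lC ntC; have [x2 Cx2 ox2] := Cauchy Ch_prime d2.
  have [Ox2 cx2] := setIP Cx2.
  have ex : <[x2]> = <[x1]>.
    apply/eqP; rewrite (eq_subG_cyclic (cycle_cyclic s1)) ?cycle_subG; last first.
    - exact: (subsetP sA1A).
    - exact: (subsetP sOA).
    by rewrite -!orderE ox1 ox2.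
  have A1x2 : x2 \in A1 by rewrite -cycle_subG ex cycle_subG.
  have : x2 \in 'C_K(N) by rewrite inE (subsetP sA1K) // en cent_cycle.
  move/(subsetP cKN)/(subsetP sB1B) => Bx2.
  have : x2 \in A :&: B by rewrite inE Bx2 (subsetP sA1A).
  rewrite tiAB => /set1gP x21; move: (prime_gt1 Ch_prime).
  by rewrite -ox2 x21 order1.
have := index_cent1 'O_l(A) n; rewrite C1 indexg1 => ->.
rewrite -(card_rcoset R n); apply: subset_leq_card.
apply/subsetP=> _ /imsetP[a Oa ->]; rewrite mem_rcoset conjN //.
by rewrite (subsetP sAGm) // (subsetP sOA).
Qed.

Let KRA1 : K = R * A1 :> {set gT}. Proof. exact: hullE. Qed.

(** On [B] the actions of [s3] and [tau] coincide. Writing [b = r * a] in [R * A1], with [tau]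
    inverting [a], puts [b ^ tau * b] into [R]; it also lies in [B], hence is trivial. *)
Let inv_B1 : {in B1, forall b, b ^ s3 = b^-1}.
Proof.
move=> b B1b; have Bb := subsetP sB1B b B1b.
have -> : b ^ s3 = b ^ tau.
  rewrite conjgM; congr (_ ^ _); apply/esym/conjg_fixP/commgP.
  by apply: (centsP abB); rewrite // cycle_id.
have : b \in R * A1 by rewrite -KRA1; case/setIP: B1b.
case/mulsgP=> r a Rr A1a eb.
have atau : a ^ tau = a^-1.
  by have /cycleP[i ->] := subsetP sA1A a A1a; rewrite conjXg s1tau expgVn.
have G0tau : tau \in G0 by rewrite groupM.
have nRx x : x \in Gm -> x \in 'N(R) by apply: (subsetP nRGm).
have : b ^ tau * b \in R :&: B.
  have RR : b ^ tau * b \in R.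
    rewrite eb conjMg atau (_ : _ * _ = r ^ tau * r ^ a); last first.
      by rewrite [r ^ a]conjgE !mulgA.
    apply: groupM; rewrite memJ_norm // nRx //; first exact: (subsetP sG0Gm).
    by rewrite (subsetP sAGm) // (subsetP sA1A).
  have BB : b ^ tau * b \in B.
    have G0b := subsetP sBG0 b Bb.
    by rewrite -tiGG0 inE (subsetP sRG _ RR) andTb groupM ?groupJ.
  by rewrite inE RR BB.
by rewrite tiRB => /set1gP e1; apply: (mulIg b); rewrite mulVg.
Qed.

(* Transfer in [G / R], in the style of Burnside. *)
Let Bl_B1 : 'O_l(B) = B1.
Proof.
have nRG := subset_trans sGGm nRGm; have nRB := subset_trans sBG nRG.
have nRA := subset_trans sAG nRG.
pose S := ('O_l(B) / R)%G.
have sOB : 'O_l(B) \subset B by apply: pcore_sub.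
have nROB := subset_trans sOB nRB.
have tiRO : R :&: 'O_l(B) = 1 by apply/trivgP; rewrite -tiRB setIS.
have oS : #|S| = #|'O_l(B)| by rewrite -(card_isog (quotient_isog nROB tiRO)).
have sSG : S \subset G / R by apply: quotientS; apply: subset_trans sOB sBG.
have lS : l.-group S by apply: quotient_pgroup; apply: pcore_pgroup.
have cycS : cyclic S by apply: quotient_cyclic; apply: cyclicS sOB (cycle_cyclic _).
have abS := cyclic_abelian cycS.
have l'i : l^'.-nat #|G / R : S|.
  have [_ _ iA] := and3P hallA; have [_ _ iB] := and3P hallB.
  suff -> : #|G / R : S| = (#|A : 'O_l(A)| * #|B : 'O_l(B)|)%N by rewrite pnatM iA.
  have oO : #|'O_l(A)| = #|R| by rewrite Al_A1 oA1.
  have LA : #|A| = (#|R| * #|A : 'O_l(A)|)%N by rewrite -oO Lagrange ?pcore_sub.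
  have LB : #|B| = (#|'O_l(B)| * #|B : 'O_l(B)|)%N by rewrite Lagrange ?pcore_sub.
  have oG : #|G| = (#|A| * #|B|)%N by rewrite -defG (TI_cardMg tiAB).
  apply/eqP; rewrite -(eqn_pmul2l (cardG_gt0 S)) Lagrange // card_quotient //.
  rewrite -(eqn_pmul2l (cardG_gt0 R)) Lagrange // oS oG LA LB.
  by rewrite mulnACA -mulnA.
have [f [sfS fz]] := transfer_central_morphism sSG abS.
have sChO : Ch \subset 'O_l(B) by apply: subset_trans sB1l; rewrite subsetI sChK.
(* Modulo [R], the group [Ch] lies in the images of both [A1] and [B], so it commutes with both
   factors of [G]. *)
have cCh : Ch / R \subset 'C(G / R).
  rewrite -defG quotientMl // centM subsetI; apply/andP; split; last first.
    by apply: quotient_cents; apply: subset_trans Ch_B abB.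
  apply: (@subset_trans _ _ (A1 / R)).
    by rewrite -(quotientMidl _ A1) -KRA1 quotientS.
  by apply: quotient_cents; apply: subset_trans sA1A (cycle_abelian _).
(* The only subgroup of order [l] in [S] is the image of [Ch], where the transfer is a power map
   with exponent prime to [l]. *)
have kerf : S :&: 'ker f = 1.
  apply/eqP/negPn/negP => ntX.
  have lX : l.-group (S :&: 'ker f) by apply: pgroupS lS; apply: subsetIl.
  have [_ d _] := pgroup_pdiv lX ntX; have [y /setIP[Sy fy] oy] := Cauchy Ch_prime d.
  have ey : <[y]> = Ch / R.
    apply/eqP; rewrite (eq_subG_cyclic cycS) ?cycle_subG ?quotientS // -orderE oy.
    have tiCh : R :&: Ch = 1 by apply/trivgP; rewrite -tiRB setIS.
    by rewrite -(card_isog (quotient_isog _ tiCh)) // (subset_trans Ch_B).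
  have cy : y \in S :&: 'C(G / R).
    by rewrite inE Sy -cycle_subG ey.
  have := mker fy; rewrite fz // => /eqP; rewrite -order_dvdn oy.
  by move: l'i; rewrite p'natE // => /negbTE->.
have ofS : #|f @* S| = #|S|.
  by rewrite card_morphim (setIidPr sSG) -indexgI kerf indexg1.
have G1 : coset R s1 \in G / R by apply: mem_quotient.
have G2 : coset R s2 \in G / R by apply: mem_quotient.
have nR1 : s1 \in 'N(R) by apply: (subsetP nRG).
have nR2 : s2 \in 'N(R) by apply: (subsetP nRG).
(* The image of [s1 * s2] squares to 1 in an [l]-group with [l] odd. *)
have fw : f (coset R s1) * f (coset R s2) = 1.
  rewrite -morphM // -morphM //.
  have Gw : coset R (s1 * s2) \in G / R by rewrite mem_quotient ?groupM.
  set w := f _; have w2 : w ^+ 2 = 1.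
    by rewrite -morphX // -morphX ?groupM // r12 morph1 morph1.
  have lw : l.-nat #[w].
    by apply: mem_p_elt lS _; apply: (subsetP sfS); apply: mem_morphim.
  apply/eqP; rewrite -order_eq1; apply/eqP; apply: pnat_1 lw _.
  apply: (@pnat_dvd _ 2); first by rewrite order_dvdn w2.
  by rewrite p'natE ?Ch_prime // gtnNdvd.
have oAB : #|f @* (A / R)| = #|f @* (B / R)|.
  rewrite !quotient_cycle // !morphim_cycle // -!orderE.
  by rewrite -(mulgK (f (coset R s2)) (f (coset R s1))) fw mul1g orderV.
have hallfA : l.-Hall(f @* (A / R)) (f @* ('O_l(A) / R)).
  apply: morphim_pHall; last by apply: quotient_pHall => //; apply: subset_trans (pcore_sub _ _) nRA.
  by apply: quotientS; apply: subset_trans (pcore_sub _ _) sAG.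
have lfA : l.-group (f @* (A / R)).
  by apply: pgroupS lS; apply: subset_trans sfS; apply: morphimS; apply: quotientS.
have eqAB : A1 / R = B1 / R.
  by rewrite -(quotientMidl _ A1) -(quotientMidl _ B1) -KRA1 defR prodK.
have ofA : #|f @* ('O_l(A) / R)| = #|f @* (A / R)|.
  by rewrite (card_Hall hallfA) part_pnat_id.
(* [f] is injective on [S], the images of [A] and [B] have equal order, and that of [A], an
   [l]-group, is already the image of ['O_l(A) = A1]. As [A1] and [B1] agree modulo [R], the order
   of ['O_l(B)] is at most that of [B1]. *)
apply/eqP; rewrite eq_sym eqEcard; apply/andP; split; first exact: sB1l.
rewrite -oS -ofS.
apply: leq_trans (subset_leq_card (morphimS f (quotientS R sOB))) _.
rewrite -oAB -ofA Al_A1 eqAB.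
by apply: leq_trans (leq_morphim _ _) (leq_morphim _ _).
Qed.

(* Gaschuetz: [B1] has a complement in [G0]; as [s3] inverts [B1] and 2 is invertible, it may be
   chosen to contain [s3], and then [chirality_TI_complement] applies. *)
Lemma no_prime_kernel : False.
Proof.
have sB1G0 := subset_trans sB1B sBG0.
have abB1 : abelian B1 := abelianS sB1B abB.
have c2 : s2 \in 'C(B1).
  by rewrite -cycle_subG (subset_trans abB) // centS.
have nB1 : G0 \subset 'N(B1).
  rewrite -defG0 mul_subG ?cycle_subG ?(subsetP (cent_sub _) _ c2) //.
  rewrite inE; apply/subsetP=> _ /imsetP[b Bb ->].
  by rewrite inv_B1 // groupV.
have nsB1 : B1 <| G0 by rewrite /normal sB1G0.
pose Dl := 'O_l(D)%G; have sDl : Dl \subset D by apply: pcore_sub.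
have nB1D : Dl \subset 'N(B1) by apply: subset_trans nB1; apply: subset_trans sDl sDG0.
have tiDl : B1 :&: Dl = 1 by apply/trivgP; rewrite -tiBD setISS.
pose P := (B1 <*> Dl)%G.
have sPG : P \subset G0 by rewrite join_subG sB1G0 (subset_trans sDl).
have defP : B1 * Dl = P by rewrite -norm_joinEr.
(* By [Bl_B1], [B1] and [Dl] are the full [l]-parts of [B] and [D], so [P] has index prime to [l] in
   [G0]. *)
have co : coprime #|B1| #|G0 : P|.
  have [_ _ iB] := and3P hallB; have [_ _ iD] := and3P hallD.
  apply: (@pnat_coprime l); first by apply: pgroupS lK; apply: subsetIl.
  suff -> : #|G0 : P| = (#|B : 'O_l(B)| * #|D : 'O_l(D)|)%N by rewrite pnatM iB.
  have LB : #|B| = (#|B1| * #|B : 'O_l(B)|)%N by rewrite -{1}Bl_B1 Lagrange ?pcore_sub.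
  have LD : #|D| = (#|Dl| * #|D : 'O_l(D)|)%N by rewrite Lagrange ?pcore_sub.
  have oG0 : #|G0| = (#|B| * #|D|)%N by rewrite -defG0 (TI_cardMg tiBD).
  have oP : #|P| = (#|B1| * #|Dl|)%N by rewrite -defP (TI_cardMg tiDl).
  apply/eqP; rewrite -(eqn_pmul2l (cardG_gt0 P)) Lagrange // oG0 oP LB LD.
  by rewrite mulnACA.
have : [splits G0, over B1].
  rewrite (Gaschutz_split nsB1 (joing_subl _ _) sPG abB1 co).
  by apply/splitsP; exists Dl; apply/complP.
case/splitsP=> H /complP[tiH defH].
have /mulsgP[u h Bu Hh e3] : s3 \in B1 * H by rewrite defH.
(* Oddness gives a square root [v] of [u] in [B1]. As [h] inverts [B1], conjugating [h] by [v^-1]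
   yields [u * h = s3], so the complement conjugated likewise contains [s3]. *)
have odd2 : coprime #|B1| 2.
  apply: (@pnat_coprime l); first by apply: pgroupS lK; apply: subsetIl.
  by rewrite p'natE ?Ch_prime // gtnNdvd.
have [v Bv ev] : exists2 v, v \in B1 & v ^+ 2 = u.
  by exists (u ^+ (expg_invn B1 2)); rewrite ?groupX // -expgM mulnC expgM (expgK odd2).
have invh b : b \in B1 -> b ^ h = b^-1.
  move=> Bb; rewrite -inv_B1 // e3 conjgM; congr (_ ^ _).
  by apply/esym/conjg_fixP/commgP; apply: (centsP abB1).
have e3' : s3 = h ^ v^-1.
  have hv : h * v^-1 = v * h by rewrite -invh // conjgE mulKVg.
  by rewrite e3 -ev conjgE invgK hv mulgA expg2.
have B1v : B1 :^ v^-1 = B1 by rewrite conjGid ?groupV.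
have sChB1 : Ch \subset B1 by rewrite subsetI sChK Ch_B.
suff e1 : Ch :&: B1 = 1 by case/negP: ntCh; rewrite -(setIidPl sChB1) e1.
apply: (@chirality_TI_complement _ _ _ G0 B1 (H :^ v^-1)%G) => //.
- by rewrite -{1}B1v /= -conjsMg defH conjGid // groupV (subsetP sB1G0).
- by rewrite /= -{1}B1v -conjIg tiH conjs1g.
by rewrite e3' memJ_conjg.
Qed.

End PrimeKernel.

(** A subgroup of prime order in the cyclic group [N] is again normal in [G0], and it cannot contain
    [Ch] unless [N] does. *)
Theorem chirality_sub_kernel (N : {group gT}) :
  N \subset B -> N <| G0 -> N :!=: 1 -> Ch \subset N.
Proof.
move=> sNB nsN ntN; apply/negPn/negP => nCh.
have N_gt1 : 1 < #|N| by rewrite cardG_gt1.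
have [s s_pr /(Cauchy s_pr)[y Ny oy]] := pdivP N_gt1.
have sYN : <[y]> \subset N by rewrite cycle_subG.
apply: (@no_prime_kernel <[y]> s) => //.
- exact: subset_trans sYN sNB.
- apply: char_normal_trans nsN.
  by rewrite sub_cyclic_char // (cyclicS sNB) ?cycle_cyclic.
by apply: contra nCh => /subset_trans; apply.
Qed.

End Core.

(** * Chiral polytopes of rank four *)

Section FaceStabilisers.

Variables (T : finType) (le : rel T) (n : nat).
Hypothesis hP : polytope le n.
Let po := polytope_po hP.
Let fs := polytope_fs hP.
Local Notation autG := (autg_group le).
Lemma end_flag B x : flag le B -> ~~ letter n (rk le x) -> x \in B.
Proof.
move=> fB nl; have := rk_gt0 po fs x; have := rk_max po fs x; move: nl; rewrite /letter => nl r1 r0.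
have [e|ne] := eqVneq (rk le x) 1%N; first exact: (bottom_flag hP).
by apply: (top_flag hP) => //; lia.
Qed.

Variable A : {set T}.
Hypothesis fA : flag le A.

Definition rstab_set i : {set {perm T}} :=
  [set g in autG | [forall x in A, (rk le x == i) ==> (g x == x)]].

Lemma rstabP i (g : {perm T}) :
  reflect (g \in autG /\ forall x, x \in A -> rk le x = i -> g x = x) (g \in rstab_set i).
Proof.
apply: (iffP setIdP) => -[Gg h]; split=> //.
  by move=> x Ax /eqP rx; have /forall_inP/(_ x Ax)/implyP/(_ rx)/eqP := h.
by apply/forall_inP => x Ax; apply/implyP => /eqP rx; rewrite h.
Qed.

Lemma rstab_group_set i : group_set (rstab_set i).
Proof.
apply/group_setP; split=> [|g h /rstabP[Gg fg] /rstabP[Gh fh]]; apply/rstabP.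
  by rewrite group1; split=> // x _ _; rewrite perm1.
by split=> [|x Ax rx]; rewrite ?groupM // permM fg ?fh.
Qed.
Canonical rstab i := Group (rstab_group_set i).

Lemma rstab_sub i : rstab i \subset autG.
Proof. by apply/subsetP => g /rstabP[]. Qed.

Lemma run_rstab i g w : g \in autG -> g @: A = run le A w -> i \notin w -> g \in rstab i.
Proof.
move=> Gg eg iw; apply/rstabP; split=> // x Ax rx.
apply: (aut_face hP _ fA Ax) => //; first exact/autgP.
by rewrite eg; apply: run_keep => //; rewrite rx.
Qed.

Lemma rstab_imset i g x : g \in autG -> x \in A -> rk le x = i -> (g x == x) = (g \in rstab i).
Proof.
move=> Gg Ax rx; apply/eqP/rstabP => [gx|[_]]; last exact.
split=> // y Ay ry; suff -> : y = x by [].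
by apply: (flag_inj po fs fA); rewrite // ry.
Qed.

Lemma aut_fix_end g x : g \in autG -> x \in A -> ~~ letter n (rk le x) -> g x = x.
Proof.
move=> /autgP ag Ax nl; apply: (aut_face hP ag fA Ax) => //.
by apply: end_flag => //; apply: (aut_flag hP).
Qed.

Hypothesis hC : chiral le.

Lemma rstab_gen (H : {group {perm T}}) (I : pred nat) c g :
  letter n c -> H \subset autG ->
  (forall i, I i -> letter n i -> exists2 g, g \in H & g @: A = run le A [:: i; c]) ->
  g \in autG -> (forall i, letter n i -> ~~ I i -> g \in rstab i) -> g \in H.
Proof.
move=> lc sH gens Gg fix_g; apply: (stab_gen hP hC fA lc sH gens Gg) => x Ax nI.
have [li|nl] := boolP (letter n (rk le x)); last exact: aut_fix_end.
by have /rstabP[_] := fix_g _ li nI; apply.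
Qed.

End FaceStabilisers.

Section Rank4.

Variables (T : finType) (le : rel T).
Hypotheses (hP : polytope le 4) (hC : chiral le).
Local Notation autG := (autg_group le).
Variables (F : {set T}) (s1 s2 s3 : {perm T}).
Hypothesis fF : flag le F.
Hypotheses (G1 : s1 \in autG) (G2 : s2 \in autG) (G3 : s3 \in autG).
Hypotheses (e1 : s1 @: F = run le F [:: 3; 2]) (e2 : s2 @: F = run le F [:: 4; 3])
  (e3 : s3 @: F = run le F [:: 5; 4]).
Local Notation stab i := (rstab le F i).

Lemma letter4P i : letter 4 i -> [\/ i = 2, i = 3, i = 4 | i = 5].
Proof.
by case: i => [|[|[|[|[|[|i]]]]]] // _; [apply: Or41|apply: Or42|apply: Or43|apply: Or44].
Qed.

Lemma run_s12 : (s1 * s2) @: F = run le F [:: 4; 2].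
Proof. by rewrite (run_mul hP G1 G2 fF _ _ e1 e2) //= (swapK hP) ?flag_swap. Qed.

Lemma run_s23 : (s2 * s3) @: F = run le F [:: 5; 3].
Proof. by rewrite (run_mul hP G2 G3 fF _ _ e2 e3) //= (swapK hP) ?flag_swap. Qed.

Lemma run_s123 : (s1 * s2 * s3) @: F = run le F [:: 5; 2].
Proof.
by rewrite (run_mul hP (groupM G1 G2) G3 fF _ _ run_s12 e3) //= (swapK hP) ?flag_swap.
Qed.

Lemma far_involution g i j : letter 4 i -> letter 4 j -> i.+1 < j ->
  g \in autG -> g @: F = run le F [:: j; i] -> g ^+ 2 = 1.
Proof.
move=> li lj ij Gg eg; apply: (autG_inj hP _ _ fF); rewrite ?groupX ?group1 //.
rewrite expg2 (run_mul hP Gg Gg fF _ _ eg eg) /= ?li ?lj // aut_imset1.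
by rewrite (swapC hP) ?flag_swap // (swapK hP) ?flag_swap // (swapK hP).
Qed.

Lemma rel12 : (s1 * s2) ^+ 2 = 1.
Proof. by apply: (@far_involution _ 2 4) run_s12; rewrite ?groupM. Qed.

Lemma rel23 : (s2 * s3) ^+ 2 = 1.
Proof. by apply: (@far_involution _ 3 5) run_s23; rewrite ?groupM. Qed.

Lemma rel123 : (s1 * s2 * s3) ^+ 2 = 1.
Proof. by apply: (@far_involution _ 2 5) run_s123; rewrite ?groupM. Qed.

Lemma s1_stab : (s1 \in stab 4) && (s1 \in stab 5).
Proof. by rewrite !(run_rstab hP fF G1 e1). Qed.

Lemma s2_stab : (s2 \in stab 2) && (s2 \in stab 5).
Proof. by rewrite !(run_rstab hP fF G2 e2). Qed.

Lemma s3_stab : (s3 \in stab 2) && (s3 \in stab 3).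
Proof. by rewrite !(run_rstab hP fF G3 e3). Qed.

Lemma s12_stab : s1 * s2 \in stab 3.
Proof. by rewrite (run_rstab hP fF (groupM G1 G2) run_s12). Qed.

Lemma s23_stab : s2 * s3 \in stab 4.
Proof. by rewrite (run_rstab hP fF (groupM G2 G3) run_s23). Qed.

Let gen1 (H : {group {perm T}}) i :
  exists2 g, g \in H & g @: F = run le F [:: i; i].
Proof. by exists 1; rewrite ?group1 // aut_imset1 /= (swapK hP). Qed.

Let genV (H : {group {perm T}}) g i j : letter 4 i -> letter 4 j -> g \in H -> g \in autG ->
  g @: F = run le F [:: j; i] -> exists2 g, g \in H & g @: F = run le F [:: i; j].
Proof.
move=> li lj Hg Gg eg; exists g^-1; rewrite ?groupV //.
by rewrite (run_inv hP Gg fF _ eg) //= li lj.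
Qed.

Lemma stab25 : stab 2 :&: stab 5 = <[s2]>.
Proof.
apply/eqP; rewrite eqEsubset; apply/andP; split; last by rewrite subsetI !cycle_subG; have /andP[-> ->] := s2_stab.
apply/subsetP => g /setIP[g2 g5]; have Gg := subsetP (rstab_sub _ _ _) _ g2.
apply: (@rstab_gen _ _ _ hP _ fF hC <[s2]> (mem [:: 3; 4]) 3 g) => //.
- by rewrite cycle_subG.
- by move=> i; rewrite !inE => /orP[]/eqP-> _; [apply: gen1 | exists s2; rewrite ?cycle_id].
by move=> i /letter4P[]->.
Qed.

Lemma stab23 : stab 2 :&: stab 3 = <[s3]>.
Proof.
apply/eqP; rewrite eqEsubset; apply/andP; split; last by rewrite subsetI !cycle_subG; have /andP[-> ->] := s3_stab.
apply/subsetP => g /setIP[g2 g5]; have Gg := subsetP (rstab_sub _ _ _) _ g2.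
apply: (@rstab_gen _ _ _ hP _ fF hC <[s3]> (mem [:: 4; 5]) 4 g) => //.
- by rewrite cycle_subG.
- by move=> i; rewrite !inE => /orP[]/eqP-> _; [apply: gen1 | exists s3; rewrite ?cycle_id].
by move=> i /letter4P[]->.
Qed.

Lemma stab45 : stab 4 :&: stab 5 = <[s1]>.
Proof.
apply/eqP; rewrite eqEsubset; apply/andP; split; last by rewrite subsetI !cycle_subG; have /andP[-> ->] := s1_stab.
apply/subsetP => g /setIP[g2 g5]; have Gg := subsetP (rstab_sub _ _ _) _ g2.
apply: (@rstab_gen _ _ _ hP _ fF hC <[s1]> (mem [:: 2; 3]) 2 g) => //.
- by rewrite cycle_subG.
- by move=> i; rewrite !inE => /orP[]/eqP-> _; [apply: gen1 | exists s1; rewrite ?cycle_id].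
by move=> i /letter4P[]->.
Qed.

Lemma stab_triple j g : letter 4 j -> g \in autG ->
  (forall i, letter 4 i -> i != j -> g \in stab i) -> g = 1.
Proof.
move=> lj Gg fix_g; apply/set1gP.
apply: (@rstab_gen _ _ _ hP _ fF hC 1%G (pred1 j) j g) => //; first exact: sub1G.
by move=> i /eqP-> _; apply: (gen1 1%G).
Qed.

Lemma involution_cycle (t g : {perm T}) : t ^+ 2 = 1 -> g \in <[t]> -> g = 1 \/ g = t.
Proof.
move=> t2 /cycleP[k ->]; rewrite (divn_eq k 2) expgD mulnC expgM t2 expg1n mul1g.
by rewrite modn2; case: odd; [right; rewrite expg1 | left].
Qed.

(* Both [t] and [t * x] are involutions, so [t] inverts [x]. *)
Lemma dihedral_conj (t x : {perm T}) : t ^+ 2 = 1 -> (t * x) ^+ 2 = 1 -> x ^ t = x^-1.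
Proof.
move=> t2 tx2; have tV : t^-1 = t by apply: (mulgI t); rewrite mulgV -expg2.
by apply: (mulIg x); rewrite mulVg conjgE tV -tx2 expg2 !mulgA.
Qed.

Lemma s12_inverts_s3 : s3 ^ (s1 * s2) = s3^-1.
Proof. by apply: dihedral_conj; [apply: rel12 | apply: rel123]. Qed.

Lemma s23_inverts_s1 : s1 ^ (s2 * s3) = s1^-1.
Proof.
apply: dihedral_conj; first exact: rel23.
have := congr1 (conjg^~ s1) rel123; rewrite conj1g conjXg => <-; congr (_ ^+ 2).
by rewrite conjgE !mulgA mulVg mul1g.
Qed.

(** The involution [s1 * s2] inverts [s3], so the group they generate consists of two cosets of
    [<[s3]>]. *)
Lemma stab3 g : g \in stab 3 -> exists2 d, d \in <[s3]> & g = d \/ g = s1 * s2 * d.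
Proof.
move=> g3; have Gg := subsetP (rstab_sub _ _ _) _ g3.
have : g \in <[s1 * s2]> <*> <[s3]>.
  apply: (@rstab_gen _ _ _ hP _ fF hC (<[s1 * s2]> <*> <[s3]>)%G (mem [:: 2; 4; 5]) 4 g) => //.
  - by rewrite join_subG !cycle_subG ?G1 ?G3 groupM.
  - move=> i; rewrite !inE => /or3P[]/eqP-> _; last 1 first.
    + by exists s3 => //; rewrite mem_gen // inE cycle_id orbT.
    + apply: genV run_s12 => //; last exact: groupM.
      by rewrite mem_gen // inE cycle_id.
    exact: gen1.
  by move=> i /letter4P[]->.
rewrite norm_joinEl; last first.
  by rewrite cycle_subG inE -cycleJ s12_inverts_s3 cycleV.
case/mulsgP=> t d /(involution_cycle rel12)[]-> Dd ->; exists d => //; last by right.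
by left; rewrite mul1g.
Qed.

Lemma stab4 g : g \in stab 4 -> exists2 a, a \in <[s1]> & g = a \/ g = a * (s2 * s3).
Proof.
move=> g4; have Gg := subsetP (rstab_sub _ _ _) _ g4.
have : g \in <[s1]> <*> <[s2 * s3]>.
  apply: (@rstab_gen _ _ _ hP _ fF hC (<[s1]> <*> <[s2 * s3]>)%G (mem [:: 2; 3; 5]) 3 g) => //.
  - by rewrite join_subG !cycle_subG ?G1 ?G3 groupM.
  - move=> i; rewrite !inE => /or3P[]/eqP-> _; last 1 first.
    + by exists (s2 * s3); [rewrite mem_gen // inE cycle_id orbT | apply: run_s23].
    + apply: genV e1 => //; by rewrite mem_gen // inE cycle_id.
    exact: gen1.
  by move=> i /letter4P[]->.
rewrite norm_joinEr; last first.
  by rewrite cycle_subG inE -cycleJ s23_inverts_s1 cycleV.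
case/mulsgP=> a t Aa /(involution_cycle rel23)[]-> ->; exists a => //; last by right.
by left; rewrite mulg1.
Qed.

Lemma cycle12_ti : <[s1]> :&: <[s2]> = 1.
Proof.
rewrite -stab45 -stab25; apply/trivgP/subsetP => g /setIP[/setIP[g4 g5] /setIP[g2 _]].
rewrite inE; apply/eqP; apply: (@stab_triple 3) => //; first exact: subsetP (rstab_sub _ _ _) _ g4.
by move=> i /letter4P[]->.
Qed.

Lemma cycle23_ti : <[s2]> :&: <[s3]> = 1.
Proof.
rewrite -stab25 -stab23; apply/trivgP/subsetP => g /setIP[/setIP[g2 g5] /setIP[_ g3]].
rewrite inE; apply/eqP; apply: (@stab_triple 4) => //; first exact: subsetP (rstab_sub _ _ _) _ g2.
by move=> i /letter4P[]->.
Qed.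

Lemma cycle1_stab2_ti : <[s1]> :&: stab 2 = 1.
Proof.
rewrite -stab45; apply/trivgP/subsetP => g /setIP[/setIP[g4 g5] g2].
rewrite inE; apply/eqP; apply: (@stab_triple 3) => //; first exact: subsetP (rstab_sub _ _ _) _ g4.
by move=> i /letter4P[]->.
Qed.

Lemma stab5_cycle3_ti : stab 5 :&: <[s3]> = 1.
Proof.
rewrite -stab23; apply/trivgP/subsetP => g /setIP[g5 /setIP[g2 g3]].
rewrite inE; apply/eqP; apply: (@stab_triple 4) => //; first exact: subsetP (rstab_sub _ _ _) _ g2.
by move=> i /letter4P[]->.
Qed.

Hypothesis oG : #|autG| = (#[s1] * #[s2] * #[s3])%N.

Lemma sub_stab2 : <[s2]> * <[s3]> \subset stab 2.
Proof. by rewrite mul_subG // cycle_subG; [have /andP[] := s2_stab | have /andP[] := s3_stab]. Qed.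

Lemma sub_stab5 : <[s1]> * <[s2]> \subset stab 5.
Proof. by rewrite mul_subG // cycle_subG; [have /andP[] := s1_stab | have /andP[] := s2_stab]. Qed.

(** Tightness bounds the stabiliser from above: it meets [<[s1]>] trivially, so their product must
    fit into a group of order [oG]. *)
Lemma card_stab2 : #|stab 2| = (#[s2] * #[s3])%N.
Proof.
apply/eqP; rewrite eqn_leq; apply/andP; split; last first.
  by rewrite -(TI_cardMg cycle23_ti) subset_leq_card ?sub_stab2.
rewrite -(leq_pmul2l (order_gt0 s1)) mulnA -oG -(TI_cardMg cycle1_stab2_ti) subset_leq_card //.
by rewrite mul_subG ?rstab_sub // cycle_subG.
Qed.

Lemma stab2E : <[s2]> * <[s3]> = stab 2.
Proof. by apply/eqP; rewrite eqEcard sub_stab2 /= card_stab2 (TI_cardMg cycle23_ti) leqnn. Qed.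

Lemma autg_cycle1_stab2 : <[s1]> * stab 2 = autG.
Proof.
apply/eqP; rewrite eqEcard mul_subG ?rstab_sub ?cycle_subG //=.
by rewrite (TI_cardMg cycle1_stab2_ti) card_stab2 mulnA oG.
Qed.

Lemma stab5E : <[s1]> * <[s2]> = stab 5.
Proof.
apply/eqP; rewrite eqEcard sub_stab5 (TI_cardMg cycle12_ti) /=.
have h : (#|stab 5| * #|stab 2| <= #|autG| * #[s2])%N.
  rewrite (mul_cardG (stab 5) (stab 2)) setIC stab25 leq_mul2r.
  by rewrite subset_leq_card ?orbT // mul_subG ?rstab_sub.
rewrite -(leq_pmul2r (order_gt0 s2)) -(leq_pmul2r (order_gt0 s3)).
by rewrite -mulnA -card_stab2 (leq_trans h) // oG mulnAC.
Qed.

Section Normalise.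

Variable K : {group {perm T}}.
Hypotheses (nK : K <| autG) (KA : <[s1]> :&: K * stab 2 \subset K)
  (KD : <[s3]> :&: K * stab 5 \subset K).
Hypotheses (K1 : s1 \notin K) (K2 : s2 \notin K) (K3 : s3 \notin K).

(** The preferences for 1 and for [s] cannot conflict, because [s] is outside [K]. By [stab3] and
    [stab4], these are the values that detect membership in the stabilisers of the base edge and the
    base 2-face. *)
Lemma class_rep (s x : {perm T}) : s \notin K -> x \in <[s]> ->
  exists2 y, y \in <[s]> & [/\ x * y^-1 \in K, x \in K -> y = 1 & x * s^-1 \in K -> y = s].
Proof.
move=> Ks sx; have [Kx|nKx] := boolP (x \in K).
  exists 1; rewrite ?group1 // invg1 mulg1; split=> // Kxs.
  by case/negP: Ks; rewrite -groupV -(groupMl _ Kx).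
have [Kxs|nKxs] := boolP (x * s^-1 \in K); first by exists s; rewrite ?cycle_id.
by exists x; rewrite ?mulgV ?group1.
Qed.

(* Representatives modulo [K] of the three factors, chosen to be 1 or [s] whenever possible,
   bring every coset to a form lying in all the face stabilisers it meets. *)
Lemma normal_form g : g \in autG -> exists2 y, y \in autG &
  g * y^-1 \in K /\ forall i, letter 4 i -> g \in K * stab i -> y \in stab i.
Proof.
have sK : K \subset autG by case/andP: nK.
have nKG x : x \in autG -> x \in 'N(K) by case/andP: nK => _ /subsetP; apply.
have sA : <[s1]> \subset autG by rewrite cycle_subG.
have sB : <[s2]> \subset autG by rewrite cycle_subG.
have sD : <[s3]> \subset autG by rewrite cycle_subG.
have conjK x k : x \in autG -> k \in K -> x * k * x^-1 \in K.
  by move=> Gx Kk; rewrite -{1}(invgK x) -mulgA -conjgE memJ_norm ?groupV ?nKG.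
(* The three factors are determined modulo [K]: [KD] and [KA] settle the outer ones, and the middle
   one follows. *)
have uniq k a b d a' b' d' : k \in K -> a \in <[s1]> -> b \in <[s2]> -> d \in <[s3]> ->
    a' \in <[s1]> -> b' \in <[s2]> -> d' \in <[s3]> -> a * b * d = k * (a' * b' * d') ->
    [/\ a * a'^-1 \in K, b * b'^-1 \in K & d * d'^-1 \in K].
  move=> Kk Aa Bb Dd Aa' Bb' Dd' e.
  have [[Ga Gb] Gd] := (subsetP sA _ Aa, subsetP sB _ Bb, subsetP sD _ Dd).
  have [[Ga' Gb'] Gd'] := (subsetP sA _ Aa', subsetP sB _ Bb', subsetP sD _ Dd').
  have h2 x y : x \in <[s2]> -> y \in <[s3]> -> x * y \in stab 2.
    by move=> Bx Dy; rewrite -stab2E mem_mulg.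
  have h5 x y : x \in <[s1]> -> y \in <[s2]> -> x * y \in stab 5.
    by move=> Bx Dy; rewrite -stab5E mem_mulg.
  have Kd : d * d'^-1 \in K.
    apply: (subsetP KD); rewrite inE groupM ?groupV //=.
    have -> : d * d'^-1 = ((a * b)^-1 * k * (a * b)) * ((a * b)^-1 * (a' * b')).
      apply: (mulgI (a * b)); apply: (mulIg d'); rewrite !mulgA.
      rewrite -[_ * d * _ * _]mulgA mulVg mulg1 e invMg !mulgA.
      by rewrite !(mulgK, mulgKV, mulVg, mulgV, mul1g).
    rewrite mem_mulg //; last by rewrite groupM ?groupV ?h5.
    by rewrite -mulgA -conjgE memJ_norm ?nKG ?groupM.
  have Ka : a * a'^-1 \in K.
    have : a'^-1 * a \in K.
      apply: (subsetP KA); rewrite inE groupM ?groupV //=.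
      have -> : a'^-1 * a = (a'^-1 * k * a') * ((b' * d') * (b * d)^-1).
        apply: (mulgI a'); apply: (mulIg (b * d)).
        rewrite invMg !mulgA !(mulgK, mulgKV, mulVg, mulgV, mul1g).
        by rewrite e !mulgA.
      rewrite mem_mulg //; last by rewrite groupM ?groupV ?h2.
      by rewrite -mulgA -conjgE memJ_norm ?nKG.
    by move/(conjK a' _ Ga'); rewrite !mulgA mulgV mul1g.
  split=> //.
  have -> : b * b'^-1 = (a^-1 * (k * (a * a'^-1)^-1) * a) * (b' * (d * d'^-1)^-1 * b'^-1).
    have eb : b = a^-1 * k * a' * b' * d' * d^-1.
      by apply: (mulgI a); apply: (mulIg d); rewrite e !mulgA mulgKV mulgV mul1g.
    rewrite eb !invMg !invgK !mulgA.
    by rewrite !(mulgK, mulgKV, mulVg, mulgV, mul1g, mulKg, mulKVg).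
  rewrite groupM //; last by apply: conjK => //; rewrite groupV.
  by rewrite -mulgA -conjgE memJ_norm ?nKG // groupM ?groupV.
rewrite -{1}autg_cycle1_stab2 => /mulsgP[a c Aa]; rewrite -{1}stab2E => /mulsgP[b d Bb Dd -> ->].
rewrite mulgA.
have [a0 Aa0 [Ka a1 aS]] := class_rep K1 Aa.
have [b0 Bb0 [Kb b1 bS]] := class_rep K2 Bb.
have [d0 Dd0 [Kd d1 dS]] := class_rep K3 Dd.
have [[Ga Gb] Gd] := (subsetP sA _ Aa, subsetP sB _ Bb, subsetP sD _ Dd).
have [[Ga0 Gb0] Gd0] := (subsetP sA _ Aa0, subsetP sB _ Bb0, subsetP sD _ Dd0).
exists (a0 * b0 * d0); first by rewrite !groupM.
split.
  have -> : a * b * d * (a0 * b0 * d0)^-1 =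
     (a * b) * (d * d0^-1) * (a * b)^-1 * (a * (b * b0^-1) * a^-1) * (a * a0^-1).
    by rewrite !invMg !mulgA !(mulgK, mulgKV, mulVg, mulgV, mul1g, mulKg, mulKVg).
  have Gab : a * b \in autG by apply: groupM.
  exact: groupM (groupM (conjK _ _ Gab Kd) (conjK _ _ Ga Kb)) Ka.
move=> i /letter4P[]->; case/mulsgP=> k x Kk.
- rewrite -{1}stab2E => /mulsgP[b' d' Bb' Dd' ->] e.
  have [|Ka' _ _] := uniq k a b d 1 b' d' Kk Aa Bb Dd (group1 _) Bb' Dd'; first by rewrite mul1g.
  rewrite a1; last by rewrite -(mulg1 a) -invg1.
  by rewrite mul1g -stab2E mem_mulg.
- case/stab3=> d' Dd' [->|->] e.
    have [|Ka' Kb' _] := uniq k a b d 1 1 d' Kk Aa Bb Dd (group1 _) (group1 _) Dd'; first by rewrite !mul1g.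
    rewrite !invg1 !mulg1 in Ka' Kb'; rewrite (a1 Ka') (b1 Kb') !mul1g.
    by have : d0 \in stab 2 :&: stab 3 by [rewrite stab23]; case/setIP.
  have [//|Ka' Kb' _] := uniq k a b d s1 s2 d' Kk Aa Bb Dd (cycle_id _) (cycle_id _) Dd'.
  rewrite aS // bS // groupM ?s12_stab //.
  by have : d0 \in stab 2 :&: stab 3 by [rewrite stab23]; case/setIP.
- case/stab4=> a' Aa' [->|->] e.
    have [|_ Kb' Kd'] := uniq k a b d a' 1 1 Kk Aa Bb Dd Aa' (group1 _) (group1 _); first by rewrite !mulg1.
    rewrite !invg1 !mulg1 in Kb' Kd'; rewrite (b1 Kb') (d1 Kd') !mulg1.
    by have : a0 \in stab 4 :&: stab 5 by [rewrite stab45]; case/setIP.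
  have [|_ Kb' Kd'] := uniq k a b d a' s2 s3 Kk Aa Bb Dd Aa' (cycle_id _) (cycle_id _); first by rewrite e !mulgA.
  rewrite bS // dS // -mulgA groupM ?s23_stab //.
  by have : a0 \in stab 4 :&: stab 5 by [rewrite stab45]; case/setIP.
rewrite -{1}stab5E => /mulsgP[a' b' Aa' Bb' ->] e.
have [|_ _ Kd'] := uniq k a b d a' b' 1 Kk Aa Bb Dd Aa' Bb' (group1 _); first by rewrite mulg1.
rewrite d1; last by rewrite -(mulg1 d) -invg1.
by rewrite mulg1 -stab5E mem_mulg.
Qed.

End Normalise.

End Rank4.

(** * Atomicity and quotients *)

Lemma card_mulg_leq (gT : finGroupType) (X Y : {set gT}) : #|X * Y| <= #|X| * #|Y|.
Proof. by rewrite -cardsX [X * Y]curry_imset2X leq_imset_card. Qed.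

Section RegularQuotient.

Variables (T : finType) (le : rel T).
Hypotheses (hP : polytope le 4) (hC : chiral le).
Let po := polytope_po hP.
Let fs := polytope_fs hP.
Local Notation autG := (autg_group le).
Variables (F : {set T}) (s1 s2 s3 : {perm T}).
Hypothesis fF : flag le F.
Hypotheses (G1 : s1 \in autG) (G2 : s2 \in autG) (G3 : s3 \in autG).
Hypotheses (e1 : s1 @: F = run le F [:: 3; 2]) (e2 : s2 @: F = run le F [:: 4; 3])
  (e3 : s3 @: F = run le F [:: 5; 4]).
Hypothesis oG : #|autG| = (#[s1] * #[s2] * #[s3])%N.
Local Notation stab i := (rstab le F i).

Variable K : {group {perm T}}.
Hypotheses (nK : K <| autG) (KA : <[s1]> :&: K * stab 2 \subset K)
  (KD : <[s3]> :&: K * stab 5 \subset K).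
Hypotheses (K1 : s1 \notin K) (K2 : s2 \notin K) (K3 : s3 \notin K).

Let sK : K \subset autG. Proof. by case/andP: nK. Qed.
Let nKG x : x \in autG -> x \in 'N(K). Proof. by case/andP: nK => _ /subsetP; apply. Qed.

(** Let [y] be the normal form of [g * h^-1]. Wherever faces match modulo [K], this product lies in
    [K] times a face stabiliser, so [y] fixes the base face, and [g^-1 * y * h] carries [g x] to
    [h x]. *)
Lemma stab_align g h (S : pred nat) : g \in autG -> h \in autG ->
  (forall x, x \in F -> S (rk le x) -> exists2 k, k \in K & k (g x) = h x) ->
  exists2 k, k \in K & forall x, x \in F -> S (rk le x) -> k (g x) = h x.
Proof.
move=> Gg Gh H; have Gu : g * h^-1 \in autG by rewrite groupM ?groupV.
have [y Gy [Ky hy]] := normal_form hP hC fF G1 G2 G3 e1 e2 e3 oG nK KA KD K1 K2 K3 Gu.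
exists (g^-1 * y * h).
  rewrite -groupV -(memJ_norm _ (nKG (groupVr Gg))) conjgE invgK !invMg invgK.
  by rewrite !mulgA mulgK.
move=> x Fx Sx; rewrite -permM !mulgA mulgV mul1g permM; congr (h _).
have [li|nl] := boolP (letter 4 (rk le x)); last exact: (aut_fix_end hP fF).
suff /hy/rstabP[//|_] : g * h^-1 \in K * stab (rk le x) by apply.
have [k Kk ek] := H x Fx Sx.
have -> : g * h^-1 = (g * k^-1 * g^-1) * (g * k * h^-1).
  by rewrite !mulgA !mulgKV.
apply: mem_mulg.
  by rewrite -{1}(invgK g) -mulgA -conjgE memJ_norm ?groupV // nKG ?groupV.
have Gk : k \in autG := subsetP sK _ Kk.
have Gj : g * k * h^-1 \in autG by rewrite !groupM ?groupV.
by rewrite -(rstab_imset hP fF Gj Fx erefl) !permM ek permK.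
Qed.

Lemma base_image A j : flag le A -> letter 4 j ->
  exists2 g, g \in autG & forall x, x \in F -> rk le x <> j -> g x \in A.
Proof.
move=> fA lj; have [[g Gg eg]|[g Gg eg]] := flag_orbit2 hP hC fF fA lj; exists g => // x Fx nx.
  by rewrite -eg imset_f.
have ag := elimT (autgP _ _) Gg.
apply: (@swap_agree' _ _ _ hP j A fA); first by rewrite -eg imset_f.
by rewrite (aut_rk hP).
Qed.

Lemma align_off j A B (S : pred nat) : letter 4 j -> ~~ S j -> flag le A -> flag le B ->
  (forall x y, x \in A -> y \in B -> rk le x = rk le y -> S (rk le x) ->
     exists2 k, k \in K & k x = y) ->
  exists2 k, k \in K &
    forall x y, x \in A -> y \in B -> rk le x = rk le y -> S (rk le x) -> k x = y.
Proof.
move=> lj Sj fA fB H.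
have [g Gg hg] := base_image fA lj; have [h Gh hh] := base_image fB lj.
have [ag ah] := (elimT (autgP _ _) Gg, elimT (autgP _ _) Gh).
have nj x : S (rk le x) -> rk le x <> j by move=> Sx e; case/negP: Sj; rewrite -e.
have [x Fx Sx|k Kk hk] := @stab_align g h S Gg Gh.
  by apply: H; rewrite ?hg ?hh ?(aut_rk hP _ ag) ?(aut_rk hP _ ah) //; apply: nj.
exists k => // x y Ax By rxy Sx.
have [z Fz rz] := flag_rk hP x fF; have nz : rk le z <> j by rewrite rz; apply: nj.
have -> : x = g z by apply: (flag_inj po fs fA); rewrite ?hg ?(aut_rk hP _ ag).
have -> : y = h z by apply: (flag_inj po fs fB); rewrite ?hh ?(aut_rk hP _ ah) // rz.
by apply: hk; rewrite // rz.
Qed.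

(** Otherwise [s1] would agree modulo [K] with an element of the vertex stabiliser, and [KA] would
    put it into [K]. *)
Lemma base_swap2 h y y' l : h \in autG -> l \in K -> y \in h @: F ->
  y' \in swap le 2 (h @: F) -> rk le y = 2 -> rk le y' = 2 -> l y' <> y.
Proof.
move=> Gh Kl /imsetP[z Fz ->]; have ah := elimT (autgP _ _) Gh.
have <- : h @: run le F [:: 2] = swap le 2 (h @: F) by rewrite (autG_run hP Gh).
case/imsetP=> z' Sz' ->; rewrite !(aut_rk hP) // => rz rz' e.
have G1V : s1^-1 \in autG by rewrite groupV.
have ez' : s1^-1 z = z'.
  apply: (aut_face hP _ fF Fz); rewrite ?rz //; first exact/autgP.
  rewrite (run_inv hP G1 fF _ e1) //; apply: (swap_agree (flag_swap 2 fF)) => //.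
  by rewrite rz'.
have Gl : l \in autG := subsetP sK _ Kl.
have : s1^-1 * (h * l * h^-1) \in stab 2.
  rewrite -(rstab_imset hP fF _ Fz rz); first by rewrite !permM ez' e permK.
  by rewrite !groupM ?groupV.
have Kh : h * l * h^-1 \in K.
  by rewrite -{1}(invgK h) -mulgA -conjgE memJ_norm ?groupV // nKG ?groupV.
move=> st; case/negP: K1; apply: (subsetP KA); rewrite inE cycle_id /=.
have -> : s1 = (h * l * h^-1) * (s1^-1 * (h * l * h^-1))^-1 by rewrite invMg invgK mulKVg.
by rewrite mem_mulg ?groupV.
Qed.

(** A letter omitted from [S] absorbs a parity mismatch between the flags. If none is omitted, ranks
    3 to 5 are aligned first; the vertices then agree or are exchanged, and [base_swap2] excludes an
    exchange. *)
Lemma quo_align A B (S : pred nat) : flag le A -> flag le B ->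
  (forall x y, x \in A -> y \in B -> rk le x = rk le y -> S (rk le x) ->
     exists2 k, k \in K & k x = y) ->
  exists2 k, k \in K &
    forall x y, x \in A -> y \in B -> rk le x = rk le y -> S (rk le x) -> k x = y.
Proof.
move=> fA fB H; have [S2|nS2] := boolP (S 2); last exact: (@align_off 2) H.
have [S3|nS3] := boolP (S 3); last exact: (@align_off 3) H.
have [S4|nS4] := boolP (S 4); last exact: (@align_off 4) H.
have [S5|nS5] := boolP (S 5); last exact: (@align_off 5) H.
pose S' i := letter 4 i && (i != 2).
have [//|//||k Kk hk] := @align_off 2 A B S' _ _ fA fB.
  move=> x y Ax By rxy /andP[/letter4P[] rx _]; apply: H => //; by rewrite rx.
have Gk : k \in autG := subsetP sK _ Kk; have ak := elimT (autgP _ _) Gk.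
have fkA := aut_flag hP ak fA.
have ag : agree le 2 B (k @: A).
  move=> y By ry; have [x Ax rx] := flag_rk hP y fA.
  have [ly|ny] := boolP (letter 4 (rk le y)).
    rewrite -(hk x y Ax By rx) ?imset_f // /S' rx ly /=; exact/eqP.
  exact: (end_flag hP fkA ny).
have [e|ne] := eqVneq (k @: A) B.
  exists k => // x y Ax By rxy _; apply: (aut_face hP ak fA) => //.
  by rewrite e.
have eS : k @: A = swap le 2 B by apply: (swap_unique hP) => //; apply/eqP.
have [x Ax rx] := @letter_face _ _ _ hP 2 A fA isT.
have [y By ry] := @letter_face _ _ _ hP 2 B fB isT.
have [l Kl el] : exists2 l, l \in K & l x = y by apply: H; rewrite // rx.
have rkx : rk le (k x) = 2 by rewrite (aut_rk hP).
have Skx : k x \in swap le 2 B by rewrite -eS imset_f.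
have Kj : k^-1 * l \in K by rewrite groupM ?groupV.
have ej : (k^-1 * l) (k x) = y by rewrite permM permK.
have [[h Gh eh]|[h Gh eh]] := @flag_orbit2 _ _ _ hP hC F B 2 fF fB isT.
  by case: (@base_swap2 h y (k x) _ Gh Kj); rewrite ?eh.
case: (@base_swap2 h (k x) y (k^-1 * l)^-1 Gh); rewrite ?groupV ?eh ?(swapK hP) //.
by rewrite -ej permK.
Qed.

Lemma quo_noswap k A i : k \in K -> flag le A -> letter 4 i -> k @: A <> swap le i A.
Proof. by move/(subsetP sK); apply: (no_swap hP hC). Qed.

Local Notation q := (quo K).
Local Notation qle := (quo_le le (K := K)).
Let hQ := quo_polytope hP sK quo_align quo_noswap.
Let cov := quo_covering hP sK quo_align quo_noswap.
Let qm : flag_map le qle 4 q := covering_flag_map hP hQ cov.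
Let fq A : flag le A -> flag qle (q @: A). Proof. by case: qm => _ + _; apply. Qed.

Let lift g : g \in autG -> exists2 g', g' \in autg_group qle & forall x, g' (q x) = q (g x).
Proof.
move=> Gg; have [g' ag' hg'] := quo_aut sK Gg (nKG Gg); exists g' => //.
exact/autgP.
Qed.

Let lift_imset (g : {perm T}) (g' : {perm {x : T | qrep K x == x}}) (A : {set T}) : (forall x, g' (q x) = q (g x)) -> g' @: (q @: A) = q @: (g @: A).
Proof. by move=> h; rewrite -!imset_comp; apply: eq_imset => x /=; rewrite h. Qed.

Let orb_quo A B : same_orbit le A B -> same_orbit qle (q @: A) (q @: B).
Proof.
case/same_orbitP=> g Gg <-; have [g' Gg' hg'] := lift Gg.
by apply/same_orbitP; exists g' => //; apply: lift_imset.
Qed.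

Section Mirror.

Variable r : {perm {x : T | qrep K x == x}}.
Hypotheses (Gr : r \in autg_group qle) (er : r @: (q @: F) = q @: swap le 4 F).

(** [s' * r] and [r * t'] have the same effect on the base flag of the quotient. Phrasing this
    through faces [x] and [y] upstairs makes it multiplicative along [mirror_pairs]. *)
Lemma mirror_gen s w : s \in autG -> all (letter 4) w -> s @: F = run le F w ->
  s^-1 @: swap le 4 F = run le (swap le 4 F) w ->
  forall x y, r (q x) = q y -> r (q (s x)) = q (s^-1 y).
Proof.
move=> Gs lw es esV x y exy; have GsV := groupVr Gs.
have [s' Gs' hs] := lift Gs; have [t' Gt' ht] := lift GsV.
have e : s' * r = r * t'.
  apply: (autG_inj hQ _ _ (fq fF)); rewrite ?groupM //.
  rewrite !aut_imsetM (lift_imset _ hs) er es (flag_map_run qm) //.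
  rewrite (autG_run hQ) ?fq // er (lift_imset _ ht) esV (flag_map_run qm) //.
  exact: flag_swap.
by rewrite -hs -permM e permM exy ht.
Qed.

(** For a pair [(1, h)] the element [h] acts trivially on the quotient, and alignment turns this
    into membership in [K]. *)
Lemma mirror_chirality : chirality_group s2 s3 \subset K.
Proof.
have f4 := flag_swap 4 fF.
have m2 : s2^-1 @: swap le 4 F = run le (swap le 4 F) [:: 4; 3].
  rewrite -[swap le 4 F]/(run le F [:: 4]) (autG_run hP) ?groupV //.
  by rewrite (run_inv hP G2 fF _ e2) //= !(swapK hP) ?flag_swap.
have m3 : s3^-1 @: swap le 4 F = run le (swap le 4 F) [:: 5; 4].
  rewrite -[swap le 4 F]/(run le F [:: 4]) (autG_run hP) ?groupV //.
  by rewrite (run_inv hP G3 fF _ e3).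
have key g h : (g, h) \in mirror_pairs s2 s3 ->
    forall x y, r (q x) = q y -> r (q (g x)) = q (h y).
  move: g h; apply: mirror_pairs_ind.
  - by move=> x y; rewrite !perm1.
  - exact: mirror_gen e2 m2.
  - exact: mirror_gen e3 m3.
  by move=> g h g' h' H H' x y exy; rewrite !permM; apply/H'/H.
apply/subsetP => h; rewrite inE => hh.
have [_ Gh] := mirror_pairs_gen G2 G3 hh.
have [|k Kk ek] := quo_flag_eq hP sK quo_align fF (aut_flag hP (elimT (autgP _ _) Gh) fF).
  rewrite -imset_comp; apply: eq_imset => y /=.
  have e : r (q (val (r^-1 (q y)))) = q y by rewrite quo_val permKV.
  by have := key _ _ hh _ _ e; rewrite perm1 e.
have <- // : k = h by apply: (autG_inj hP _ Gh fF) => //; apply: (subsetP sK).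
Qed.

End Mirror.

Hypothesis nCh : ~~ (chirality_group s2 s3 \subset K).

Lemma quo_not_mirror : ~ same_orbit qle (q @: F) (q @: swap le 4 F).
Proof. by case/same_orbitP=> r Gr er; case/negP: nCh; apply: mirror_chirality er. Qed.

Let chiralP i A : flag le A -> letter 4 i ->
  same_orbit le F A /\ same_orbit le (swap le 4 F) (swap le i A) \/
  same_orbit le (swap le 4 F) A /\ same_orbit le F (swap le i A).
Proof.
move=> fA li; have f4 := flag_swap 4 fF; have fi := flag_swap i fA.
have nF : ~ same_orbit le F (swap le 4 F) by apply: (swap_orbit hP hC fF).
have nA : ~ same_orbit le A (swap le i A) by apply: (swap_orbit hP hC fA).
have [[g Gg eg]|[g Gg eg]] := @flag_orbit2 _ _ _ hP hC F A i fF fA li.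
  have FA : same_orbit le F A by apply/same_orbitP; exists g.
  left; split=> //; apply: (two_orbits hC f4 fA fi) nA => h; apply: nF.
  by apply: same_orbit_trans FA _; apply: same_orbit_sym.
have FA : same_orbit le F (swap le i A) by apply/same_orbitP; exists g.
right; split=> //; apply: (two_orbits hC f4 fF fA) => [/same_orbit_sym//|h].
by apply: nA; apply: same_orbit_trans FA; apply: same_orbit_sym.
Qed.

Lemma quo_chiral : chiral qle.
Proof.
have nm := quo_not_mirror; split.
  move=> X Y fX fY /(adj_swap hQ fX fY)[i li ->].
  have [A fA ->] := quo_flag_lift hP sK fX.
  have [_ _ qs] := qm; rewrite -qs // => s.
  case: (chiralP fA li) => -[/orb_quo h /orb_quo h']; apply: nm.
    apply: same_orbit_trans h _; apply: same_orbit_trans s _; exact: same_orbit_sym.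
  apply: same_orbit_trans h' _; apply: same_orbit_sym; exact: same_orbit_trans h s.
exists (q @: F), (q @: swap le 4 F); split; rewrite ?fq ?flag_swap //.
move=> X fX; have [A fA ->] := quo_flag_lift hP sK fX.
by case: (@chiralP 2 A fA isT) => -[/orb_quo h _]; [left|right].
Qed.

Lemma quo_tight : exists qs, tight qle 4 qs.
Proof.
have hCQ := quo_chiral.
have [t1 Gt1 h1] := lift G1; have [t2 Gt2 h2] := lift G2; have [t3 Gt3 h3] := lift G3.
have E (s : {perm T}) (t : {perm {x : T | qrep K x == x}}) w : (forall x, t (q x) = q (s x)) -> all (letter 4) w -> s @: F = run le F w ->
    t @: (q @: F) = run qle (q @: F) w.
  by move=> h lw es; rewrite (lift_imset _ h) es (flag_map_run qm).
have [E1 E2] := (E _ _ [:: 3; 2] h1 isT e1, E _ _ [:: 4; 3] h2 isT e2).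
have E3 := E _ _ [:: 5; 4] h3 isT e3.
exists [seq #[s] | s <- [:: t1; t2; t3]]; split.
  apply: (chiral_has_type hQ hCQ (fq fF)) => // -[|[|[|k]]] //= _; by split.
rewrite (card_flags hQ hCQ (fq fF)) //; congr (2 * _)%N.
rewrite /= !big_cons big_nil muln1.
have powl (s : {perm T}) (t : {perm {x : T | qrep K x == x}}) : (forall x, t (q x) = q (s x)) -> forall i x, (t ^+ i) (q x) = q ((s ^+ i) x).
  by move=> h; elim=> [|i IH] x; rewrite ?perm1 // !expgSr !permM IH h.
(* The image of the base flag lifts to a flag in the orbit of [F], since [quo_not_mirror] excludes
   the other orbit; so every automorphism of the quotient is induced from upstairs. *)
have sub : autg_group qle \subset <[t1]> * (<[t2]> * <[t3]>).
  apply/subsetP => g' Gg'; have ag' := elimT (autgP _ _) Gg'.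
  have [A fA eA] := quo_flag_lift hP sK (aut_flag hQ ag' (fq fF)).
  have [[h _]|[_ FA]] := chiralP fA (isT : letter 4 4); last first.
    case: quo_not_mirror; apply: same_orbit_trans (orb_quo FA) _.
    have [_ _ qs] := qm; rewrite !qs // -eA.
    have <- : g' @: swap qle 4 (q @: F) = swap qle 4 (g' @: (q @: F)).
      exact: (autG_run hQ Gg' (fq fF) (isT : all (letter 4) [:: 4])).
    by apply: same_orbit_sym; apply/same_orbitP; exists g'.
  case/same_orbitP: h => g Gg eg.
  have: g \in <[s1]> * stab 2 by rewrite (autg_cycle1_stab2 hP hC fF G1 G2 G3 e1 e2 e3 oG).
  case/mulsgP=> _ c /cycleP[i ->]; rewrite -(stab2E hP hC fF G1 G2 G3 e1 e2 e3 oG).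
  case/mulsgP=> _ _ /cycleP[j ->] /cycleP[k ->] -> defg.
  have -> : g' = t1 ^+ i * (t2 ^+ j * t3 ^+ k).
    apply: (autG_inj hQ Gg' _ (fq fF)); first by rewrite !groupM ?groupX.
    rewrite eA -eg defg; apply/esym; apply: (lift_imset (g := s1 ^+ i * (s2 ^+ j * s3 ^+ k))) => x.
    by rewrite !permM (powl _ _ h1) (powl _ _ h2) (powl _ _ h3).
  by rewrite !mem_mulg ?mem_cycle.
apply/eqP; rewrite eqn_leq; apply/andP; split.
  apply: leq_trans (subset_leq_card sub) _; apply: leq_trans (card_mulg_leq _ _) _.
  by rewrite leq_mul2l card_mulg_leq orbT.
apply: leq_trans (_ : #|<[t1]> * rstab qle (q @: F) 2| <= _); last first.
  by rewrite subset_leq_card // mul_subG ?rstab_sub ?cycle_subG.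
rewrite (TI_cardMg (cycle1_stab2_ti hQ hCQ (fq fF) Gt1 E1)) leq_mul2l.
rewrite -(TI_cardMg (cycle23_ti hQ hCQ (fq fF) Gt2 Gt3 E2 E3)) subset_leq_card ?orbT //.
exact: (sub_stab2 hQ (fq fF) Gt2 Gt3 E2 E3).
Qed.

End RegularQuotient.

Section AtomicKernel.

Variables (T : finType) (le : rel T).
Hypotheses (hP : polytope le 4) (hC : chiral le).
Local Notation autG := (autg_group le).
Variables (F : {set T}) (s1 s2 s3 : {perm T}).
Hypothesis fF : flag le F.
Hypotheses (G1 : s1 \in autG) (G2 : s2 \in autG) (G3 : s3 \in autG).
Hypotheses (e1 : s1 @: F = run le F [:: 3; 2]) (e2 : s2 @: F = run le F [:: 4; 3])
  (e3 : s3 @: F = run le F [:: 5; 4]).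
Hypothesis oG : #|autG| = (#[s1] * #[s2] * #[s3])%N.
Hypothesis atomic : forall (T' : finType) (le' : rel T') (m : nat) (qs : seq nat),
  polytope le' m -> chiral le' -> tight le' m qs -> ~ properly_covers le le'.

Lemma atomic_kernel (K : {group {perm T}}) : K <| autG -> K :!=: 1 ->
  <[s1]> :&: K * rstab le F 2 \subset K -> <[s3]> :&: K * rstab le F 5 \subset K ->
  s1 \notin K -> s2 \notin K -> s3 \notin K -> chirality_group s2 s3 \subset K.
Proof.
move=> nK ntK KA KD K1 K2 K3; apply/negPn/negP => nCh.
have sK : K \subset autG by case/andP: nK.
have align := quo_align hP hC fF G1 G2 G3 e1 e2 e3 oG nK KA KD K1 K2 K3.
have nsw := quo_noswap hP hC nK.
have [qs tq] := quo_tight hP hC fF G1 G2 G3 e1 e2 e3 oG nK KA KD K1 K2 K3 nCh.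
apply: (atomic (quo_polytope hP sK align nsw) _ tq).
  exact: (quo_chiral hP hC fF G1 G2 G3 e1 e2 e3 oG nK KA KD K1 K2 K3 nCh).
exists (quo K); split; first exact: (quo_covering hP sK align nsw).
case=> /bij_inj qinj _; case/trivgPn: ntK => k Kk /eqP; apply.
by apply/permP => x; rewrite perm1; apply: qinj; rewrite quoK.
Qed.

End AtomicKernel.

(** * Polyhedra and regular facets *)

Lemma mem_pair_inv (gT : finGroupType) (M : {group gT * gT}) (s : gT) :
  (s, s^-1) \in M -> (s^-1, s) \in M.
Proof. by move/groupVr; rewrite -[_^-1]/(s^-1, s^-1^-1) invgK. Qed.

(** Given a pair [(g, g')] with [g] in the kernel, [g] is a power of one generator, so [(g^-1, g)]
    is also a mirror pair. Multiplying puts [g * g'] into the chirality group, hence [g'] into the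
    kernel. *)
Lemma chirality_morph (gT rT : finGroupType) (H : {group gT}) (phi : {morphism H >-> rT})
    (s2 s3 : gT) : s2 \in H -> s3 \in H ->
  ('ker phi \subset <[s2]>) || ('ker phi \subset <[s3]>) ->
  chirality_group s2 s3 \subset 'ker phi -> chirality_group (phi s2) (phi s3) :=: 1.
Proof.
move=> H2 H3 kB kCh.
have kM g g' : (g, g') \in mirror_pairs s2 s3 -> g \in 'ker phi -> g' \in 'ker phi.
  move=> gg kg; have [Hg Hg'] := mirror_pairs_gen H2 H3 gg.
  suff /(_ g kg)[j [j' [jj kj' ej]]] : forall g, g \in 'ker phi -> exists j j',
      [/\ (j, j') \in mirror_pairs s2 s3, j' \in 'ker phi & j * g = 1].
    have : (j * g, j' * g') \in mirror_pairs s2 s3 by apply: (groupM jj gg).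
    rewrite ej => h; have : j' * g' \in 'ker phi by apply: (subsetP kCh); rewrite inE.
    by rewrite groupMl.
  move=> x kx; have mk s : (s, s^-1) \in mirror_pairs s2 s3 -> x \in <[s]> ->
      exists j j', [/\ (j, j') \in mirror_pairs s2 s3, j' \in 'ker phi & j * x = 1].
    move=> ms /cycleP[i ex]; exists (s ^+ i)^-1, (s ^+ i).
    split; [ | by rewrite -ex | by rewrite ex mulVg].
    elim: i {ex} => [|i IH]; first by rewrite !expg0 invg1; apply: group1.
    have := groupM (mem_pair_inv ms) IH; rewrite -[_ * _]/(s^-1 * s ^- i, s * s ^+ i).
    by rewrite -invMg -expgSr -expgS.
  case/orP: kB => /subsetP/(_ _ kx) hx; [exact: mk (mirror_pair2 _ _) hx | exact: mk (mirror_pair3 _ _) hx].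
have lft t t' : (t, t') \in mirror_pairs (phi s2) (phi s3) -> exists g g',
    [/\ (g, g') \in mirror_pairs s2 s3, phi g = t & phi g' = t'].
  move: t t'; apply: mirror_pairs_ind.
  - by exists 1, 1; rewrite morph1; split=> //; apply: group1.
  - by exists s2, s2^-1; rewrite morphV //; split=> //; apply: mirror_pair2.
  - by exists s3, s3^-1; rewrite morphV //; split=> //; apply: mirror_pair3.
  move=> u u' v v' [g [g' [gg <- <-]]] [h [h' [hh <- <-]]].
  have [Hg Hg'] := mirror_pairs_gen H2 H3 gg; have [Hh Hh'] := mirror_pairs_gen H2 H3 hh.
  by exists (g * h), (g' * h'); rewrite !morphM //; split=> //; apply: (groupM gg hh).
apply/trivgP/subsetP => t; rewrite inE => /lft[g [g' [gg e <-]]].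
have [Hg Hg'] := mirror_pairs_gen H2 H3 gg.
by rewrite inE; apply/eqP/mker/(kM g) => //; apply/kerP.
Qed.

Lemma run2_neq (T : finType) (le : rel T) n (A : {set T}) i j : polytope le n ->
  flag le A -> letter n i -> letter n j -> i <> j -> run le A [:: j; i] <> A.
Proof.
move=> hP fA li lj nij /= e; have [x Ax rx] := letter_face hP fA lj.
have e' : swap le j A = swap le i A by rewrite -{2}e (swapK hP) ?flag_swap.
apply: (swap_face_neq hP fA lj Ax (y := x)) => //.
rewrite e'; apply: (swap_agree fA) => //; rewrite rx; exact/nesym.
Qed.

Section Rank3.

Variables (T : finType) (le : rel T).
Hypotheses (hP : polytope le 3) (hC : chiral le).
Local Notation autG := (autg_group le).
Variables (F : {set T}) (t2 t3 : {perm T}).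
Hypothesis fF : flag le F.
Hypotheses (G2 : t2 \in autG) (G3 : t3 \in autG).
Hypotheses (e2 : t2 @: F = run le F [:: 3; 2]) (e3 : t3 @: F = run le F [:: 4; 3]).

Lemma letter3P i : letter 3 i -> [\/ i = 2, i = 3 | i = 4].
Proof. by case: i => [|[|[|[|[|i]]]]] // _; [apply: Or31|apply: Or32|apply: Or33]. Qed.

Let e2V : t2^-1 @: F = run le F [:: 2; 3].
Proof. by rewrite (run_inv hP G2 fF _ e2). Qed.

Lemma rank3_gen : autG :=: <[t2]> <*> <[t3]>.
Proof.
apply/eqP; rewrite eqEsubset join_subG !cycle_subG G2 G3 !andbT.
apply/subsetP => g Gg.
apply: (@rstab_gen _ _ _ hP _ fF hC (<[t2]> <*> <[t3]>)%G predT 3 g) => //.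
  by rewrite join_subG !cycle_subG G2 G3.
move=> i _ /letter3P[]->.
- by exists t2^-1; rewrite // groupV mem_gen // inE cycle_id.
- by exists 1; rewrite ?group1 // aut_imset1 /= (swapK hP).
by exists t3; rewrite // mem_gen // inE cycle_id orbT.
Qed.

Lemma rank3_ti : <[t2]> :&: <[t3]> = 1.
Proof.
have s4 : <[t2]> \subset rstab le F 4 by rewrite cycle_subG (run_rstab hP fF G2 e2).
have s2 : <[t3]> \subset rstab le F 2 by rewrite cycle_subG (run_rstab hP fF G3 e3).
apply/trivgP/subsetP => g /setIP[/(subsetP s4) g4 /(subsetP s2) g2].
apply: (@rstab_gen _ _ _ hP _ fF hC 1%G (pred1 3) 3 g) => //.
- exact: sub1G.
- by move=> i /eqP-> _; exists 1; rewrite ?group1 // aut_imset1 /= (swapK hP).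
- exact: subsetP (rstab_sub _ _ _) _ g2.
by move=> i /letter3P[]->.
Qed.

(* Otherwise reflecting every word in [swap 3 F] would define an automorphism. *)
Lemma chirality_neq1 : chirality_group t2 t3 :!=: 1.
Proof.
apply/negP => /eqP Ch1; have f3 := flag_swap 3 fF.
have [|f af ef] := extend_flag hP fF f3; last first.
  by apply: (no_swap hP hC _ fF (isT : letter 3 3) ef); apply/autgP.
move=> w lw ew.
have [ow|evw] := boolP (odd (size w)).
  case: (odd_orbit hP hC fF lw ow); rewrite ew; apply/same_orbitP.
  by exists 1; rewrite ?group1 ?aut_imset1.
have [||g [h [gh Gg Gh eg eh]]] :=
    @pair_words _ _ _ hP F (swap le 3 F) (mirror_pairs t2 t3) predT 3 fF f3 isT _ w lw _ evw.
- have lsw g u : g \in autG -> all (letter 3) u -> g @: F = run le F u ->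
      g @: swap le 3 F = run le F (u ++ [:: 3]).
    move=> Gg lu eg; rewrite -[swap le 3 F]/(run le F [:: 3]) (autG_run hP) //.
    by rewrite eg run_cat.
  move=> i _ /letter3P[]->.
  + exists t2^-1, t2; rewrite groupV; split=> //; last by rewrite (lsw _ [:: 3; 2]).
    exact/mem_pair_inv/mirror_pair2.
  + by exists 1, 1; rewrite group1 !aut_imset1 /= !(swapK hP) ?flag_swap //; split=> //; apply: group1.
  exists t3, t3^-1; rewrite groupV; split=> //; first exact: mirror_pair3.
  rewrite (lsw _ [:: 3; 4]) ?groupV //; by rewrite (run_inv hP G3 fF _ e3).
- exact/allP.
have g1 : g = 1 by apply: (autG_inj hP Gg (group1 _) fF); rewrite eg ew aut_imset1.
have : h \in chirality_group t2 t3 by rewrite inE -g1.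
by rewrite Ch1 => /set1gP h1; rewrite -eh h1 aut_imset1.
Qed.

End Rank3.

Section RegularFacet.

Variables (T : finType) (le : rel T).
Hypotheses (hP : polytope le 4) (hC : chiral le).
Let po := polytope_po hP.
Let fs := polytope_fs hP.
Local Notation autG := (autg_group le).
Variables (F : {set T}) (s1 s2 s3 : {perm T}).
Hypothesis fF : flag le F.
Hypotheses (G1 : s1 \in autG) (G2 : s2 \in autG) (G3 : s3 \in autG).
Hypotheses (e1 : s1 @: F = run le F [:: 3; 2]) (e2 : s2 @: F = run le F [:: 4; 3])
  (e3 : s3 @: F = run le F [:: 5; 4]).
Hypothesis oG : #|autG| = (#[s1] * #[s2] * #[s3])%N.
Variables (z x5 : T).
Hypotheses (Fz : z \in F) (rz : rk le z = 2) (F5 : x5 \in F) (r5 : rk le x5 = 5).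
Hypothesis reg : regular (@facet_le T le x5).

(** Tightness makes [<[s1]>] a complement of the vertex stabiliser, hence transitive on vertices; so
    all vertices lie on the base facet. *)
Lemma vertex_cycle v : rk le v = 2 -> exists i, v = (s1 ^+ i) z.
Proof.
move=> rv; have [B fB Bv] := flag1 po v.
have [g Gg gz] : exists2 g, g \in autG & g z = v.
  have [[g Gg eg]|[g Gg eg]] := @flag_orbit2 _ _ _ hP hC F B 3 fF fB isT; exists g => //.
    by apply: (aut_face hP _ fF Fz); [exact/autgP | rewrite eg | rewrite rv rz].
  apply: (aut_face hP _ fF Fz); [exact/autgP | rewrite eg | by rewrite rv rz].
  by apply: (swap_agree fB); rewrite // rv.
have : g^-1 \in <[s1]> * rstab le F 2 by rewrite (autg_cycle1_stab2 hP hC fF G1 G2 G3 e1 e2 e3 oG) groupV.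
case/mulsgP=> a c Aa Gc e; have /cycleP[i ei] : a^-1 \in <[s1]> by rewrite groupV.
exists i; rewrite -ei -gz -[g]invgK e invMg permM; congr (a^-1 _).
by have /rstabP[_] : c^-1 \in rstab le F 2 by [rewrite groupV]; apply.
Qed.

(** Regularity gives a reflection [r] of the facet exchanging the base edge. On vertices it agrees
    with the half-turn [s2 * s3]: both fix [z] and invert [s1]. As [r] also inverts [s2], so does
    the half-turn on vertices; with [s2 * s3 = s3^-1 * s2^-1] this gives equal images of [v] under
    [s3] and [s3^-1]. *)
Lemma square_fixes_vertices v : rk le v = 2 -> (s3 ^+ 2) v = v.
Proof.
move=> rv.
have [b Fb rb] : exists2 b, b \in F & rk le b = 1%N by apply: (flag_face po fs fF).
pose D x := le x x5.
have hb x : le b x.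
  have [B fB Bx] := flag1 po x.
  have Bb : b \in B by apply: (bottom_flag hP).
  by rewrite (flag_le po fs fB Bb Bx) rb (rk_gt0 po fs).
have hD x : D x = le b x && le x x5 by rewrite hb.
have hm : rk le x5 = (rk le b + 4)%N by rewrite r5 rb.
have hS : polytope (sub_le le (D := D)) 3 := sub_polytope hP hD (hb x5) hm.
have fS : flag (sub_le le (D := D)) (sect D F) by apply: (flag_sect hP hD (hb x5) hm).
have sw B i : flag le B -> b \in B -> x5 \in B -> 1 < i < 5 ->
    sect D (swap le i B) = swap (sub_le le (D := D)) i (sect D B).
  move=> fB Bb B5 hi; rewrite (sect_swap hP hD (hb x5) hm) ?rb ?r5 //.
  by rewrite subn1.
have f3 := flag_swap 3 fF.
have F3b : b \in swap le 3 F by apply: (swap_agree fF); rewrite // rb.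
have F35 : x5 \in swap le 3 F by apply: (swap_agree fF); rewrite // r5.
have f3S : flag (sub_le le (D := D)) (sect D (swap le 3 F)).
  by apply: (flag_sect hP hD (hb x5) hm).
have [r [ar er]] : same_orbit (sub_le le (D := D)) (sect D F) (sect D (swap le 3 F)).
  exact: (reg fS f3S).
have Gr : r \in autg_group (sub_le le (D := D)) by apply/autgP.
rewrite sw // in er.
have sub s u : s \in autG -> s \in rstab le F 5 -> all (fun i => 1 < i < 5) u ->
    s @: F = run le F u -> exists s' : {perm {x : T | D x}},
    [/\ s' \in autg_group (sub_le le (D := D)), forall x, val (s' x) = s (val x)
      & s' @: sect D F = run (sub_le le (D := D)) (sect D F) u].
  move=> Gs /rstabP[_ s5] lu es.
  have sb : s b = b by apply: (aut_fix_end hP fF Gs Fb); rewrite rb.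
  have [s' as' hs] := sub_aut hD Gs sb (s5 _ F5 r5).
  exists s'; split=> //; first exact/autgP.
  rewrite (sect_aut _ hs) es; elim: u (F) fF Fb F5 lu {es} => //= i u IH B fB Bb B5 /andP[hi lu].
  rewrite IH ?flag_swap ?sw //.
    by apply: (swap_agree fB) => //; rewrite rb => e; rewrite -e in hi.
  by apply: (swap_agree fB) => //; rewrite r5 => e; rewrite -e in hi.
have /andP[_ st1] := s1_stab hP fF G1 e1; have /andP[_ st2] := s2_stab hP fF G2 e2.
have [t1 [Gt1 h1 E1]] := sub _ [:: 3; 2] G1 st1 isT e1.
have [t2 [Gt2 h2 E2]] := sub _ [:: 4; 3] G2 st2 isT e2.
have mir t u : t \in autg_group (sub_le le (D := D)) -> all (letter 3) u ->
    t @: sect D F = run (sub_le le (D := D)) (sect D F) u ->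
    run (sub_le le (D := D)) (sect D F) (3 :: u) = run (sub_le le (D := D)) (sect D F) (rcons (rev u) 3) ->
    t * r = r * t^-1.
  move=> Gt lu Et comm; apply: (autG_inj hS _ _ fS); rewrite ?groupM ?groupV //.
  rewrite !aut_imsetM Et (autG_run hS) // er.
  rewrite -[swap _ 3 _]/(run (sub_le le (D := D)) (sect D F) [:: 3]) (autG_run hS) ?groupV //.
  by rewrite (run_inv hS Gt fS _ Et) // -!run_cat cats1.
have m1 : t1 * r = r * t1^-1 by apply: (mir _ [:: 3; 2]) => //=; rewrite !(swapK hS) ?flag_swap.
have m2 : t2 * r = r * t2^-1 by apply: (mir _ [:: 4; 3]).
have powr i : t1 ^+ i * r = r * t1^-1 ^+ i.
  by elim: i => [|i IH]; rewrite ?mul1g ?mulg1 // expgSr -mulgA m1 mulgA IH -mulgA -expgSr.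
have valV (t : {perm {x : T | D x}}) (s : {perm T}) : (forall x, val (t x) = s (val x)) ->
    forall x, val (t^-1 x) = s^-1 (val x).
  by move=> h x; apply: (@perm_inj _ s); rewrite -h !permKV.
have powv (t : {perm {x : T | D x}}) (s : {perm T}) i : (forall x, val (t x) = s (val x)) ->
    forall x, val ((t ^+ i) x) = (s ^+ i) (val x).
  by move=> h; elim: i => [|i IH] x; rewrite ?perm1 // !expgSr !permM h IH.
have Dz : D z by rewrite /D (flag_le po fs fF) // rz r5.
pose z' : {x : T | D x} := exist _ z Dz.
have rS (y : {x : T | D x}) : rk (sub_le le (D := D)) y = rk le (val y).
  by have := sub_le_rk hP hD (hb x5) hm y; rewrite rb addn1 => -[].
have rz' : r z' = z'.
  apply: (aut_face hS ar fS); rewrite ?inE //.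
  rewrite er; apply: (swap_agree fS); rewrite ?inE // rS /= rz //.
have tau i : (s2 * s3) ((s1 ^+ i) z) = (s1^-1 ^+ i) z.
  have := congr1 (fun g => g ^+ i) (s23_inverts_s1 hP fF G1 G2 G3 e1 e2 e3).
  rewrite -conjXg => <-; rewrite conjgE !permM; congr (s3 (s2 _)).
  congr ((s1 ^+ i) _).
  have G23 : s2 * s3 \in rstab le F 2.
    have /andP[? _] := s2_stab hP fF G2 e2; have /andP[? _] := s3_stab hP fF G3 e3.
    exact: groupM.
  have : (s2 * s3)^-1 \in rstab le F 2 by rewrite groupV.
  by case/rstabP=> _ /(_ z Fz rz).
have tauR (y : {x : T | D x}) : rk le (val y) = 2 -> (s2 * s3) (val y) = val (r y).
  case/vertex_cycle=> i ey; have -> : y = (t1 ^+ i) z' by apply: val_inj; rewrite ey (powv _ _ i h1).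
  rewrite -[r _]permM powr [in RHS]permM rz' (powv _ _ i (valV _ _ h1)) (powv _ _ i h1) /=.
  exact: tau.
have rk2 s x : s \in autG -> rk le (s x) = rk le x by move/autgP/(aut_rk hP).
have ru : rk le (s2^-1 v) = 2 by rewrite rk2 ?groupV.
have [i eu] := vertex_cycle ru.
have eu' : s2^-1 v = val ((t1 ^+ i) z') by rewrite (powv _ _ i h1).
have h : (s2 * (s2 * s3)) (s2^-1 v) = ((s2 * s3) * s2^-1) (s2^-1 v).
  rewrite [LHS]permM [RHS]permM eu' -h2 tauR; last by rewrite h2 -eu' rk2.
  by rewrite -[r _]permM m2 permM (valV _ _ h2) tauR // -eu'.
have e23V : s2 * s3 = s3^-1 * s2^-1.
  rewrite -invMg; apply: (mulgI (s2 * s3)); rewrite mulgV -expg2.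
  exact: (rel23 hP fF G2 G3 e2 e3).
move: h; rewrite {1}e23V !permM permKV => /perm_inj h.
by rewrite -h permKV.
Qed.

Lemma square_in_core : s3 ^+ 2 \in gcore (rstab le F 2) autG.
Proof.
apply/bigcapP => h Gh; rewrite mem_conjg.
rewrite -(rstab_imset hP fF _ Fz rz); last by rewrite groupJ ?groupX ?groupV.
have -> : (s3 ^+ 2 ^ h^-1) z = h^-1 ((s3 ^+ 2) (h z)) by rewrite conjgE invgK !permM.
rewrite square_fixes_vertices ?permK //.
by rewrite (aut_rk hP) //; apply/autgP.
Qed.

End RegularFacet.

(** * Vertex-figures *)

Section VertexFigure.

Variables (T : finType) (le : rel T).
Hypotheses (hP : polytope le 4) (hC : chiral le).
Let po := polytope_po hP.
Let fs := polytope_fs hP.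
Local Notation autG := (autg_group le).
Variables (F : {set T}) (s1 s2 s3 : {perm T}).
Hypothesis fF : flag le F.
Hypotheses (G1 : s1 \in autG) (G2 : s2 \in autG) (G3 : s3 \in autG).
Hypotheses (e1 : s1 @: F = run le F [:: 3; 2]) (e2 : s2 @: F = run le F [:: 4; 3])
  (e3 : s3 @: F = run le F [:: 5; 4]).
Hypothesis oG : #|autG| = (#[s1] * #[s2] * #[s3])%N.
Local Notation stab i := (rstab le F i).
Variable v : T.
Hypotheses (Fv : v \in F) (rv : rk le v = 2).

Local Notation S := {x : T | le v x}.
Local Notation leV := (sub_le le (D := le v)).
Local Notation FV := (sect (le v) F).

Let top : exists c, [/\ c \in F, rk le c = 6 & forall x, le x c].
Proof.
have [//|c Fc rc] := flag_face po fs fF (_ : 0 < 6 <= 6); exists c; split=> // x.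
have [B fB Bx] := flag1 po x; have Bc : c \in B by apply: (top_flag hP).
by rewrite (flag_le po fs fB) // rc (rk_max po fs).
Qed.

Lemma vfig_polytope : polytope leV 3.
Proof.
have [c [Fc rc hc]] := top; apply: (@sub_polytope _ _ _ hP (le v) v c 3) => //.
  by move=> x; rewrite hc andbT.
by rewrite rc rv.
Qed.

Lemma vfig_flag : flag leV FV.
Proof.
have [c [Fc rc hc]] := top; apply: (@flag_sect _ _ _ hP (le v) v c 3) => //.
  by move=> x; rewrite hc andbT.
by rewrite rc rv.
Qed.

Lemma vfig_run B w : flag le B -> v \in B -> all (fun i => 1 < i < 5) w ->
  sect (le v) (run le B [seq i.+1 | i <- w]) = run leV (sect (le v) B) w.
Proof.
have [c [Fc rc hc]] := top; elim: w B => //= i w IH B fB Bv /andP[/andP[i1 i5] lw].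
have Bc : c \in B by apply: (top_flag hP).
rewrite IH ?flag_swap //; last first.
  by apply: (swap_agree fB); rewrite // rv => -[e]; rewrite -e in i1.
rewrite (@sect_swap _ _ _ hP (le v) v c 3) ?rv ?rc //.
- by rewrite subn2.
- by move=> x; rewrite hc andbT.
by rewrite !ltnS i1.
Qed.

Lemma vfig_restr g : g \in stab 2 ->
  exists2 g' : {perm S}, g' \in autg_group leV & forall x, val (g' x) = g (val x).
Proof.
have [c [Fc rc hc]] := top; case/rstabP=> Gg g2.
have gc : g c = c by apply: (aut_fix_end hP fF Gg Fc); rewrite rc.
have [|g' ag' hg'] := @sub_aut _ _ (le v) v c _ g Gg (g2 _ Fv rv) gc.
  by move=> x; rewrite hc andbT.
by exists g' => //; apply/autgP.
Qed.

Lemma vfig_faithful g : g \in stab 2 -> (forall x : S, g (val x) = val x) -> g = 1.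
Proof.
move=> g2 h; have Gg := subsetP (rstab_sub _ _ _) _ g2.
apply: (stab_triple hP hC fF (isT : letter 4 2) Gg) => i li _; apply/rstabP; split=> // x Fx rx.
have vx : le v x by rewrite (flag_le po fs fF) // rv rx; case/andP: li.
exact: (h (exist _ x vx)).
Qed.

Let restrX (g : {perm T}) (g' : {perm S}) : (forall x, val (g' x) = g (val x)) ->
  forall i x, val ((g' ^+ i) x) = (g ^+ i) (val x).
Proof. by move=> h; elim=> [|i IH] x; rewrite ?perm1 // !expgSr !permM h IH. Qed.

Lemma order_restr (g : {perm T}) (g' : {perm S}) : g \in stab 2 ->
  (forall x, val (g' x) = g (val x)) -> #[g'] = #[g].
Proof.
move=> g2 h; apply/eqP; rewrite eqn_dvd !order_dvdn; apply/andP; split; apply/eqP.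
  by apply/permP => x; apply: val_inj; rewrite (restrX h) expg_order !perm1.
apply: vfig_faithful; first exact: groupX.
by move=> x; rewrite -(restrX h) expg_order perm1.
Qed.

Let st2 : s2 \in stab 2. Proof. by have /andP[] := s2_stab hP fF G2 e2. Qed.
Let st3 : s3 \in stab 2. Proof. by have /andP[] := s3_stab hP fF G3 e3. Qed.
Let defG0 : <[s2]> * <[s3]> = stab 2. Proof. exact: (stab2E hP hC fF G1 G2 G3 e1 e2 e3 oG). Qed.

Lemma vfig_gens : exists r2 r3 : {perm S},
  [/\ r2 \in autg_group leV, r3 \in autg_group leV,
      forall x, val (r2 x) = s2 (val x), forall x, val (r3 x) = s3 (val x)
    & r2 @: FV = run leV FV [:: 3; 2] /\ r3 @: FV = run leV FV [:: 4; 3]].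
Proof.
have [r2 Gr2 h2] := vfig_restr st2; have [r3 Gr3 h3] := vfig_restr st3.
exists r2, r3; split=> //; split.
  by rewrite (sect_aut _ h2) e2 (@vfig_run F [:: 3; 2]).
by rewrite (sect_aut _ h3) e3 (@vfig_run F [:: 4; 3]).
Qed.

Hypothesis hCV : chiral leV.

(** The restricted rotations generate the automorphism group of the vertex-figure, so each of its
    automorphisms comes from the vertex stabiliser and inherits the factorisation [<[s2]> *
    <[s3]>]. *)
Lemma vfig_tight : tight leV 3 [:: #[s2]; #[s3]].
Proof.
have [r2 [r3 [Gr2 Gr3 h2 h3 [E2 E3]]]] := vfig_gens.
have [hV fV] := (vfig_polytope, vfig_flag).
rewrite -(order_restr st2 h2) -(order_restr st3 h3); split.
  apply: (@chiral_has_type _ _ _ hV hCV _ fV [:: r2; r3]) => // -[|[|k]] //= _; by split.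
rewrite (card_flags hV hCV fV) // !big_cons big_nil muln1; congr (2 * _)%N.
rewrite -(TI_cardMg (rank3_ti hV hCV fV Gr2 Gr3 E2 E3)); apply: eq_card => g'.
apply/idP/idP => [|/mulsgP[x y Hx Hy ->]]; last first.
  have sub r : r \in autg_group leV -> <[r]> \subset autg_group leV by rewrite cycle_subG.
  exact: groupM (subsetP (sub _ Gr2) _ Hx) (subsetP (sub _ Gr3) _ Hy).
rewrite (rank3_gen hV hCV fV Gr2 Gr3 E2 E3) joing_idl joing_idr => Hg.
have [g g2 hg] : exists2 g, g \in stab 2 & forall x, val (g' x) = g (val x).
  apply: (gen_induction (P := fun g' : {perm S} => exists2 g, g \in stab 2 & forall x, val (g' x) = g (val x)) _ _ _ Hg).
  - by exists 1; rewrite ?group1 // => x; rewrite !perm1.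
  - by move=> _ /set2P[]->; [exists s2 | exists s3].
  move=> x y [g g2 hg] [h g2' hh]; exists (g * h); first exact: groupM.
  by move=> z; rewrite !permM hh hg.
move: g2; rewrite -defG0 => /mulsgP[_ _ /cycleP[i ->] /cycleP[j ->] eg].
have -> : g' = r2 ^+ i * r3 ^+ j; last by rewrite mem_mulg ?mem_cycle.
by apply/permP => x; apply: val_inj; rewrite hg eg !permM (restrX h3) (restrX h2).
Qed.

Section Cover.

Variables (W : finType) (leW : rel W).
Hypotheses (hW : polytope leW 3) (hCW : chiral leW).
Variable eta : S -> W.
Hypothesis cov : covering leV leW eta.

Let hV := vfig_polytope.
Let fV := vfig_flag.
Let em : flag_map leV leW 3 eta := covering_flag_map hV hW cov.
Local Notation FW := (eta @: FV).
Let fW : flag leW FW. Proof. by case: em => _ + _; apply. Qed.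

(** A relation rather than a map, so that [g] acts on the whole polytope and [t] on [W]. On the
    vertex stabiliser it determines [t], because [eta] is onto. *)
Definition lifts (g : {perm T}) (t : {perm W}) :=
  [forall x, forall y, (val y == g (val x)) ==> (eta y == t (eta x))].

Lemma liftsP (g : {perm T}) (t : {perm W}) : reflect (forall x y, val y = g (val x) -> eta y = t (eta x)) (lifts g t).
Proof.
apply: (iffP forallP) => [h x y /eqP e|h x].
  by have /forallP/(_ y)/implyP/(_ e)/eqP := h x.
by apply/forallP => y; apply/implyP => /eqP e; apply/eqP/h.
Qed.

Lemma lifts_restr (g : {perm T}) (g' : {perm S}) (t : {perm W}) : (forall x, val (g' x) = g (val x)) ->
  (forall x, eta (g' x) = t (eta x)) -> lifts g t.
Proof.
by move=> h ht; apply/liftsP => x y e; rewrite -ht; congr eta; apply: val_inj; rewrite e h.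
Qed.

Lemma liftsM g h t u : g \in stab 2 -> lifts g t -> lifts h u -> lifts (g * h) (t * u).
Proof.
move=> g2 /liftsP lg /liftsP lh; have [g' _ hg] := vfig_restr g2.
apply/liftsP => x y; rewrite !permM => e.
by rewrite -(lg x (g' x)) ?hg //; apply: lh; rewrite hg.
Qed.

Lemma lifts_uniq g t u : g \in stab 2 -> lifts g t -> lifts g u -> t = u.
Proof.
move=> g2 /liftsP lt /liftsP lu; have [g' _ hg] := vfig_restr g2.
apply/permP => w; have [x <-] : exists x, eta x = w by case: cov => + _ _ _; apply.
by rewrite -(lt x (g' x)) // (lu x (g' x)).
Qed.

Lemma lifts1 : lifts 1 1.
Proof. by apply/liftsP => x y; rewrite !perm1 => /val_inj->. Qed.

Lemma liftsX g t i : g \in stab 2 -> lifts g t -> lifts (g ^+ i) (t ^+ i).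
Proof.
move=> g2 l; elim: i => [|i IH]; first exact: lifts1.
by rewrite !expgS; apply: liftsM.
Qed.

(** Chirality of [W] supplies [t2] and [t3]. They intertwine with the rotations because both
    composites with [eta] are flag maps agreeing on the base flag. *)
Lemma cover_gens : exists t2 t3,
  [/\ t2 \in autg_group leW, t3 \in autg_group leW, lifts s2 t2, lifts s3 t3
    & t2 @: FW = run leW FW [:: 3; 2] /\ t3 @: FW = run leW FW [:: 4; 3]].
Proof.
have [r2 [r3 [Gr2 Gr3 h2 h3 [E2 E3]]]] := vfig_gens.
have [//|//|t2 Gt2 et2] := @even_gen _ _ _ hW hCW FW [:: 3; 2] fW.
have [//|//|t3 Gt3 et3] := @even_gen _ _ _ hW hCW FW [:: 4; 3] fW.
have eqm (t : {perm W}) (r' : {perm S}) w : t \in autg_group leW -> r' \in autg_group leV ->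
    all (letter 3) w -> r' @: FV = run leV FV w -> t @: FW = run leW FW w ->
    forall x, eta (r' x) = t (eta x).
  move=> /autgP at_ /autgP ar lw er et x.
  have m1 := flag_map_comp (aut_flag_map hV ar) em.
  have m2 := flag_map_comp em (aut_flag_map hW at_).
  apply: (flag_map_eq hV hW m1 m2 fV).
  by rewrite (imset_comp eta) (imset_comp t) er et (flag_map_run em).
exists t2, t3; split=> //.
  by apply: (lifts_restr h2); apply: (eqm _ _ [:: 3; 2]).
by apply: (lifts_restr h3); apply: (eqm _ _ [:: 4; 3]).
Qed.

Definition descend (g : {perm T}) : {perm W} := odflt 1 [pick t | lifts g t].

Lemma descendP g : g \in stab 2 -> lifts g (descend g).
Proof.
move=> g2; rewrite /descend; case: pickP => //= none.
have [t2 [t3 [_ _ l2 l3 _]]] := cover_gens.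
move: (g2); rewrite -defG0 => /mulsgP[_ _ /cycleP[i ->] /cycleP[j ->] eg].
have := none (t2 ^+ i * t3 ^+ j); rewrite eg liftsM ?liftsX ?groupX //.
Qed.

Lemma descendM : {in stab 2 &, {morph descend : g h / g * h}}.
Proof.
move=> g h g2 h2; apply: (lifts_uniq (groupM g2 h2)); first exact/descendP/groupM.
by apply: liftsM; rewrite ?descendP.
Qed.

Canonical descend_morphism := Morphism descendM.

Hypothesis kernelB : forall N : {group {perm T}},
  N \subset <[s2]> -> N <| stab 2 -> N :!=: 1 -> chirality_group s2 s3 \subset N.
Hypothesis kernelD : forall N : {group {perm T}},
  N \subset <[s3]> -> N <| stab 2 -> N :!=: 1 -> s3 \notin N -> chirality_group s2 s3 \subset N.

(** Keeping one entry of the type forces the kernel into the other cyclic factor, and the drop in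
    the other entry makes it nontrivial. It then contains the chirality group, so that of [W] would
    be trivial, against [chirality_neq1]. *)
Lemma vfig_no_cover p' q' :
  (has_type leW 3 [:: p'; #[s3]] /\ p' %| #[s2] /\ p' != #[s2]) \/
  (has_type leW 3 [:: #[s2]; q'] /\ q' %| #[s3] /\ q' != #[s3]) -> False.
Proof.
have [t2 [t3 [Gt2 Gt3 l2 l3 [E2 E3]]]] := cover_gens.
have d2 : descend s2 = t2 by apply: (lifts_uniq st2) => //; apply: descendP.
have d3 : descend s3 = t3 by apply: (lifts_uniq st3) => //; apply: descendP.
have typ ps : has_type leW 3 ps -> ps = [:: #[t2]; #[t3]].
  by apply: (@chiral_type_unique _ _ _ hW hCW _ fW [:: t2; t3]) => // -[|[|k]] //= _; split.
pose N := 'ker descend_morphism; have nN : N <| stab 2 by apply: ker_normal.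
have kX s t i : s \in stab 2 -> descend s = t -> (s ^+ i \in N) = (t ^+ i == 1).
  move=> sst et; have dX : descend (s ^+ i) = t ^+ i by rewrite -et; apply: (morphX descend_morphism).
  by rewrite -dX; apply/kerP/eqP => //; apply: groupX.
(* The cyclic groups of [t2] and [t3] meet trivially, so both factors of a kernel element lie in the
   kernel. *)
have kfac g : g \in N -> exists i j, [/\ g = s2 ^+ i * s3 ^+ j, t2 ^+ i = 1 & t3 ^+ j = 1].
  move=> Ng; have g2 : g \in stab 2 by case/andP: nN => /subsetP/(_ _ Ng).
  move: (g2); rewrite -defG0 => /mulsgP[_ _ /cycleP[i ->] /cycleP[j ->] eg].
  have dX s t k : s \in stab 2 -> descend s = t -> descend (s ^+ k) = t ^+ k.
    by move=> sst <-; apply: (morphX descend_morphism).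
  have : descend g = 1 by apply: (mker (f := descend_morphism)).
  rewrite eg descendM ?groupX // (dX _ t2) // (dX _ t3) // => e.
  have e' : t3 ^+ j = (t2 ^+ i)^-1 by apply: (mulgI (t2 ^+ i)); rewrite e mulgV.
  have : t3 ^+ j \in <[t2]> :&: <[t3]> by rewrite inE mem_cycle e' groupV mem_cycle.
  rewrite (rank3_ti hW hCW fW Gt2 Gt3 E2 E3) => /set1gP e3'.
  by exists i, j; split=> //; move: e; rewrite e3' mulg1.
have ntX s t : s \in stab 2 -> descend s = t -> #[t] %| #[s] -> #[t] != #[s] -> N :!=: 1.
  move=> sst et dv ne; apply/negP => /eqP N1; case/negP: ne.
  have : s ^+ #[t] \in N by rewrite (kX _ t) // expg_order.
  by rewrite N1 => /set1gP/eqP; rewrite -order_dvdn eqn_dvd dv.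
have fin : ('ker descend_morphism \subset <[s2]>) || ('ker descend_morphism \subset <[s3]>) ->
    chirality_group s2 s3 \subset 'ker descend_morphism -> False.
  move=> kk kC; have := chirality_morph st2 st3 kk kC; rewrite /= d2 d3 => Ch1.
  by case/eqP: (chirality_neq1 hW hCW fW Gt2 Gt3 E2 E3).
case=> -[/typ[p2 p3] [dv ne]].
  have sN : N \subset <[s2]>.
    apply/subsetP => g /kfac[i [j [-> _ /eqP]]]; rewrite -order_dvdn -p3 order_dvdn => /eqP->.
    by rewrite mulg1 mem_cycle.
  apply: fin; first by rewrite sN.
  by apply: (kernelB sN nN); apply: (ntX s2 t2); rewrite // -p2.
have sN : N \subset <[s3]>.
  apply/subsetP => g /kfac[i [j [-> /eqP + _]]]; rewrite -order_dvdn -p2 order_dvdn => /eqP->.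
  by rewrite mul1g mem_cycle.
apply: fin; first by rewrite sN orbT.
apply: (kernelD sN nN); first by apply: (ntX s3 t3); rewrite // -p3.
rewrite -[s3]expg1 (kX _ t3) // expg1; apply/eqP => t1.
apply: (run2_neq hW fW (isT : letter 3 3) (isT : letter 3 4)) => //.
by rewrite -E3 t1 aut_imset1.
Qed.

End Cover.

End VertexFigure.

Section AtomicVertexFigure.

Variables (T : finType) (le : rel T).
Hypotheses (hP : polytope le 4) (hC : chiral le).
Local Notation autG := (autg_group le).
Variables (F : {set T}) (s1 s2 s3 : {perm T}).
Hypothesis fF : flag le F.
Hypotheses (G1 : s1 \in autG) (G2 : s2 \in autG) (G3 : s3 \in autG).
Hypotheses (e1 : s1 @: F = run le F [:: 3; 2]) (e2 : s2 @: F = run le F [:: 4; 3])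
  (e3 : s3 @: F = run le F [:: 5; 4]).
Hypothesis oG : #|autG| = (#[s1] * #[s2] * #[s3])%N.
Hypothesis atomic : forall (T' : finType) (le' : rel T') (m : nat) (qs : seq nat),
  polytope le' m -> chiral le' -> tight le' m qs -> ~ properly_covers le le'.
Local Notation stab i := (rstab le F i).

Let gen_neq1 (s : {perm T}) i j : letter 4 i -> letter 4 j -> i <> j -> s @: F = run le F [:: j; i] -> s != 1.
Proof.
move=> li lj nij es; apply/eqP => s1'; apply: (run2_neq hP fF li lj nij).
by rewrite -es s1' aut_imset1.
Qed.

(** For [K] inside the facet stabiliser, the alignment condition at facets is immediate, because
    [<[s3]>] meets that stabiliser trivially; the condition at vertices follows from the splitting
    of [K]. *)
Lemma atomic_kernelB : s3 ^+ 2 \in gcore (stab 2) autG ->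
  forall N : {group {perm T}}, N \subset <[s2]> -> N <| stab 2 -> N :!=: 1 ->
  chirality_group s2 s3 \subset N.
Proof.
move=> core3.
have tA := cycle1_stab2_ti hP hC fF G1 e1; have tD := stab5_cycle3_ti hP hC fF G3 e3.
apply: (@chirality_sub_kernel _ s1 s2 s3 (rstab le F 5) (rstab le F 2) (autg_group le)) => //.
- exact: (rel12 hP fF G1 G2 e1 e2).
- exact: (rel23 hP fF G2 G3 e2 e3).
- exact: (rel123 hP fF G1 G2 G3 e1 e2 e3).
- exact: (stab5E hP hC fF G1 G2 G3 e1 e2 e3 oG).
- exact: (stab2E hP hC fF G1 G2 G3 e1 e2 e3 oG).
- exact: (autg_cycle1_stab2 hP hC fF G1 G2 G3 e1 e2 e3 oG).
- by rewrite setIC (stab25 hP hC fF G2 e2).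
- exact: (cycle23_ti hP hC fF G2 G3 e2 e3).
move=> K nK ntK sK5 facK K1 K2.
have sB : <[s2]> \subset stab 2 by rewrite cycle_subG; case/andP: (s2_stab hP fF G2 e2).
have KD : <[s3]> :&: K * stab 5 = 1 by rewrite mulSGid // setIC tD.
apply: (atomic_kernel hP hC fF G1 G2 G3 e1 e2 e3 oG atomic) => //.
- apply/subsetP => a /setIP[Aa /mulsgP[k g Kk g2 ea]].
  have /mulsgP[x y /setIP[Kx Ax] /setIP[_ By] ek] := subsetP facK _ Kk.
  suff -> : a = x by [].
  apply: (mulgI x^-1); rewrite mulVg; apply/set1gP; rewrite -tA inE groupM ?groupV //=.
  by rewrite ea ek -mulgA mulKg; apply: groupM (subsetP sB _ By) g2.
- by rewrite KD sub1G.
apply: contra (gen_neq1 (isT : letter 4 4) (isT : letter 4 5) _ e3) => // K3.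
by apply/eqP/set1gP; rewrite -KD inE cycle_id mulSGid // (subsetP sK5).
Qed.

(** [N] is characteristic in [<[s3]>], which [s1 * s2] normalises by inverting [s3]. As [s2]
    normalises [N] too, so does [s1]. *)
Lemma atomic_kernelD (N : {group {perm T}}) : N \subset <[s3]> -> N <| stab 2 -> N :!=: 1 ->
  s3 \notin N -> chirality_group s2 s3 \subset N.
Proof.
move=> sN nN ntN N3.
have tA := cycle1_stab2_ti hP hC fF G1 e1; have tD := stab5_cycle3_ti hP hC fF G3 e3.
have tBD := cycle23_ti hP hC fF G2 G3 e2 e3.
have /andP[sN2 nN2] := nN; have sNG : N \subset autG := subset_trans sN2 (rstab_sub _ _ _).
have n12 : s1 * s2 \in 'N(N).
  have cN : N \char <[s3]> by rewrite sub_cyclic_char ?cycle_cyclic.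
  have /subsetP := char_norms cN; apply.
  by rewrite inE -cycleJ (s12_inverts_s3 hP fF G1 G2 G3 e1 e2 e3) cycleV.
have n2 : s2 \in 'N(N) by apply: (subsetP nN2); case/andP: (s2_stab hP fF G2 e2).
have n1 : s1 \in 'N(N) by rewrite -(groupMr _ n2).
have nNG : N <| autG.
  by rewrite /normal sNG -(autg_cycle1_stab2 hP hC fF G1 G2 G3 e1 e2 e3 oG) mul_subG ?cycle_subG.
have notN (s : {perm T}) i j : letter 4 i -> letter 4 j -> i <> j -> s @: F = run le F [:: j; i] ->
    <[s]> :&: <[s3]> = 1 -> s \notin N.
  move=> li lj nij es ti; apply: contra (gen_neq1 li lj nij es) => Ns.
  by apply/eqP/set1gP; rewrite -ti inE cycle_id (subsetP sN).
apply: (atomic_kernel hP hC fF G1 G2 G3 e1 e2 e3 oG atomic) => //.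
- by rewrite mulSGid // tA sub1G.
- apply/subsetP => d /setIP[Dd /mulsgP[k g Nk g5 ed]].
  suff -> : d = k by [].
  apply: (mulgI k^-1); rewrite mulVg; apply/set1gP; rewrite -tD inE {1}ed mulKg g5.
  by rewrite groupM ?groupV // (subsetP sN).
- apply: (notN _ 2 3) => //; apply/trivgP; rewrite /= -tA setIS // cycle_subG.
  by case/andP: (s3_stab hP fF G3 e3).
exact: (notN _ 3 4).
Qed.

End AtomicVertexFigure.

(* faces F of rank 3 have rk F = 5; vertices v (rank 0) have rk v = 2 *)
Theorem theorem5p4 (T : finType) (le : rel T) :
  atomic_chiral4 le ->
  (forall F : T, rk le F = 5 -> regular (@facet_le T le F)) ->
  (forall v : T, rk le v = 2 -> chiral (@vfig_le T le v)) ->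
  forall v : T, rk le v = 2 -> atomic_chiral_polyhedron (@vfig_le T le v).
Proof.
move=> [ps [hP hC [hT hN] atomic]] reg vch v rv.
have po := polytope_po hP; have fs := polytope_fs hP.
(* The base flag is taken through [v], so that the stabiliser of [v] is [rstab le F 2]. *)
have [F fF Fv] := flag1 po v.
have [//|//|s1 G1 e1] := @even_gen _ _ _ hP hC F [:: 3; 2] fF.
have [//|//|s2 G2 e2] := @even_gen _ _ _ hP hC F [:: 4; 3] fF.
have [//|//|s3 G3 e3] := @even_gen _ _ _ hP hC F [:: 5; 4] fF.
have oG : #|autg_group le| = (#[s1] * #[s2] * #[s3])%N%g.
  (* The entries of the given type are the orders of the rotations, which turns the flag count into
     the order of the automorphism group. *)
  have eps : ps = [seq #[s]%g | s <- [:: s1; s2; s3]].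
    by apply: (chiral_type_unique hP hC fF _ _ hT) => // -[|[|[|k]]].
  move: hN; rewrite (card_flags hP hC fF) // eps !big_cons big_nil muln1 => /eqP.
  by rewrite eqn_pmul2l // mulnA => /eqP.
have [x5 F5 r5] := @letter_face _ _ _ hP 5 F fF isT.
have core3 := square_in_core hP hC fF G1 G2 G3 e1 e2 e3 oG Fv rv F5 r5 (reg _ r5).
exists #[s2]%g, #[s3]%g; split.
- exact: (vfig_polytope hP fF rv).
- exact: vch.
- exact: (vfig_tight hP hC fF G1 G2 G3 e1 e2 e3 oG Fv rv (vch _ rv)).
move=> W leW p' q' hW hCW typ [eta cov].
apply: (vfig_no_cover hP hC fF G1 G2 G3 e1 e2 e3 oG Fv rv hW hCW cov _ _ typ).
  exact: (atomic_kernelB hP hC fF G1 G2 G3 e1 e2 e3 oG atomic core3).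
exact: (atomic_kernelD hP hC fF G1 G2 G3 e1 e2 e3 oG atomic).
Qed.
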